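(* Let $\widetilde Q$ be a probability distribution on $\mathbb{R}$ with $\int x\,\widetilde Q(dx)=0$, $\int x^2\,\widetilde Q(dx)=1$ and $\int x^4\,\widetilde Q(dx)<\infty$. For each $N\ge 1$ let $\widetilde X_N$ be the $N\times N$ real-symmetric Wigner matrix associated with $\widetilde Q$, let $\widetilde D_N(\lambda):=\det(\widetilde X_N-\lambda)$, and for $\mu,\nu\in\mathbb{R}$ let $$\widetilde\sigma_N(\mu,\nu):=\frac{\mathbb{E}\big((\widetilde D_N(\mu)-\mathbb{E}\widetilde D_N(\mu))(\widetilde D_N(\nu)-\mathbb{E}\widetilde D_N(\nu))\big)}{\sqrt{\mathbb{E}(\widetilde D_N(\mu)-\mathbb{E}\widetilde D_N(\mu))^2}\,\sqrt{\mathbb{E}(\widetilde D_N(\nu)-\mathbb{E}\widetilde D_N(\nu))^2}}.$$ Then for all $\mu,\nu\in\mathbb{R}$, $$\lim_{N\to\infty}\widetilde\sigma_N\!\left(2\sqrt N+\mu/N^{1/6},\,2\sqrt N+\nu/N^{1/6}\right)=\frac{\mathbb{B}(\mu,\nu)}{\sqrt{\mathbb{B}(\mu,\mu)}\,\sqrt{\mathbb{B}(\nu,\nu)}},$$ where $$\mathbb{B}(\mu,\nu):=\frac{(\mu+\nu)\,\mathrm{Ai}(\mu)\,\mathrm{Ai}(\nu)-2\,\mathrm{Ai}'(\mu)\,\mathrm{Ai}'(\nu)}{(\mu-\nu)^2}+\frac{2\,\mathrm{Ai}(\mu)\,\mathrm{Ai}'(\nu)-2\,\mathrm{Ai}'(\mu)\,\mathrm{Ai}(\nu)}{(\mu-\nu)^3},$$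 understood by continuous extension when $\mu=\nu$.
   Context: The $N\times N$ real-symmetric Wigner matrix $\widetilde X_N=(\widetilde X_{ij})_{i,j=1,\dots,N}$ associated with $\widetilde Q$ is defined by $\widetilde X_{ij}:=\widetilde X^{\mathrm{Re}}_{ij}$ for $i<j$, $\widetilde X_{ii}:=\sqrt2\,\widetilde X^{\mathrm{Re}}_{ii}$, and $\widetilde X_{ij}:=\widetilde X^{\mathrm{Re}}_{ji}$ for $i>j$, where $\{\widetilde X^{\mathrm{Re}}_{ij}: i\le j\}$ is a collection of i.i.d. real random variables with distribution $\widetilde Q$. Here $\det(\widetilde X_N-\lambda)$ means $\det(\widetilde X_N-\lambda I_N)$, $\mathbb{E}$ denotes expectation, and $\mathrm{Ai}$ denotes the Airy function. The correlation coefficient $\widetilde\sigma_N(\mu,\nu)$ is defined whenever its denominator is nonzero. *)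

(* Defs.v *)
From HB Require Import structures.
From mathcomp Require Import all_boot all_order all_algebra.
From mathcomp Require Import all_classical all_reals all_analysis.

Set Implicit Arguments.
Unset Strict Implicit.
Unset Printing Implicit Defensive.

Import Order.TTheory GRing.Theory Num.Theory.
Import numFieldNormedType.Exports.

Local Open Scope classical_set_scope.
Local Open Scope ring_scope.

Section independence.
Context d (T : measurableType d) d' (T' : measurableType d') (R : realType).
Context (P : probability T R) (I : finType).

(* The family (X i), i \in D, satisfies the product rule on each subfamily. *)
Definition independent_RVs (D : {set I}) (X : I -> {RV P >-> T'}) : Prop :=
  forall (J : {set I}) (A : I -> set T'), J \subset D ->
    (forall i, measurable (A i)) ->
    P (\bigcap_(i in [set` J]) (X i @^-1` A i))
      = (\prod_(i in J) P (X i @^-1` A i))%E.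

(* Measures are compared on measurable sets only, since their values
   elsewhere carry no meaning. *)
Definition iid_RVs (D : {set I}) (X : I -> {RV P >-> T'})
    (Q : probability T' R) : Prop :=
  independent_RVs D X /\
  forall i, i \in D -> forall A, measurable A -> distribution P (X i) A = Q A.

End independence.

Section wigner.
Context (R : realType) (N : nat).

Definition upper_triangle : {set 'I_N * 'I_N} :=
  finset (fun p : 'I_N * 'I_N => (p.1 <= p.2)%N).

(* Only the entries of x indexed by upper_triangle are used. *)
Definition wigner_mx (x : 'I_N * 'I_N -> R) : 'M[R]_N :=
  \matrix_(i, j) if (i < j)%N then x (i, j)
                 else if i == j then Num.sqrt 2 * x (i, i)
                 else x (j, i).

Definition char_det (A : 'M[R]_N) (lambda : R) : R := \det (A - lambda%:M).

End wigner.

Definition correlation d (T : measurableType d) (R : realType)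
    (P : probability T R) (X Y : T -> R) : R :=
  fine (covariance P X Y)
    / (Num.sqrt (fine 'V_P[X]%E) * Num.sqrt (fine 'V_P[Y]%E)).

Section airy.
Context (R : realType).
Local Notation mu := (@lebesgue_measure R).

(* Ai x = 1/pi * \int_0^oo cos (t^3/3 + x t) dt, which converges only
   conditionally, hence as an improper integral. *)
Definition Ai (x : R) : R :=
  pi^-1 * lim ((\int[mu]_(t in `[0, b]) cos (t ^+ 3 / 3 + x * t))
                 @[b --> +oo]).

Definition airyB_offdiag (x y : R) : R :=
  ((x + y) * Ai x * Ai y - 2 * derive1 Ai x * derive1 Ai y) / (x - y) ^+ 2
  + (2 * Ai x * derive1 Ai y - 2 * derive1 Ai x * Ai y) / (x - y) ^+ 3.

Definition airyB (x y : R) : R :=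
  if x == y then
    lim (airyB_offdiag p.1 p.2
           @[p --> within [set q : R * R | q.1 != q.2] (nbhs (x, y))])
  else airyB_offdiag x y.

End airy.

(* Main.v *)
(* The covariance of two characteristic determinants involves the entries only
   through their moments of order at most 4, so the law Q may be replaced by a
   signed measure on {-2, -1, 0, 1, 2} with the same moments. Expanding along
   one row and column gives a closed system of recursions for the means of
   products of \det, \tr \adj, ... of the two matrices, solved by
     Cov (D_N(x), D_N(y)) = N! \sum_(k < N) c_(N-k) He_k(x) He_k(y) / k!,
   where \sum_j c_j z^j = exp (b z^2) / (1 - z)^2 and b = (E X^4 - 3) / 2.
   Write He_k as a Gaussian integral of (c + i t)^k, with abscissa
   c = N^(1/2) exp (N^(-1/3)). For x = 2 N^(1/2) + mu / N^(1/6) and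
   k = N - j, j ~ u N^(1/3), it converges after normalisation to Ai (mu + u),
   and c_j ~ exp (b) j. By dominated convergence the sum, seen as the integral
   of a step function, tends up to factors cancelling in the correlation to
     \int_0^oo u Ai (mu + u) Ai (nu + u) du,
   which is B (mu, nu) because Ai'' (x) = x Ai (x). *)
Require Import Defs.
From HB Require Import structures.
From mathcomp Require Import all_boot all_order all_algebra.
From mathcomp Require Import all_classical all_reals all_analysis.
From mathcomp Require Import finmap perm measurable_realfun.
From mathcomp Require Import ring lra.
From mathcomp Require Import zify.

Set Implicit Arguments.
Unset Strict Implicit.
Unset Printing Implicit Defensive.

Import Order.TTheory GRing.Theory Num.Theory.
Import numFieldNormedType.Exports.

Local Open Scope classical_set_scope.
Local Open Scope ring_scope.

(** * Quadrature functionals and moments *)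

(** At the edge the two saddle points of w^k exp ((w - x)^2 / 2) merge at N^(1/2), which would call
    for a delicate steepest descent. A line about N^(1/6) to the right of that point avoids it: on w
    = c + i N^(1/6) t the inequality ln (1 + y^2) <= y^2 alone bounds the normalised integrand by
    exp (- t^2 / 3), for all k <= N and all spectral points at once, and its pointwise limit is the
    Airy integrand on the line of height 1. The exponential in c makes N / c^2 = exp (- 2 N^(-1/3))
    exact, so the summand k = N - j carries exp (- 2 j N^(-1/3)). This factor dominates the sum, and
    its limit exp (- 2 u) supplies the two factors exp (- u) that turn the height-1 integrals into
    Ai (mu + u) and Ai (nu + u). Only the means of one determinant and of a product of two are
    transferred from Q to the signed measure; the other means of the recursions live in finite sums,
    where nothing has to be integrable. Complex integrals are handled by real and imaginary parts:
    Cauchy's theorem becomes differentiation in the height of the line, and the Hermite formula is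
    proved by its recursion. *)

Section quadrature.
Context (R : realType) (K : finType) (wt node : K -> R).

(* Integration of functions of (x p)_{p : J} against the product of (signed)
   copies of the discrete measure \sum_k wt k * delta_(node k). *)
Definition qE (J : finType) (F : (J -> R) -> R) : R :=
  \sum_(w : {ffun J -> K}) (\prod_p wt (w p)) * F (fun p => node (w p)).

Definition qE1 (g : R -> R) : R := \sum_k wt k * g (node k).

Definition mom (e : nat) : R := qE1 (fun y => y ^+ e).

(** The mean of the monomial spelled by s: by independence each letter contributes the moment whose
    order is its multiplicity, and an absent letter contributes 1 once the weights sum to 1. *)
Definition mword (I : finType) (s : seq I) : R := \prod_p mom (count_mem p s).

Lemma qED (J : finType) (F G : (J -> R) -> R) :
  qE (fun x => F x + G x) = qE F + qE G.
Proof. by rewrite -big_split; apply: eq_bigr => w _; rewrite mulrDr. Qed.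

Lemma qEZ (J : finType) (c : R) (F : (J -> R) -> R) :
  qE (fun x => c * F x) = c * qE F.
Proof. by rewrite mulr_sumr; apply: eq_bigr => w _; rewrite mulrCA. Qed.

Lemma qEN (J : finType) (F : (J -> R) -> R) : qE (fun x => - F x) = - qE F.
Proof. by rewrite /qE -sumrN; apply: eq_bigr => w _; rewrite mulrN. Qed.

Lemma qEB (J : finType) (F G : (J -> R) -> R) :
  qE (fun x => F x - G x) = qE F - qE G.
Proof. by rewrite qED qEN. Qed.

Lemma qE_sum (J : finType) (T : finType) (F : T -> (J -> R) -> R) :
  qE (fun x => \sum_t F t x) = \sum_t qE (F t).
Proof. by rewrite exchange_big; apply: eq_bigr => w _; rewrite mulr_sumr. Qed.

Lemma eq_qE (J : finType) (F G : (J -> R) -> R) : F =1 G -> qE F = qE G.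
Proof. by move=> FG; apply: eq_bigr => w _; rewrite FG. Qed.

Lemma qE_prod (J : finType) (q : J -> R -> R) :
  qE (fun x => \prod_p q p (x p)) = \prod_p qE1 (q p).
Proof.
rewrite /qE1 bigA_distr_bigA; apply: eq_bigr => w _.
by rewrite -big_split.
Qed.

Hypothesis wt1 : \sum_k wt k = 1.

(** Independence for a product functional. Configurations on I are grouped by their restriction
    along [iota]; each group is a product set, so its sum factors. Coordinates on the range of
    [iota] carry the weight of the restriction, the others reproduce [qE1 (q p)]. *)
Lemma qE_split (I J : finType) (iota : J -> I) (q : I -> R -> R)
    (Y : (J -> R) -> R) : injective iota ->
    (forall j, q (iota j) = fun=> 1) ->
  qE (fun x => (\prod_p q p (x p)) * Y (x \o iota)) =
  (\prod_p qE1 (q p)) * qE Y.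
Proof.
move=> iinj q1.
rewrite [RHS]mulr_sumr.
rewrite {1}/qE (partition_big (fun w : {ffun I -> K} => [ffun j => w (iota j)]) predT)//=.
apply: eq_bigr => w' _.
(* The nodes allowed at p within the group of w': the prescribed one if p is in the range of [iota],
   and any node otherwise, the condition being vacuous. *)
pose Q p k := [forall j, (iota j == p) ==> (k == w' j)].
transitivity ((\sum_(w in family Q) \prod_p (wt (w p) * q p (node (w p)))) *
              Y (fun p => node (w' p))).
  rewrite mulr_suml; apply: eq_big => w.
    apply/eqP/familyP => [E p | H].
      by apply/forallP => j; apply/implyP => /eqP <-; rewrite -E ffunE.
    apply/ffunP => j; rewrite ffunE.
    by have /forallP/(_ j) := H (iota j); rewrite eqxx => /eqP.
  move=> /eqP <-; rewrite big_split/= mulrA; congr (_ * Y _).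
  by apply/funext => j /=; rewrite ffunE.
rewrite -(bigA_distr_big_dep Q (fun p k => wt k * q p (node k))) mulrA; congr (_ * _).
rewrite (bigID (fun p => p \in codom iota))/= mulrC.
rewrite [X in _ = X * _](bigID (fun p => p \in codom iota))/=.
rewrite [X in _ = X * _ * _]big1 ?mul1r; last first.
  move=> _ /codomP[j ->]; rewrite q1 /qE1.
  by under eq_bigr do rewrite mulr1.
congr (_ * _).
  apply: eq_bigr => p np; apply: eq_bigl => k; apply/forallP => j.
  by apply/implyP => /eqP jp; case/negP: np; rewrite -jp codom_f.
rewrite (eq_bigl (mem [set iota j | j : J])%SET); last first.
  move=> p; apply/codomP/imsetP => [[j ->]|[j _ ->]]; by exists j.
rewrite big_imset /=; last by move=> ? ? _ _; exact: iinj.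
rewrite (eq_bigl xpredT) => [|?]; last by rewrite inE.
apply: eq_bigr => j _.
rewrite (big_pred1 (w' j)) ?q1 ?mulr1// => k.
apply/forallP/eqP => [/(_ j)|-> j']; first by rewrite eqxx => /eqP.
by apply/implyP => /eqP/iinj ->.
Qed.

Lemma mom0 : mom 0 = 1.
Proof. by rewrite /mom /qE1; under eq_bigr do rewrite expr0 mulr1. Qed.

Lemma qE_word (I J : finType) (iota : J -> I) (s : seq I) (Y : (J -> R) -> R) :
    injective iota -> (forall j, iota j \notin s) ->
  qE (fun x => (\prod_(p <- s) x p) * Y (x \o iota)) = mword s * qE Y.
Proof.
move=> iinj ns.
rewrite -(@qE_split I J iota (fun p y => y ^+ count_mem p s))//; last first.
  move=> j; apply/funext => y.
  by have /count_memPn -> := ns j.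
apply: eq_qE => x; congr (_ * _).
elim: s {ns} => [|a s IH]; first by rewrite big_nil big1.
rewrite big_cons IH /= [RHS](eq_bigr (fun p => x p ^+ (a == p) * x p ^+ count_mem p s)).
  rewrite big_split [X in _ = X * _](bigD1 a)//= eqxx expr1 [X in _ = _ * X * _]big1 ?mulr1// => p.
  by rewrite eq_sym => /negPf ->.
by move=> p _; rewrite exprD.
Qed.

Lemma mword_nil (I : finType) : mword ([::] : seq I) = 1.
Proof. by rewrite /mword big1// => p _; exact: mom0. Qed.

Lemma qE_marg (I J : finType) (iota : J -> I) (Y : (J -> R) -> R) :
  injective iota -> qE (fun x => Y (x \o iota)) = qE Y.
Proof.
move=> iinj; rewrite -[RHS]mul1r -(mword_nil I) -(@qE_word _ _ iota)//.
by apply: eq_qE => x; rewrite big_nil mul1r.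
Qed.

Lemma mword_perm (I : finType) (s t : seq I) : perm_eq s t -> mword s = mword t.
Proof. by move=> /seq.permP st; apply: eq_bigr => p _; rewrite st. Qed.

Lemma mword_nseq (I : finType) (a : I) (e : nat) (s : seq I) : a \notin s ->
  mword (nseq e a ++ s) = mom e * mword s.
Proof.
move=> /count_memPn a_s; rewrite /mword (bigD1 a)//= [in RHS](bigD1 a)//= a_s.
rewrite count_cat count_nseq /= eqxx mul1n a_s addn0 mom0 mul1r; congr (_ * _).
apply: eq_bigr => p /negPf pa.
by rewrite count_cat count_nseq /= eq_sym pa mul0n add0n.
Qed.

Hypotheses (mom1 : mom 1 = 0) (mom2 : mom 2 = 1).

Lemma mword_lonely (I : finType) (a : I) (s : seq I) :
  count_mem a s = 1%N -> mword s = 0.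
Proof. by move=> cs; rewrite /mword (bigD1 a)//= cs mom1 mul0r. Qed.

Lemma mword1 (I : finType) (p : I) : mword [:: p] = 0.
Proof. by apply: (@mword_lonely _ p); rewrite /= eqxx. Qed.

Lemma mword2 (I : finType) (p q : I) : mword [:: p; q] = (p == q)%:R.
Proof.
have [<-|pq] := eqVneq p q; last first.
  by apply: (@mword_lonely _ p); rewrite /= eqxx eq_sym (negPf pq).
by rewrite -[[:: p; p]]/(nseq 2 p ++ [::]) mword_nseq// mom2 mword_nil mulr1.
Qed.

(** Wick's formula: the three pairings, plus the fourth cumulant [mom 4 - 3] where all letters
    coincide. A letter occurring exactly three times leaves the fourth alone with mean 0, which is
    why the third moment never appears. *)
Lemma mword4 (I : finType) (p q r t : I) :
  mword [:: p; q; r; t] =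
    (p == q)%:R * (r == t)%:R + (p == r)%:R * (q == t)%:R
    + (p == t)%:R * (q == r)%:R
    + (mom 4 - 3) * ((p == q)%:R * (p == r)%:R * (p == t)%:R).
Proof.
have lone (a : I) s : count_mem a s = 1%N -> mword s = 0 := @mword_lonely I a s.
have pair (a b : I) : a != b -> mword [:: a; a; b; b] = 1.
  move=> ab; rewrite -[X in mword X]/(nseq 2 a ++ [:: b; b]) mword_nseq.
    by rewrite mom2 mul1r mword2 eqxx.
  by rewrite !inE negb_or ab.
have [<-|pq] := eqVneq p q.
  have [<-|rt] := eqVneq r t.
    have [<-|pr] := eqVneq p r; last by rewrite pair// /=; ring.
    rewrite -[X in mword X]/(nseq 4 p ++ [::]) mword_nseq// mword_nil.
    rewrite /=; ring.
  have [prE|pr] := eqVneq p r.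
    rewrite (lone t) ?prE ?(negPf rt) /=; first ring.
    by rewrite eqxx (negPf rt).
  rewrite (lone r) /= ?(negPf pr) ?(eq_sym t) ?(negPf rt) ?eqxx; [ring|by []].
have [<-|pr] := eqVneq p r.
  rewrite (@mword_perm _ _ [:: p; p; q; t]); last first.
    by rewrite perm_cons -[[:: q; p; t]]/([:: q] ++ [:: p] ++ [:: t]) perm_catCA.
  have [<-|qt] := eqVneq q t.
    by rewrite pair// ?[q == p]eq_sym ?(negPf pq) /=; ring.
  rewrite (lone q) /=; first by rewrite ?[q == p]eq_sym ?(negPf pq) /=; ring.
  by rewrite eqxx (negPf pq) eq_sym (negPf qt).
have [<-|pt] := eqVneq p t.
  rewrite (@mword_perm _ _ [:: p; p; q; r]); last first.
    by rewrite perm_cons -[[:: q; r; p]]/([:: q; r] ++ [:: p]) perm_catC.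
  have [<-|qr] := eqVneq q r.
    by rewrite pair// /=; ring.
  rewrite (lone q) /=; first ring.
  by rewrite eqxx (negPf pq) eq_sym (negPf qr).
rewrite (lone p) /=; first ring.
by rewrite eqxx !(eq_sym _ p) (negPf pq) (negPf pr) (negPf pt).
Qed.

End quadrature.

(** * Cofactor expansions around one index *)

Definition minor (T : Type) n (i : 'I_n.+1) (M : 'M[T]_n.+1) : 'M[T]_n :=
  row' i (col' i M).

Lemma minorE (T : Type) n (i : 'I_n.+1) (M : 'M[T]_n.+1) k l :
  minor i M k l = M (lift i k) (lift i l).
Proof. by rewrite !mxE. Qed.

(** Deleting two indices in either order leaves the same set; i' is the position of i once
    [lift i k] is gone. The parity turns the product of two cofactor signs into minus the sign of a
    cofactor of the minor. *)
Lemma double_lift n (i : 'I_n.+2) (k : 'I_n.+1) : exists i' : 'I_n.+1,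
  [/\ lift (lift i k) i' = i,
      forall l : 'I_n, lift (lift i k) (lift i' l) = lift i (lift k l)
    & odd (i + lift i k + i' + k)].
Proof.
have [ik|ki] := leqP i k.
  have liftE : lift i k = k.+1 :> nat by rewrite /= /bump ik.
  exists (Ordinal (leq_ltn_trans ik (ltn_ord k))); split.
  - by apply: val_inj; rewrite /= /bump ik add1n ltnNge ik.
  - by move=> l; apply: val_inj; rewrite /= /bump; lia.
  - by rewrite liftE /=; lia.
have i'P : (i.-1 < n.+1)%N by case: i ki => i /=; lia.
have liftE : lift i k = k :> nat by rewrite /= /bump leqNgt ki.
exists (Ordinal i'P); split.
- by apply: val_inj; rewrite /= /bump; lia.
- by move=> l; apply: val_inj; rewrite /= /bump; lia.
- by rewrite liftE /=; lia.
Qed.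

Section bordered.
Context (R : comPzRingType).
Implicit Types n : nat.

Lemma signr_odd_add (a b : nat) : odd (a + b) -> (-1) ^+ a = - (-1) ^+ b :> R.
Proof.
rewrite oddD -[(-1) ^+ a]signr_odd -[(-1) ^+ b]signr_odd.
by case: (odd a); case: (odd b) => //= _; rewrite ?expr0 ?expr1 ?opprK.
Qed.

(** Expansion along row i, then of each off-diagonal minor along what remains of column i. It
    isolates the entries that, for a Wigner matrix, are independent of [minor i M]. *)
Lemma det_bordered n (i : 'I_n.+1) (M : 'M[R]_n.+1) :
  \det M = M i i * \det (minor i M)
    - \sum_k \sum_l M i (lift i k) * M (lift i l) i * \adj (minor i M) k l.
Proof.
rewrite (expand_det_row M i) (bigD1_ord i)//=; congr (_ + _).
  by rewrite /cofactor addnn -signr_odd odd_double mul1r.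
rewrite -sumrN; apply: eq_bigr => k _.
case: n => [|n] in i M k *; first by case: k.
have [i' [ii' ll' odd_i]] := double_lift i k.
rewrite /cofactor (expand_det_col _ i') !mulr_sumr -sumrN.
apply: eq_bigr => l _.
rewrite [\adj _ _ _]mxE /cofactor !mxE ii'.
rewrite (_ : row' l (col' i' _) = row' l (col' k (minor i M))); last first.
  by apply/matrixP => a b; rewrite !mxE ll'.
set D := \det _.
transitivity (M i (lift i k) * M (lift i l) i * D *
   ((-1) ^+ (i + lift i k + (l + i')))); first by rewrite !exprD; ring.
rewrite (@signr_odd_add _ (l + k)); first ring.
by move: (lift i k : nat) odd_i => L; lia.
Qed.

Lemma adj_minor n (i : 'I_n.+1) (M : 'M[R]_n.+1) : \adj M i i = \det (minor i M).
Proof. by rewrite mxE /cofactor addnn -signr_odd odd_double mul1r. Qed.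

Lemma mxtrace_adj n (M : 'M[R]_n.+1) : \tr (\adj M) = \sum_i \det (minor i M).
Proof. by apply: eq_bigr => i _; exact: adj_minor. Qed.

(** Linearity in row i is the point: the mean of a product of two such entries needs second moments
    only. *)
Lemma adj_bordered n (i : 'I_n.+1) (k : 'I_n) (M : 'M[R]_n.+1) :
  \adj M i (lift i k) = - \sum_l M i (lift i l) * \adj (minor i M) l k.
Proof.
case: n => [|n] in i M k *; first by case: k.
have [i' [ii' ll' odd_i]] := double_lift i k.
rewrite mxE /cofactor (expand_det_row _ i') mulr_sumr -sumrN.
apply: eq_bigr => l _.
rewrite [\adj _ _ _]mxE /cofactor !mxE ii'.
rewrite (_ : row' i' (col' l _) = row' k (col' l (minor i M))); last first.
  by apply/matrixP => a b; rewrite !mxE ll'.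
set D := \det _.
transitivity (M i (lift i l) * D *
   ((-1) ^+ (lift i k + i + (i' + l)))); first by rewrite !exprD; ring.
rewrite (@signr_odd_add _ (k + l)); first ring.
by move: (lift i k : nat) odd_i => L; lia.
Qed.

(* The second derivative of \det (M + t) at t = 0. *)
Definition adj2 n (M : 'M[R]_n) : R :=
  match n return 'M[R]_n -> R with
  | 0 => fun=> 0
  | n'.+1 => fun M => \sum_k \tr (\adj (minor k M))
  end M.

(** The trace sums the principal minors. Deleting i itself leaves [\det (minor i M)]; any other
    principal minor still contains i and is expanded there by [det_bordered]. *)
Lemma mxtrace_adj_bordered n (i : 'I_n.+2) (M : 'M[R]_n.+2) :
  \tr (\adj M) = \det (minor i M) +
    \sum_k (M i i * \det (minor k (minor i M))
      - \sum_l \sum_m M i (lift i (lift k l)) * M (lift i (lift k m)) i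
          * \adj (minor k (minor i M)) l m).
Proof.
rewrite mxtrace_adj (bigD1_ord i)//=; congr (_ + _).
apply: eq_bigr => k _.
have [i' [ii' ll' _]] := double_lift i k.
rewrite (det_bordered i').
rewrite (_ : minor i' _ = minor k (minor i M)); last first.
  by apply/matrixP => a b; rewrite !minorE !ll'.
rewrite !minorE !ii'; congr (_ - _).
by apply: eq_bigr => l _; apply: eq_bigr => m _; rewrite !minorE !ii' !ll'.
Qed.

End bordered.

(** * Minors of a shifted Wigner matrix and means over one row *)

Section wigner_minors.
Context (R : realType).
Implicit Types (n : nat) (la : R).

Definition charm n la (x : 'I_n * 'I_n -> R) : 'M[R]_n := wigner_mx x - la%:M.

Definition liftp n (i : 'I_n.+1) (p : 'I_n * 'I_n) : 'I_n.+1 * 'I_n.+1 :=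
  (lift i p.1, lift i p.2).

(** [wigner_mx] reads both symmetric entries joining i and [lift i k] from the variable above the
    diagonal; this is the index of that variable. *)
Definition row_index n (i : 'I_n.+1) (k : 'I_n) : 'I_n.+1 * 'I_n.+1 :=
  if (i < lift i k)%N then (i, lift i k) else (lift i k, i).

Lemma liftp_inj n (i : 'I_n.+1) : injective (liftp i).
Proof. move=> [a b] [c e] E; congr pair; apply: (@lift_inj _ i).
  exact: (congr1 fst E).
exact: (congr1 snd E). Qed.

Lemma row_index_inj n (i : 'I_n.+1) : injective (row_index i).
Proof.
move=> k l; rewrite /row_index; case: ifP => _; case: ifP => _ E.
- exact: (lift_inj (congr1 snd E)).
- by have /eqP := congr1 fst E; rewrite /= (negPf (neq_lift _ _)).
- by have /eqP := congr1 snd E; rewrite /= (negPf (neq_lift _ _)).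
- exact: (lift_inj (congr1 fst E)).
Qed.

Lemma row_index_diag n (i : 'I_n.+1) k : (row_index i k == (i, i)) = false.
Proof.
rewrite /row_index; case: ifP => _; rewrite xpair_eqE eqxx ?andbT /=.
  by rewrite eq_sym (negPf (neq_lift _ _)).
by rewrite eq_sym (negPf (neq_lift _ _)).
Qed.

Lemma liftp_row n (i : 'I_n.+1) j k : (liftp i j == row_index i k) = false.
Proof.
rewrite /row_index /liftp; case: ifP => _; rewrite xpair_eqE /=.
  by rewrite eq_sym (negPf (neq_lift _ _)).
by rewrite [X in _ && X]eq_sym (negPf (neq_lift _ _)) andbF.
Qed.

Lemma liftp_diag n (i : 'I_n.+1) j : (liftp i j == (i, i)) = false.
Proof.
by rewrite xpair_eqE eq_sym (negPf (neq_lift _ _)).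
Qed.

(** [lift i] preserves the order of indices, so a minor is again a shifted Wigner matrix, in fewer
    variables. This is what closes the recursions under deletion of an index. *)
Lemma minor_charm n la (i : 'I_n.+1) (x : 'I_n.+1 * 'I_n.+1 -> R) :
  minor i (charm la x) = charm la (x \o liftp i).
Proof.
apply/matrixP => k l; rewrite !mxE /liftp (inj_eq lift_inj).
by have -> : (lift i k < lift i l)%N = (k < l)%N by rewrite /= /bump; lia.
Qed.

Lemma charm_diag n la (i : 'I_n) (x : 'I_n * 'I_n -> R) :
  charm la x i i = Num.sqrt 2 * x (i, i) - la.
Proof. by rewrite !mxE ltnn eqxx. Qed.

Lemma charm_row n la (i : 'I_n.+1) k (x : 'I_n.+1 * 'I_n.+1 -> R) :
  charm la x i (lift i k) = x (row_index i k).
Proof.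
by rewrite !mxE /row_index (negPf (neq_lift _ _)) mulr0n subr0; case: ifP.
Qed.

Lemma wigner_mx_sym n (x : 'I_n * 'I_n -> R) : (wigner_mx x)^T = wigner_mx x.
Proof.
apply/matrixP => i j; rewrite !mxE -!val_eqE /=.
by case: (ltngtP i j) => [//|//|/val_inj ->].
Qed.

Lemma charm_sym n la (x : 'I_n * 'I_n -> R) : (charm la x)^T = charm la x.
Proof. by rewrite /charm linearB /= wigner_mx_sym tr_scalar_mx. Qed.

Lemma charm_col n la (i : 'I_n.+1) k (x : 'I_n.+1 * 'I_n.+1 -> R) :
  charm la x (lift i k) i = x (row_index i k).
Proof. by rewrite -[in LHS]charm_sym mxE charm_row. Qed.

Lemma adj_charm_sym n la (x : 'I_n * 'I_n -> R) i j :
  \adj (charm la x) i j = \adj (charm la x) j i.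
Proof. by rewrite -[in LHS]charm_sym -trmx_adj mxE. Qed.

End wigner_minors.

Section row_expectation.
Context (R : realType) (K : finType) (wt node : K -> R).
Hypothesis wt1 : \sum_k wt k = 1.
Hypothesis mom1 : mom wt node 1 = 0.
Hypothesis mom2 : mom wt node 2 = 1.
Local Notation qE := (qE wt node).
Local Notation m4 := (mom wt node 4).
Context (n : nat) (i : 'I_n.+1).
Implicit Types (Y Z : ('I_n * 'I_n -> R) -> R) (x : 'I_n.+1 * 'I_n.+1 -> R).
Local Notation v := (row_index i).

Lemma qE_row0 Y : qE (fun x => Y (x \o liftp i)) = qE Y.
Proof. by apply: qE_marg => //; exact: liftp_inj. Qed.

Lemma qE_row1d Y : qE (fun x => x (i, i) * Y (x \o liftp i)) = 0.
Proof.
transitivity (qE (fun x => (\prod_(p <- [:: (i, i)]) x p) * Y (x \o liftp i))).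
  by apply: eq_qE => x; rewrite big_seq1.
rewrite qE_word ?mword1 ?mul0r//; first exact: liftp_inj.
by move=> j; rewrite inE liftp_diag.
Qed.

Lemma qE_row2d Y : qE (fun x => x (i, i) * x (i, i) * Y (x \o liftp i)) = qE Y.
Proof.
transitivity (qE (fun x => (\prod_(p <- [:: (i, i); (i, i)]) x p) * Y (x \o liftp i))).
  by apply: eq_qE => x; rewrite big_cons big_seq1.
rewrite qE_word ?mword2 ?eqxx ?mul1r//; first exact: liftp_inj.
by move=> j; rewrite !inE liftp_diag.
Qed.

Lemma qE_row2 k l Y :
  qE (fun x => x (v k) * x (v l) * Y (x \o liftp i)) = (k == l)%:R * qE Y.
Proof.
transitivity (qE (fun x => (\prod_(p <- [:: v k; v l]) x p) * Y (x \o liftp i))).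
  by apply: eq_qE => x; rewrite big_cons big_seq1.
rewrite qE_word//; [|exact: liftp_inj|by move=> j; rewrite !inE !liftp_row].
by rewrite mword2// (inj_eq (@row_index_inj _ _)).
Qed.

Lemma qE_row3 k l Y :
  qE (fun x => x (i, i) * (x (v k) * x (v l)) * Y (x \o liftp i)) = 0.
Proof.
transitivity (qE (fun x => (\prod_(p <- [:: (i, i); v k; v l]) x p)
    * Y (x \o liftp i))).
  by apply: eq_qE => x; rewrite !big_cons big_nil mulr1.
rewrite qE_word//; [|exact: liftp_inj|].
  by rewrite (@mword_lonely _ _ _ _ mom1 _ (i, i)) ?mul0r//= eqxx !row_index_diag.
by move=> j; rewrite !inE !liftp_row liftp_diag.
Qed.

Lemma qE_row4 k l a b Y :
  qE (fun x => x (v k) * x (v l) * (x (v a) * x (v b)) * Y (x \o liftp i)) =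
  ((k == l)%:R * (a == b)%:R + (k == a)%:R * (l == b)%:R
    + (k == b)%:R * (l == a)%:R
    + (m4 - 3) * ((k == l)%:R * (k == a)%:R * (k == b)%:R)) * qE Y.
Proof.
transitivity (qE (fun x => (\prod_(p <- [:: v k; v l; v a; v b]) x p)
    * Y (x \o liftp i))).
  by apply: eq_qE => x; rewrite !big_cons big_nil mulr1 -!mulrA.
rewrite qE_word//; [|exact: liftp_inj|by move=> j; rewrite !inE !liftp_row].
by rewrite mword4// !(inj_eq (@row_index_inj _ _)).
Qed.

Lemma sum_delta (T : finType) (k : T) (F : T -> R) :
  \sum_l (k == l)%:R * F l = F k.
Proof.
rewrite (bigD1 k)//= eqxx mul1r big1 ?addr0// => l.
by rewrite eq_sym => /negPf ->; rewrite mul0r.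
Qed.

Lemma qE_rowquad (Y : 'I_n -> 'I_n -> ('I_n * 'I_n -> R) -> R) :
  qE (fun x => \sum_k \sum_l x (v k) * x (v l) * Y k l (x \o liftp i)) =
  qE (fun y => \sum_k Y k k y).
Proof.
rewrite !qE_sum; apply: eq_bigr => k _; rewrite qE_sum.
under eq_bigr do rewrite qE_row2.
exact: sum_delta.
Qed.

Lemma qE_rowdquad (Y : 'I_n -> 'I_n -> ('I_n * 'I_n -> R) -> R) :
  qE (fun x => \sum_k \sum_l x (i, i) * (x (v k) * x (v l)) * Y k l (x \o liftp i))
  = 0.
Proof.
rewrite qE_sum big1// => k _; rewrite qE_sum big1// => l _.
exact: qE_row3.
Qed.

(** Of the three pairings in [mword4], one gives the product of traces and the two crossed ones
    agree because D is symmetric, whence the factor 2; the fourth cumulant gives the diagonal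
    sum. *)
Lemma qE_rowquartic (C D : ('I_n * 'I_n -> R) -> 'M[R]_n) :
    (forall y k l, D y k l = D y l k) ->
  qE (fun x => (\sum_k \sum_l x (v k) * x (v l) * C (x \o liftp i) k l)
             * (\sum_a \sum_b x (v a) * x (v b) * D (x \o liftp i) a b)) =
  qE (fun y => \tr (C y) * \tr (D y) + 2 * (\sum_k \sum_l C y k l * D y k l)
             + (m4 - 3) * (\sum_k C y k k * D y k k)).
Proof.
move=> Dsym.
transitivity (\sum_k \sum_l \sum_a \sum_b
  ((k == l)%:R * (a == b)%:R + (k == a)%:R * (l == b)%:R
    + (k == b)%:R * (l == a)%:R
    + (m4 - 3) * ((k == l)%:R * (k == a)%:R * (k == b)%:R))
  * qE (fun y => C y k l * D y a b)).
  rewrite -(@eq_qE _ _ _ _ _ (fun x => \sum_k \sum_l \sum_a \sum_b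
      x (v k) * x (v l) * (x (v a) * x (v b)) *
      (C (x \o liftp i) k l * D (x \o liftp i) a b))); last first.
    move=> x; rewrite mulr_suml; apply: eq_bigr => k _.
    rewrite mulr_suml; apply: eq_bigr => l _.
    rewrite mulr_sumr; apply: eq_bigr => a _.
    rewrite mulr_sumr; apply: eq_bigr => b _; ring.
  rewrite qE_sum; apply: eq_bigr => k _.
  rewrite qE_sum; apply: eq_bigr => l _.
  rewrite qE_sum; apply: eq_bigr => a _.
  rewrite qE_sum; apply: eq_bigr => b _.
  exact: (qE_row4 k l a b (fun y => C y k l * D y a b)).
transitivity (\sum_k \sum_a qE (fun y => C y k k * D y a a)
  + 2 * (\sum_k \sum_l qE (fun y => C y k l * D y k l))
  + (m4 - 3) * \sum_k qE (fun y => C y k k * D y k k)); last first.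
  rewrite !qED !qEZ; congr (_ + 2 * _ + _ * _).
  - rewrite -(@eq_qE _ _ _ _ _ (fun y => \sum_k \sum_l C y k k * D y l l)).
      by rewrite qE_sum; apply: eq_bigr => k _; rewrite qE_sum.
    by move=> y; rewrite /mxtrace mulr_suml; apply: eq_bigr => k _; rewrite mulr_sumr.
  - by rewrite qE_sum; apply: eq_bigr => k _; rewrite qE_sum.
  - by rewrite qE_sum.
move: (m4 - 3) => k4.
set S := fun k l a b => qE (fun y => C y k l * D y a b).
transitivity (\sum_k \sum_l ((k == l)%:R * (\sum_a S k l a a)
  + S k l k l + S k l l k + (k == l)%:R * (k4 * S k l k k))).
  apply: eq_bigr => k _; apply: eq_bigr => l _.
  under eq_bigr => a _ do under eq_bigr => b _ do rewrite !mulrDl.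
  under eq_bigr => a _ do rewrite !big_split.
  rewrite !big_split; congr (_ + _ + _ + _).
  - rewrite mulr_sumr; apply: eq_bigr => a _.
    rewrite -(sum_delta a (fun b => S k l a b)) mulr_sumr.
    by apply: eq_bigr => b _; rewrite -mulrA.
  - rewrite -[RHS](sum_delta k (fun a => S k l a l)); apply: eq_bigr => a _.
    rewrite -(sum_delta l (fun b => S k l a b)) mulr_sumr.
    by apply: eq_bigr => b _; rewrite -mulrA.
  - rewrite exchange_big -[RHS](sum_delta k (fun b => S k l l b)).
    apply: eq_bigr => b _.
    rewrite -(sum_delta l (fun a => S k l a b)) mulr_sumr.
    by apply: eq_bigr => a _; rewrite -mulrA.
  - rewrite -[S k l k k](sum_delta k (fun a => S k l a k)) !mulr_sumr.
    apply: eq_bigr => a _.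
    rewrite -(sum_delta k (fun b => S k l a b)) !mulr_sumr.
    by apply: eq_bigr => b _; rewrite /S; ring.
under eq_bigr => k _ do rewrite !big_split !sum_delta.
rewrite !big_split /= -mulr_sumr.
have -> : \sum_k \sum_l S k l l k = \sum_k \sum_l S k l k l.
  apply: eq_bigr => k _; apply: eq_bigr => l _.
  by apply: eq_qE => y; rewrite Dsym.
ring.
Qed.

End row_expectation.

Section expansions.
Context (R : realType) (K : finType) (wt node : K -> R).
Hypothesis wt1 : \sum_k wt k = 1.
Hypothesis mom1 : mom wt node 1 = 0.
Hypothesis mom2 : mom wt node 2 = 1.
Local Notation qE := (qE wt node).
Local Notation m4 := (mom wt node 4).
Local Notation sqrt2 := (Num.sqrt 2 : R).

Section one_vertex.
Context (n : nat) (i : 'I_n.+1).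
Implicit Types (Y : ('I_n * 'I_n -> R) -> R) (x : 'I_n.+1 * 'I_n.+1 -> R).
Local Notation v := (row_index i).

Definition rowq (C : 'M[R]_n) x : R := \sum_k \sum_l x (v k) * x (v l) * C k l.

Lemma det_charm la x : \det (charm la x) =
  (sqrt2 * x (i, i) - la) * \det (charm la (x \o liftp i))
  - rowq (\adj (charm la (x \o liftp i))) x.
Proof.
rewrite (det_bordered i) charm_diag minor_charm; congr (_ - _).
apply: eq_bigr => k _; apply: eq_bigr => l _.
by rewrite charm_row charm_col.
Qed.

Lemma qE_rowq (C : ('I_n * 'I_n -> R) -> 'M[R]_n) Y :
  qE (fun x => rowq (C (x \o liftp i)) x * Y (x \o liftp i)) =
  qE (fun y => \tr (C y) * Y y).
Proof.
rewrite -(@eq_qE _ _ _ _ _ (fun x => \sum_k \sum_l x (v k) * x (v l) *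
    (C (x \o liftp i) k l * Y (x \o liftp i)))); last first.
  move=> x; rewrite mulr_suml; apply: eq_bigr => k _.
  by rewrite mulr_suml; apply: eq_bigr => l _; rewrite !mulrA.
rewrite (@qE_rowquad _ _ _ _ wt1 mom1 mom2 _ _ (fun k l y => C y k l * Y y)).
by apply: eq_qE => y; rewrite mulr_suml.
Qed.

Lemma qE_drowq (C : ('I_n * 'I_n -> R) -> 'M[R]_n) Y :
  qE (fun x => x (i, i) * rowq (C (x \o liftp i)) x * Y (x \o liftp i)) = 0.
Proof.
rewrite -(@eq_qE _ _ _ _ _ (fun x => \sum_k \sum_l x (i, i) *
    (x (v k) * x (v l)) * (C (x \o liftp i) k l * Y (x \o liftp i)))); last first.
  move=> x; rewrite mulr_sumr mulr_suml; apply: eq_bigr => k _.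
  by rewrite mulr_sumr mulr_suml; apply: eq_bigr => l _; rewrite !mulrA.
exact: (@qE_rowdquad _ _ _ _ wt1 mom1 _ _ (fun k l y => C y k l * Y y)).
Qed.

Lemma qE_det la Y :
  qE (fun x => \det (charm la x) * Y (x \o liftp i)) =
  qE (fun y => (- la * \det (charm la y) - \tr (\adj (charm la y))) * Y y).
Proof.
rewrite -(@eq_qE _ _ _ _ _ (fun x =>
    sqrt2 * (x (i, i) * (\det (charm la (x \o liftp i)) * Y (x \o liftp i)))
    - la * (\det (charm la (x \o liftp i)) * Y (x \o liftp i))
    - rowq (\adj (charm la (x \o liftp i))) x * Y (x \o liftp i))); last first.
  by move=> x; rewrite det_charm; ring.
rewrite !qEB !qEZ (qE_rowq (fun y => \adj (charm la y)))//.
rewrite (qE_row1d _ _ _ (fun y => \det (charm la y) * Y y))//.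
rewrite (qE_row0 _ _ _ (fun y => \det (charm la y) * Y y))//.
rewrite mulr0 sub0r -qEZ -!qEN -qED.
by apply: eq_qE => y; ring.
Qed.

(** Both determinants are expanded at i. The constant 2 is the variance of the diagonal entry;
    products of one diagonal variable with a quadratic form in the row have mean 0, and the product
    of two quadratic forms is [qE_rowquartic]. *)
Lemma qE_detdet la mu :
  qE (fun x : 'I_n.+1 * 'I_n.+1 -> R => \det (charm la x) * \det (charm mu x)) =
  qE (fun y : 'I_n * 'I_n -> R =>
    let A := charm la y in let B := charm mu y in
    (2 + la * mu) * (\det A * \det B)
    + la * (\det A * \tr (\adj B)) + mu * (\tr (\adj A) * \det B)
    + \tr (\adj A) * \tr (\adj B) + 2 * (\sum_k \sum_l \adj A k l * \adj B k l)
    + (m4 - 3) * (\sum_k \adj A k k * \adj B k k)).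
Proof.
pose a x : R := \det (charm la (x \o liftp i)).
pose b x : R := \det (charm mu (x \o liftp i)).
pose C x := rowq (\adj (charm la (x \o liftp i))) x.
pose D x := rowq (\adj (charm mu (x \o liftp i))) x.
pose ab (y : 'I_n * 'I_n -> R) := \det (charm la y) * \det (charm mu y).
have s2 : sqrt2 * sqrt2 = 2 by rewrite -expr2 sqr_sqrtr.
rewrite -(@eq_qE _ _ _ _ _ (fun x =>
    2 * (x (i, i) * x (i, i) * ab (x \o liftp i))
    - sqrt2 * (la + mu) * (x (i, i) * ab (x \o liftp i))
    + la * mu * ab (x \o liftp i)
    - sqrt2 * (x (i, i) * D x * a x) - sqrt2 * (x (i, i) * C x * b x)
    + la * (D x * a x) + mu * (C x * b x) + C x * D x)); last first.
  move=> x; rewrite !det_charm /ab -/(a x) -/(b x) -/(C x) -/(D x).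
  by rewrite -{1}s2; ring.
rewrite !(qEB, qED, qEZ).
rewrite (qE_row1d _ _ _ ab)// (qE_row2d _ _ _ _ ab)// (qE_row0 _ _ _ ab)//.
rewrite (qE_drowq (fun y => \adj (charm mu y)) (fun y => \det (charm la y))).
rewrite (qE_drowq (fun y => \adj (charm la y)) (fun y => \det (charm mu y))).
rewrite (qE_rowq (fun y => \adj (charm mu y)) (fun y => \det (charm la y))).
rewrite (qE_rowq (fun y => \adj (charm la y)) (fun y => \det (charm mu y))).
rewrite (qE_rowquartic wt1 mom1 mom2 i (fun y => \adj (charm la y))
  (D := fun y => \adj (charm mu y))); last exact: adj_charm_sym.
rewrite !mulr0 !subr0 -!qEZ -!qED.
by apply: eq_qE => y /=; rewrite /ab; ring.
Qed.

(** By [adj_bordered] both entries are linear in row i, and only squares of row variables survive.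
    The outcome is column k of the same sum for the minor, so [adjadj] obeys a recursion of its
    own. *)
Lemma qE_adjadj k la mu :
  qE (fun x => \adj (charm la x) i (lift i k) * \adj (charm mu x) i (lift i k)) =
  qE (fun y => \sum_l \adj (charm la y) l k * \adj (charm mu y) l k).
Proof.
pose Y l m y := \adj (charm la y) l k * \adj (charm mu y) m k.
rewrite -(@eq_qE _ _ _ _ _ (fun x =>
    \sum_l \sum_m x (v l) * x (v m) * Y l m (x \o liftp i))).
  exact: (@qE_rowquad _ _ _ _ wt1 mom1 mom2 _ _ Y).
move=> x; rewrite !adj_bordered !minor_charm mulrNN mulr_suml.
apply: eq_bigr => l _; rewrite mulr_sumr; apply: eq_bigr => m _.
by rewrite !charm_row /Y; ring.
Qed.

End one_vertex.

(** After [mxtrace_adj_bordered], averaging over the row turns each quadratic form into the trace of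
    an adjugate of a minor, and these traces add up to [adj2]. Size n = 0 stands apart, there being
    no second index to delete. *)
Lemma qE_trace n (i : 'I_n.+1) la (Y : ('I_n * 'I_n -> R) -> R) :
  qE (fun x => \tr (\adj (charm la x)) * Y (x \o liftp i)) =
  qE (fun y => (\det (charm la y) - la * \tr (\adj (charm la y))
                - adj2 (charm la y)) * Y y).
Proof.
case: n => [|n] in i Y *.
  rewrite -(@eq_qE _ _ _ _ _ (fun x => Y (x \o liftp i))); last first.
    by move=> x; rewrite mxtrace_adj big_ord1 det_mx00 mul1r.
  rewrite qE_row0//; apply: eq_qE => y.
  by rewrite det_mx00 /mxtrace big_ord0 /=; ring.
pose al (y : 'I_n.+1 * 'I_n.+1 -> R) := \det (charm la y).
pose ak k (y : 'I_n.+1 * 'I_n.+1 -> R) := \det (minor k (charm la y)).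
rewrite -(@eq_qE _ _ _ _ _ (fun x =>
    al (x \o liftp i) * Y (x \o liftp i)
    + \sum_k (sqrt2 * (x (i, i) * (ak k (x \o liftp i) * Y (x \o liftp i)))
      - la * (ak k (x \o liftp i) * Y (x \o liftp i))
      - \sum_l \sum_m x (row_index i (lift k l)) * x (row_index i (lift k m))
         * (\adj (minor k (charm la (x \o liftp i))) l m * Y (x \o liftp i)))));
  last first.
  move=> x; rewrite (mxtrace_adj_bordered i) minor_charm mulrDl; congr (_ + _).
  rewrite mulr_suml; apply: eq_bigr => k _.
  rewrite mulrBl charm_diag /ak; congr (_ - _); first ring.
  rewrite mulr_suml; apply: eq_bigr => l _; rewrite mulr_suml.
  by apply: eq_bigr => m _; rewrite charm_row charm_col mulrA.
rewrite qED (qE_row0 _ _ _ (fun y => al y * Y y))// qE_sum.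
rewrite -[in RHS](@eq_qE _ _ _ _ _ (fun y => al y * Y y +
  \sum_k (- (la * (ak k y * Y y)) - \tr (\adj (minor k (charm la y))) * Y y))).
  rewrite qED qE_sum; congr (_ + _); apply: eq_bigr => k _.
  rewrite !qEB !qEZ (qE_row1d _ _ _ (fun y => ak k y * Y y))//.
  rewrite (qE_row0 _ _ _ (fun y => ak k y * Y y))// mulr0 sub0r qEN qEZ.
  congr (_ - _).
  rewrite qE_sum.
  under eq_bigr do rewrite qE_sum.
  under eq_bigr => l _ do under eq_bigr => m _ do
    rewrite (qE_row2 wt1 mom1 mom2 i (lift k l) (lift k m)
      (fun y => \adj (minor k (charm la y)) l m * Y y)) (inj_eq lift_inj).
  under eq_bigr => l _ do rewrite sum_delta.
  by rewrite -qE_sum; apply: eq_qE => y; rewrite mulr_suml.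
move=> y; rewrite sumrB sumrN -mulr_sumr -!mulr_suml mxtrace_adj /=.
by rewrite /al /ak; ring.
Qed.

End expansions.

(** * Convolutions and Hermite polynomials *)

Section convolution.
Context (R : comPzRingType).
Implicit Types u v w : nat -> R.

(** On coefficient sequences, [conv], [shift] and [psum] are the product of generating functions and
    the multiplications by z and by 1 / (1 - z). *)
Definition conv u v n : R := \sum_(k < n.+1) u (n - k)%N * v k.

Definition shift v n : R := if n is n'.+1 then v n' else 0.

Definition psum u n : R := \sum_(k < n.+1) u k.

Lemma psumS u n : psum u n.+1 = psum u n + u n.+1.
Proof. by rewrite /psum big_ord_recr. Qed.

Lemma psum0 u : psum u 0 = u 0%N.
Proof. by rewrite /psum big_ord1. Qed.

Lemma convDr u v w n : conv u (fun k => v k + w k) n = conv u v n + conv u w n.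
Proof. by rewrite -big_split; apply: eq_bigr => k _; rewrite mulrDr. Qed.

Lemma convZr u v a n : conv u (fun k => a * v k) n = a * conv u v n.
Proof. by rewrite mulr_sumr; apply: eq_bigr => k _; rewrite mulrCA. Qed.

Lemma convNr u v n : conv u (fun k => - v k) n = - conv u v n.
Proof. by rewrite /conv -sumrN; apply: eq_bigr => k _; rewrite mulrN. Qed.

Lemma conv_shiftr u v n : conv u (shift v) n = shift (conv u v) n.
Proof.
case: n => [|n]; first by rewrite /conv big_ord1 mulr0.
by rewrite /conv big_ord_recl mulr0 add0r; apply: eq_bigr => k _.
Qed.

Lemma conv_shiftl u v n : conv (shift u) v n = shift (conv u v) n.
Proof.
case: n => [|n]; first by rewrite /conv big_ord1 mul0r.
rewrite /conv big_ord_recr/= subnn mul0r addr0; apply: eq_bigr => k _.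
by rewrite subSn // -ltnS.
Qed.

Lemma conv_psuml u v n : conv (psum u) v n = psum (conv u v) n.
Proof.
elim: n => [|n IH]; first by rewrite psum0 /conv !big_ord1 psum0.
rewrite psumS -IH /conv big_ord_recr/= [X in _ = _ + X]big_ord_recr /= subnn psum0.
rewrite addrA -big_split; congr (_ + _); apply: eq_bigr => k _ /=.
by rewrite (subSn (_ : k <= n)%N) ?psumS ?mulrDl// -ltnS.
Qed.

Lemma eq_conv u u' v v' n :
  u =1 u' -> v =1 v' -> conv u v n = conv u' v' n.
Proof. by move=> uu' vv'; apply: eq_bigr => k _; rewrite uu' vv'. Qed.

(** The Leibniz rule for the derivation z d/dz. *)
Lemma conv_natmul u v n :
  n%:R * conv u v n = conv (fun k => k%:R * u k) v n + conv u (fun k => k%:R * v k) n.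
Proof.
rewrite mulr_sumr -big_split; apply: eq_bigr => k _ /=.
have {1}-> : n = (n - k + k)%N by rewrite subnK// -ltnS.
by rewrite natrD; ring.
Qed.

End convolution.

Section hermite.
Context (R : realType).

Fixpoint hermite (n : nat) (x : R) : R :=
  match n with
  | 0 => 1
  | m.+1 => match m with
            | 0 => x
            | m'.+1 => x * hermite m x - m%:R * hermite m' x
            end
  end.

Lemma hermiteSS n x :
  hermite n.+2 x = x * hermite n.+1 x - n.+1%:R * hermite n x.
Proof. by []. Qed.

Lemma hermiteS n x :
  hermite n.+1 x = x * hermite n x - n%:R * shift (hermite ^~ x) n.
Proof. by case: n => [|n]; rewrite ?hermiteSS//= mulr1 mul0r subr0. Qed.

End hermite.

Section cumulant_coefficients.
Context (R : realType) (b : R).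

(* Coefficients of exp(b z^2), exp(b z^2) / (1 - z) and exp(b z^2) / (1 - z)^2. *)
Definition expsq_coef (n : nat) : R :=
  if odd n then 0 else b ^+ n./2 / (n./2)`!%:R.

Definition expsq_coef1 := psum expsq_coef.

Definition expsq_coef2 := psum expsq_coef1.

Lemma expsq_coef_double k : expsq_coef k.*2 = b ^+ k / k`!%:R.
Proof. by rewrite /expsq_coef odd_double doubleK. Qed.

Lemma expsq_coef_odd k : expsq_coef k.*2.+1 = 0.
Proof. by rewrite /expsq_coef oddS odd_double. Qed.

(** Coefficient form of f' = 2 b z f. The recursions for [expsq_coef1] and [expsq_coef2] add 1 / (1
    - z) to the logarithmic derivative, once and twice. *)
Lemma expsq_coef_rec n : n.+1%:R * expsq_coef n.+1 = 2 * b * shift expsq_coef n.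
Proof.
rewrite -(odd_double_half n); case: (odd n); move: n./2 => k /=.
  have k0 : k.+1%:R != 0 :> R by rewrite pnatr_eq0.
  rewrite add0n -doubleS !expsq_coef_double -muln2 natrM exprS factS natrM invfM.
  by move: (k`!%:R^-1) (b ^+ k) => f B; field.
rewrite add0n expsq_coef_odd mulr0; case: k => [|k]; first by rewrite /= mulr0.
by rewrite doubleS /= expsq_coef_odd mulr0.
Qed.

Lemma expsq_coef1_rec n :
  n.+1%:R * expsq_coef1 n.+1 = psum expsq_coef1 n + 2 * b * shift expsq_coef1 n.
Proof.
elim: n => [|n IH].
  rewrite /expsq_coef1 psumS !psum0 mulrDr expsq_coef_rec /= mul1r; ring.
rewrite {1}/expsq_coef1 psumS -/expsq_coef1 mulrDr expsq_coef_rec.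
rewrite -addn1 natrD mulrDl IH mul1r psumS.
case: n {IH} => [|n] /=.
  by rewrite (_ : expsq_coef1 0 = expsq_coef 0); [ring|exact: psum0].
by rewrite (_ : expsq_coef1 n.+1 = expsq_coef1 n + expsq_coef n.+1); [ring|exact: psumS].
Qed.

Lemma expsq_coef2_rec n : n.+1%:R * expsq_coef2 n.+1 =
  2 * psum expsq_coef2 n + 2 * b * shift expsq_coef2 n.
Proof.
elim: n => [|n IH].
  rewrite /expsq_coef2 psumS !psum0 mulrDr expsq_coef1_rec /= psum0; ring.
rewrite {1}/expsq_coef2 psumS -/expsq_coef2 mulrDr expsq_coef1_rec.
rewrite -addn1 natrD mulrDl IH mul1r -/(expsq_coef2 _) psumS.
case: n {IH} => [|n] /=.
  by rewrite (_ : expsq_coef2 0 = expsq_coef1 0); [ring|exact: psum0].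
by rewrite (_ : expsq_coef2 n.+1 = expsq_coef2 n + expsq_coef1 n.+1); [ring|exact: psumS].
Qed.

End cumulant_coefficients.

(** * Recursions for the mixed means *)

Section moments.
Context (R : realType) (K : finType) (wt node : K -> R).
Hypothesis wt1 : \sum_k wt k = 1.
Hypothesis mom1 : mom wt node 1 = 0.
Hypothesis mom2 : mom wt node 2 = 1.
Local Notation qE := (qE wt node).
Local Notation m4 := (mom wt node 4).
Context (la mu : R).

Local Notation A := (charm la).
Local Notation B := (charm mu).

Definition det_mean n := qE (fun x : 'I_n * 'I_n -> R => \det (A x)).
Definition trace_mean n := qE (fun x : 'I_n * 'I_n -> R => \tr (\adj (A x))).
Definition detdet n := qE (fun x : 'I_n * 'I_n -> R => \det (A x) * \det (B x)).
Definition dettr n := qE (fun x : 'I_n * 'I_n -> R => \det (A x) * \tr (\adj (B x))).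
Definition trdet n := qE (fun x : 'I_n * 'I_n -> R => \tr (\adj (A x)) * \det (B x)).
Definition trtr n :=
  qE (fun x : 'I_n * 'I_n -> R => \tr (\adj (A x)) * \tr (\adj (B x))).
Definition detadj2 n := qE (fun x : 'I_n * 'I_n -> R => \det (A x) * adj2 (B x)).
Definition adjadj n :=
  qE (fun x : 'I_n * 'I_n -> R => \sum_k \sum_l \adj (A x) k l * \adj (B x) k l).
Definition adjdiag n :=
  qE (fun x : 'I_n * 'I_n -> R => \sum_k \adj (A x) k k * \adj (B x) k k).

Lemma sumr_const_ord n (c : R) : \sum_(i < n.+1) c = n.+1%:R * c.
Proof. by rewrite sumr_const card_ord mulr_natl. Qed.

Lemma trace_meanS n : trace_mean n.+1 = n.+1%:R * det_mean n.
Proof.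
rewrite -sumr_const_ord /trace_mean.
under eq_qE do rewrite mxtrace_adj; rewrite qE_sum; apply: eq_bigr => i _.
under eq_qE do rewrite minor_charm.
by rewrite (qE_row0 node wt1 i (fun y => \det (A y))).
Qed.

Lemma det_meanS n : det_mean n.+1 = - la * det_mean n - trace_mean n.
Proof.
rewrite /det_mean -[in LHS](@eq_qE _ _ _ _ _ (fun x => \det (A x) * 1)); last first.
  by move=> x; rewrite mulr1.
rewrite (qE_det wt1 mom1 mom2 ord0 la (fun=> 1)) -qEZ -qEB.
by apply: eq_qE => y; rewrite mulr1.
Qed.


Lemma qE1cst (J : finType) : qE (fun _ : J -> R => 1) = 1.
Proof.
transitivity (qE (fun x : J -> R => \prod_(p : J) 1)).
  by apply: eq_qE => x; rewrite big1.
rewrite (qE_prod wt node (fun (p : J) (_ : R) => 1)) big1// => p _.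
by rewrite /qE1; under eq_bigr do rewrite mulr1.
Qed.

Lemma det_mean0 : det_mean 0 = 1.
Proof. by rewrite /det_mean; under eq_qE do rewrite det_mx00; exact: qE1cst. Qed.


(** The trace is a sum of principal minors. The one avoiding i involves no variable of row i, so
    only the other factor is expanded at i, and every i contributes alike. The next three recursions
    follow the same pattern. *)
Lemma dettrS n : dettr n.+1 = n.+1%:R * (- la * detdet n - trdet n).
Proof.
rewrite -sumr_const_ord /dettr.
under eq_qE do rewrite mxtrace_adj mulr_sumr; rewrite qE_sum.
apply: eq_bigr => i _; under eq_qE do rewrite minor_charm.
rewrite (qE_det wt1 mom1 mom2 i la (fun y => \det (B y))) -qEZ -qEB.
by apply: eq_qE => y; ring.
Qed.

Lemma trdetS n : trdet n.+1 = n.+1%:R * (- mu * detdet n - dettr n).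
Proof.
rewrite -sumr_const_ord /trdet.
under eq_qE do rewrite mxtrace_adj mulr_suml; rewrite qE_sum.
apply: eq_bigr => i _; under eq_qE do rewrite minor_charm mulrC.
rewrite (qE_det wt1 mom1 mom2 i mu (fun y => \det (A y))) -qEZ -qEB.
by apply: eq_qE => y; ring.
Qed.

Lemma trtrS n : trtr n.+1 = n.+1%:R * (detdet n - mu * dettr n - detadj2 n).
Proof.
rewrite -sumr_const_ord /trtr.
under eq_qE do rewrite mxtrace_adj mulr_suml; rewrite qE_sum.
apply: eq_bigr => i _; under eq_qE do rewrite minor_charm mulrC.
rewrite (qE_trace wt1 mom1 mom2 i mu (fun y => \det (A y))) -qEZ -!qEB.
by apply: eq_qE => y; ring.
Qed.

Lemma detadj2S n : detadj2 n.+1 = n.+1%:R * (- la * dettr n - trtr n).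
Proof.
rewrite -sumr_const_ord /detadj2.
under eq_qE do rewrite /adj2 mulr_sumr; rewrite qE_sum.
apply: eq_bigr => i _; under eq_qE do rewrite minor_charm.
rewrite (qE_det wt1 mom1 mom2 i la (fun y => \tr (\adj (B y)))) -qEZ -qEB.
by apply: eq_qE => y; ring.
Qed.

Lemma adjadjS n : adjadj n.+1 = n.+1%:R * (detdet n + adjadj n).
Proof.
rewrite -sumr_const_ord {1}/adjadj qE_sum; apply: eq_bigr => i _.
under eq_qE do rewrite (bigD1_ord i)//= !adj_minor !minor_charm.
rewrite qED qE_sum (qE_row0 node wt1 i (fun y => \det (A y) * \det (B y))).
congr (_ + _).
under eq_bigr do rewrite qE_adjadj//.
by rewrite -qE_sum; apply: eq_qE => y; rewrite exchange_big.
Qed.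

Lemma adjdiagS n : adjdiag n.+1 = n.+1%:R * detdet n.
Proof.
rewrite -sumr_const_ord /adjdiag qE_sum; apply: eq_bigr => i _.
under eq_qE do rewrite !adj_minor !minor_charm.
by rewrite (qE_row0 node wt1 i (fun y => \det (A y) * \det (B y))).
Qed.

Lemma detdetS n : detdet n.+1 = (2 + la * mu) * detdet n + la * dettr n
  + mu * trdet n + trtr n + 2 * adjadj n + (m4 - 3) * adjdiag n.
Proof.
by rewrite /detdet (qE_detdet wt1 mom1 mom2 ord0 la mu) !(qED, qEZ).
Qed.

Lemma detdet0 : detdet 0 = 1.
Proof.
by rewrite /detdet; under eq_qE do rewrite !det_mx00 mulr1; exact: qE1cst.
Qed.

Lemma qE_eq0 (J : finType) (F : (J -> R) -> R) : (forall x, F x = 0) -> qE F = 0.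
Proof. by move=> F0; rewrite /qE big1// => w _; rewrite F0 mulr0. Qed.

Lemma mxtrace0 (M : 'M[R]_0) : \tr M = 0.
Proof. by rewrite /mxtrace big_ord0. Qed.

Lemma dettr0 : dettr 0 = 0.
Proof. by apply: qE_eq0 => x; rewrite mxtrace0 mulr0. Qed.

Lemma trdet0 : trdet 0 = 0.
Proof. by apply: qE_eq0 => x; rewrite mxtrace0 mul0r. Qed.

Lemma trtr0 : trtr 0 = 0.
Proof. by apply: qE_eq0 => x; rewrite mxtrace0 mul0r. Qed.

Lemma detadj20 : detadj2 0 = 0.
Proof. by apply: qE_eq0 => x; rewrite mulr0. Qed.

Lemma adjadj0 : adjadj 0 = 0.
Proof. by apply: qE_eq0 => x; rewrite big_ord0. Qed.

Lemma adjdiag0 : adjdiag 0 = 0.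
Proof. by apply: qE_eq0 => x; rewrite big_ord0. Qed.

Lemma trace_mean0 : trace_mean 0 = 0.
Proof. by apply: qE_eq0 => x; rewrite mxtrace0. Qed.

(** The trace of the adjugate has mean n times the preceding mean of the determinant, which turns
    [det_meanS] into the Hermite recursion. *)
Lemma det_mean_hermite n : det_mean n = (-1) ^+ n * hermite n la.
Proof.
suff: det_mean n = (-1) ^+ n * hermite n la /\
      trace_mean n = - (-1) ^+ n * n%:R * shift (fun k => hermite k la) n by case.
elim: n => [|n [IHd IHt]].
  by rewrite det_mean0 trace_mean0 expr0 mul1r mulr0.
rewrite trace_meanS det_meanS IHd IHt hermiteS exprS /=; split; ring.
Qed.

End moments.

(** * Solution of the recursions *)

Section closed_form.
Context (R : realType) (K : finType) (wt node : K -> R).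
Hypothesis wt1 : \sum_k wt k = 1.
Hypothesis mom1 : mom wt node 1 = 0.
Hypothesis mom2 : mom wt node 2 = 1.
Local Notation m4 := (mom wt node 4).
Context (la mu : R).

Definition hermite_pair (k : nat) : R := hermite k la * hermite k mu / k`!%:R.

Local Notation eta := hermite_pair.

(* Each of the means entering the recursions is the convolution of expsq_coef2
   with eta or one of the following sequences. *)
Let hP k : R := - hermite k.+1 la * hermite k mu / k`!%:R.
Let hQ k : R := - hermite k la * hermite k.+1 mu / k`!%:R.
Let Pe := shift hP.
Let Qe := shift hQ.
Let Ge := shift (fun k => k.+1%:R * eta k).
Let Re n := - la * shift Pe n - shift Ge n.

Let factn0 n : n`!%:R != 0 :> R. Proof. by rewrite pnatr_eq0 -lt0n fact_gt0. Qed.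
Let nat0 n : n.+1%:R != 0 :> R. Proof. by rewrite pnatr_eq0. Qed.

Let PeS n : Pe n.+1 = - la * eta n - Qe n.
Proof.
case: n => [|n]; first by rewrite /Pe /Qe /hP /eta /= fact0; ring.
rewrite /Pe /Qe /= /hP /hQ /eta hermiteSS factS natrM.
by have := factn0 n; have := nat0 n; move: (n`!%:R) (n.+1%:R) => f k k0 f0; field; rewrite f0.
Qed.

Let QeS n : Qe n.+1 = - mu * eta n - Pe n.
Proof.
case: n => [|n]; first by rewrite /Pe /Qe /hQ /eta /= fact0; ring.
rewrite /Pe /Qe /= /hP /hQ /eta hermiteSS factS natrM.
by have := factn0 n; have := nat0 n; move: (n`!%:R) (n.+1%:R) => f k k0 f0; field; rewrite f0.
Qed.

(** [Re] reaches two steps back, so the small cases n = 0 and n = 1, where a shift meets its default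
    value 0, are checked apart. *)
Let GeS n : Ge n.+1 = eta n - mu * Pe n - Re n.
Proof.
case: n => [|[|n]].
- by rewrite /Ge /Pe /Re /Pe /Ge /=; ring.
- rewrite /Ge /Pe /Re /Pe /Ge /= /hP /eta /=.
  by rewrite ?fact0 (_ : 1`! = 1)%N//; field.
- rewrite /Ge /Re /= /Pe /Ge /= /hP /eta !hermiteSS !factS !natrM.
  have := factn0 n; have := nat0 n; have := nat0 n.+1.
  rewrite -[n.+3%:R]natr1 -[n.+2%:R]natr1.
  by move: (n`!%:R) (n.+1%:R) => f k k1 k0 f0; field; rewrite f0 k0.
Qed.

Let etaS n : n.+1%:R * eta n.+1 = la * mu * eta n + la * Pe n + mu * Qe n + Ge n.
Proof.
case: n => [|n].
  by rewrite /eta /Ge /Pe /Qe /= ?fact0 (_ : 1`! = 1)%N//; field.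
rewrite /Pe /Qe /Ge /= /hP /hQ /eta !hermiteSS !factS !natrM.
have := factn0 n; have := nat0 n; have := nat0 n.+1.
rewrite -[n.+2%:R]natr1.
by move: (n`!%:R) (n.+1%:R) => f k k1 k0 f0; field; rewrite f0 k0.
Qed.

(** Division by n! absorbs the factor [n.+1] that counts the choices of the deleted index. *)
Let norm (u : nat -> R) n := u n / n`!%:R.

Let normS (u : nat -> R) a n : u n.+1 = n.+1%:R * a -> norm u n.+1 = a / n`!%:R.
Proof.
move=> uE; rewrite /norm uE factS natrM.
by have := factn0 n; have := nat0 n; move: (n`!%:R) (n.+1%:R) => f k k0 f0; field; rewrite f0.
Qed.

Let phi := norm (detdet wt node la mu).
Let P := norm (dettr wt node la mu).
Let Q := norm (trdet wt node la mu).
Let G := norm (trtr wt node la mu).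
Let Rr := norm (detadj2 wt node la mu).
Let tau := norm (adjadj wt node la mu).

Let PS n : P n.+1 = - la * phi n - Q n.
Proof. by rewrite /P (normS (dettrS wt1 mom1 mom2 la mu n)) mulrBl mulrA. Qed.

Let QS n : Q n.+1 = - mu * phi n - P n.
Proof. by rewrite /Q (normS (trdetS wt1 mom1 mom2 la mu n)) mulrBl mulrA. Qed.

Let GS n : G n.+1 = phi n - mu * P n - Rr n.
Proof. by rewrite /G (normS (trtrS wt1 mom1 mom2 la mu n)) !mulrBl mulrA. Qed.

Let RS n : Rr n.+1 = - la * P n - G n.
Proof. by rewrite /Rr (normS (detadj2S wt1 mom1 mom2 la mu n)) mulrBl mulrA. Qed.

Let tauS n : tau n.+1 = phi n + tau n.
Proof. by rewrite /tau (normS (adjadjS wt1 mom1 mom2 la mu n)) mulrDl. Qed.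

Let adjdiagE n : norm (adjdiag wt node la mu) n = shift phi n.
Proof.
case: n => [|n]; first by rewrite /norm adjdiag0 mul0r.
by rewrite (normS (adjdiagS node wt1 la mu n)).
Qed.

(** The origin of the factor 1 / (1 - z): by [tauS], the normalised [adjadj] accumulates all earlier
    normalised second moments of the determinant. *)
Let tau_psum n : phi n + tau n = psum phi n.
Proof.
elim: n => [|n IH]; first by rewrite psum0 /tau /norm adjadj0 mul0r addr0.
by rewrite psumS -IH tauS addrC.
Qed.

Let phiS n : n.+1%:R * phi n.+1 = la * mu * phi n + la * P n + mu * Q n + G n
  + 2 * psum phi n + (m4 - 3) * shift phi n.
Proof.
rewrite -tau_psum -adjdiagE /phi {1}/norm (detdetS wt1 mom1 mom2) factS natrM.
rewrite /P /Q /G /tau /norm.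
by have := factn0 n; have := nat0 n; move: (n`!%:R) (n.+1%:R) => f k k0 f0; field; rewrite f0.
Qed.

(** [hermite_pair] and its companions solve the system deprived of the terms [2 * psum phi] and
    [(m4 - 3) * shift phi]. These two add 2 / (1 - z) + (m4 - 3) z to the logarithmic derivative,
    which is that of the generating function of [expsq_coef2]. The companion recursions only shift
    indices, hence commute with convolution; the one with factor [n.+1] obeys the Leibniz rule
    [conv_natmul]. *)
Theorem detdet_closed n : detdet wt node la mu n =
  n`!%:R * conv (expsq_coef2 ((m4 - 3) / 2)) hermite_pair n.
Proof.
set c := expsq_coef2 _.
have c2 k : k.+1%:R * c k.+1 = 2 * psum c k + (m4 - 3) * shift c k.
  by rewrite /c expsq_coef2_rec; congr (_ + _ * _); field.
(* The induction carries [phi] at every index up to n, since [psum phi] involves them all, but the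
   companions at n only. *)
suff: (forall k, (k <= n)%N -> phi k = conv c eta k) /\
   [/\ P n = conv c Pe n, Q n = conv c Qe n, G n = conv c Ge n
     & Rr n = conv c Re n].
  move=> [/(_ n (leqnn n)) <- _].
  by rewrite /phi /norm mulrCA mulfV ?mulr1.
elim: n => [|n [IHphi [IHP IHQ IHG IHR]]].
  split=> [k|].
    rewrite leqn0 => /eqP ->; rewrite /phi /norm detdet0//.
    rewrite /conv big_ord1 /c /expsq_coef2 psum0 /expsq_coef1 psum0 /expsq_coef.
    by rewrite /eta /= fact0 !divr1 !mulr1.
  rewrite /P /Q /G /Rr /norm dettr0 trdet0 trtr0 detadj20 mul0r.
  by rewrite /conv !big_ord1 /Re /= !mulr0 subr0 mulr0.
have E := IHphi n (leqnn n).
have step (u : nat -> R) : conv c u n.+1 = c n.+1 * u 0%N + conv c (u \o succn) n.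
  by rewrite /conv big_ord_recl subn0; congr (_ + _); apply: eq_bigr.
have neg1 a (u : nat -> R) : conv c (fun k => - a * u k) n = - a * conv c u n.
  exact: convZr.
have phin1 : phi n.+1 = conv c eta n.+1.
  apply: (mulfI (nat0 n)); rewrite phiS conv_natmul.
  rewrite (@eq_conv _ c c (fun k => k%:R * eta k) (shift (fun k => la * mu * eta k +
    la * Pe k + mu * Qe k + Ge k))) //; last first.
    by case=> [|k] /=; rewrite ?mul0r// etaS.
  rewrite (@eq_conv _ (fun k => k%:R * c k) (shift (fun k => 2 * psum c k +
    (m4 - 3) * shift c k)) eta eta) //; last first.
    by case=> [|k] /=; rewrite ?mul0r// c2.
  rewrite conv_shiftr conv_shiftl /= !convDr !convZr -E -IHP -IHQ -IHG.
  have -> : psum phi n = conv (psum c) eta n.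
    rewrite conv_psuml; apply: eq_bigr => k _; apply: IHphi.
    by rewrite -ltnS.
  have -> : shift phi n = conv (shift c) eta n.
    by rewrite conv_shiftl; case: (n) IHphi => //= m; exact.
  rewrite [X in _ = X + _](_ : _ = 2 * conv (psum c) eta n +
      (m4 - 3) * conv (shift c) eta n); first ring.
  by rewrite !mulr_sumr -big_split; apply: eq_bigr => k _; rewrite mulrDl !mulrA.
split=> [k|].
  by rewrite leq_eqVlt => /orP[/eqP -> //|]; rewrite ltnS; exact: IHphi.
have R0 : Re 0 = 0 by rewrite /Re /= mulr0 subr0.
split; rewrite step ?R0 [X in _ = X + _]mulr0 add0r.
- by rewrite PS E IHQ -neg1 -convNr -convDr; apply: eq_conv => // k; rewrite -PeS.
- by rewrite QS E IHP -neg1 -convNr -convDr; apply: eq_conv => // k; rewrite -QeS.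
- rewrite GS E IHP IHR -convZr -!convNr -!convDr; apply: eq_conv => // k.
  by rewrite -GeS.
- by rewrite RS IHP IHG -neg1 -convNr -convDr.
Qed.

End closed_form.

(** * Reduction of the expectation to the quadrature *)

Section weighted_pushforward.
Local Open Scope ereal_scope.
Context d (T : measurableType d) (R : realType) (P : probability T R).

Import HBNNSimple.

(* The measures A |-> \int_(Y^-1 A) H and c * law(Y) coincide on measurable
   sets, hence integrate the nonnegative functions alike. *)
Lemma ge0_integral_weighted (H : T -> R) (Y : {RV P >-> measurableTypeR R}) (c : R)
    (f : measurableTypeR R -> R) :
  measurable_fun setT H -> (forall x, 0 <= H x)%R -> (0 <= c)%R ->
  (forall A : set (measurableTypeR R), measurable A ->
     \int[P]_x (H x * \1_A (Y x))%:E = c%:E * P (Y @^-1` A)) ->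
  measurable_fun [set: measurableTypeR R] f -> (forall y, 0 <= f y)%R ->
  \int[P]_x (H x * f (Y x))%:E = c%:E * \int[P]_x (f (Y x))%:E.
Proof.
move=> mH H0 c0 HA mf f0.
have mY : measurable_fun setT Y by exact: measurable_funPT.
have mfE : measurable_fun [set: measurableTypeR R] (EFin \o f) by exact/measurable_EFinP.
pose g n := nnsfun_approx (T := measurableTypeR R) measurableT mfE n.
have mgY n : measurable_fun setT (fun x => g n (Y x)).
  exact: (measurableT_comp (measurable_funPT (g n)) mY).
have ndg y : {homo (fun n => g n y) : m n / (m <= n)%N >-> (m <= n)%R}.
  by move=> m n mn; exact/lefP/nd_nnsfun_approx.
have cvg_g y : (g n y)%:E @[n --> \oo] --> (f y)%:E.
  by apply: (cvg_nnsfun_approx measurableT mfE) => // t _; rewrite lee_fin.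
have gE n : \int[P]_x (H x * g n (Y x))%:E = c%:E * \int[P]_x (g n (Y x))%:E.
  pose s := fset_set (g n @` setT).
  have gEord := fimfunEord (g n).
  have s0 (i : 'I_(#|` s|)) : (0 <= s`_i)%R.
    have : s`_i \in s by rewrite mem_nth.
    rewrite /s in_fset_set; last exact: fimfunP.
    by move=> /set_mem[y _ <-].
  have mg (i : 'I_(#|` s|)) : measurable (g n @^-1` [set s`_i]) by [].
  have m1 (i : 'I_(#|` s|)) :
      measurable_fun setT (fun x => \1_(g n @^-1` [set s`_i]) (Y x) : R).
    by apply: (measurableT_comp _ mY); exact: measurable_indic.
  transitivity (\sum_(i < #|` s|) \int[P]_x
      ((s`_i)%:E * (H x * \1_(g n @^-1` [set s`_i]) (Y x))%:E)).
    rewrite -ge0_integral_sum//; last 2 first.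
    - move=> i; apply: measurable_funeM; apply/measurable_EFinP.
      exact: measurable_funM.
    - by move=> i x _; rewrite mule_ge0 ?lee_fin ?mulr_ge0.
    apply: eq_integral => x _; rewrite gEord sumEFin mulr_sumr; congr (_%:E).
    by apply: eq_bigr => i _; rewrite mulrCA.
  transitivity (c%:E * \sum_(i < #|` s|) \int[P]_x
      ((s`_i)%:E * (\1_(g n @^-1` [set s`_i]) (Y x))%:E)); last first.
    congr (_ * _); rewrite -ge0_integral_sum//; last 2 first.
    - by move=> i; apply: measurable_funeM; exact/measurable_EFinP.
    - by move=> i x _; rewrite mule_ge0 ?lee_fin.
    by apply: eq_integral => x _; rewrite gEord sumEFin.
  rewrite ge0_sume_distrr; last first.
    by move=> i _; apply: integral_ge0 => x _; rewrite mule_ge0 ?lee_fin.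
  apply: eq_bigr => i _.
  rewrite ge0_integralZl//; last 3 first.
  - by apply/measurable_EFinP; exact: measurable_funM.
  - by move=> x _; rewrite lee_fin mulr_ge0.
  - by rewrite lee_fin.
  rewrite ge0_integralZl ?lee_fin//; last exact/measurable_EFinP.
  rewrite HA// muleCA; congr (_ * (_ * _)).
  transitivity (\int[P]_x (\1_(Y @^-1` (g n @^-1` [set s`_i])) x)%:E).
    by rewrite integral_indic// ?setIT// -[X in measurable X]setTI; exact: mY.
  by apply: eq_integral => x _; rewrite !indicE.
have cvgL : \int[P]_x (H x * g n (Y x))%:E @[n --> \oo] -->
            \int[P]_x (H x * f (Y x))%:E.
  rewrite (_ : (fun n => _) = (fun n => \int[P]_x (EFin \o (fun x => H x * g n (Y x))%R) x))//.
  rewrite (_ : \int[P]_x (H x * f (Y x))%:E =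
    \int[P]_x limn (fun n => (H x * g n (Y x))%:E)); last first.
    apply: eq_integral => x _; apply/esym/cvg_lim => //.
    by under eq_fun do rewrite EFinM; rewrite EFinM; exact: cvgeZl.
  apply: cvg_monotone_convergence => //.
  - by move=> n; apply/measurable_EFinP; exact: measurable_funM.
  - by move=> n x _; rewrite lee_fin mulr_ge0.
  - by move=> x _ m n mn; rewrite lee_fin ler_wpM2l// ndg.
have cvgR : \int[P]_x (g n (Y x))%:E @[n --> \oo] --> \int[P]_x (f (Y x))%:E.
  rewrite (_ : \int[P]_x (f (Y x))%:E =
    \int[P]_x limn (fun n => (g n (Y x))%:E)); last first.
    by apply: eq_integral => x _; apply/esym/cvg_lim.
  apply: cvg_monotone_convergence => //.
  - by move=> n; exact/measurable_EFinP.
  - by move=> n x _; rewrite lee_fin.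
  - by move=> x _ m n mn; rewrite lee_fin ndg.
have cvgL' : \int[P]_x (H x * g n (Y x))%:E @[n --> \oo] -->
             c%:E * \int[P]_x (f (Y x))%:E.
  by under eq_fun do rewrite gE; exact: cvgeZl.
exact: (cvg_unique _ cvgL cvgL').
Qed.

End weighted_pushforward.

Section independent_product.
Context d (T : measurableType d) (R : realType) (P : probability T R).
Context (I : finType) (X : I -> {RV P >-> measurableTypeR R}) (D : {set I}).
Hypothesis indX : independent_RVs D X.

Let mX p : measurable_fun setT (X p). Proof. exact: measurable_funPT. Qed.

Let mcomp p (g : measurableTypeR R -> R) : measurable_fun setT g ->
  measurable_fun setT (fun x => g (X p x)).
Proof. by move=> mg; exact: (measurableT_comp mg (mX p)). Qed.

Let mprod (A : pred I) (q : I -> measurableTypeR R -> R) :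
  (forall p, A p -> measurable_fun setT (q p)) ->
  measurable_fun setT (fun x => \prod_(p | A p) q p (X p x)).
Proof.
move=> mq; under eq_fun do rewrite big_mkcond.
apply: (@measurable_prod _ _ _ _ I _ (fun p x => if A p then q p (X p x) else 1)).
move=> p _. case: (boolP (A p)) => Ap; last exact: measurable_cst.
by apply: mcomp; exact: mq.
Qed.

(** Induction on a list K containing every coordinate whose factor is not an indicator. For empty K
    this is the product rule for events; in the inductive step one indicator is upgraded to a
    nonnegative function by [ge0_integral_weighted], with the product of the other factors as
    weight. *)
Lemma ge0_integral_indep_prod (K : seq I) (f : I -> measurableTypeR R -> R)
    (C : I -> R) :
  (forall p, p \in D -> measurable_fun setT (f p)) ->
  (forall p, p \in D -> forall y, 0 <= f p y) ->
  (forall p, p \in D -> p \notin K ->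
     exists2 A, measurable A & f p = \1_A) ->
  (forall p, p \in D -> (\int[P]_x (f p (X p x))%:E = (C p)%:E)%E) ->
  (\int[P]_x (\prod_(p in D) f p (X p x))%:E = (\prod_(p in D) C p)%:E)%E.
Proof.
elim: K f C => [|a K IH] f C mf f0 fA fC.
  have /choice[A mA] : forall p, exists A, measurable A /\ (p \in D -> f p = \1_A).
    move=> p; case: (boolP (p \in D)) => pD; last by exists set0.
    by have [A mA fE] := fA p pD isT; exists A.
  transitivity (P (\bigcap_(i in [set` D]) (X i @^-1` A i))).
    transitivity (\int[P]_x (\1_(\bigcap_(i in [set` D]) (X i @^-1` A i)) x)%:E)%E.
      apply: eq_integral => x _; congr (_%:E).
      rewrite [RHS]indicE; case: (boolP (x \in _)) => [/set_mem xA|xA].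
        rewrite big1// => p pD; have [_ ->//] := mA p.
        by rewrite indicE mem_set//; exact: xA.
      have [p [pD xp]] : exists p, p \in D /\ ~ (A p (X p x)).
        apply: contrapT => /forallNP nA; move/negP: xA; apply; apply/mem_set => p pD.
        by have := nA p; rewrite not_andE => -[//|/contrapT].
      rewrite (bigD1 p)//=; have [_ ->//] := mA p.
      by rewrite indicE memNset// mul0r.
    rewrite integral_indic ?setIT//.
    apply: fin_bigcap_measurable => [|p _]; first exact: finite_finset.
    by rewrite -[X in measurable X]setTI; apply: mX => //; have [] := mA p.
  rewrite indX//; last by move=> p; have [] := mA p.
  rewrite -prodEFin; apply: eq_bigr => p pD; rewrite -fC//.
  have [mAp ->//] := mA p.
  transitivity (\int[P]_x (\1_(X p @^-1` A p) x)%:E)%E.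
    by rewrite integral_indic ?setIT// -[X in measurable X]setTI; exact: mX.
  by apply: eq_integral => x _; rewrite !indicE.
have [aD|aD] := boolP (a \in D); last first.
  apply: IH => // p pD pK; apply: fA => //.
  by rewrite inE negb_or pK andbT; apply: contraNneq aD => <-.
pose H x := \prod_(p in D | p != a) f p (X p x).
pose c := \prod_(p in D | p != a) C p.
have C0 p : p \in D -> 0 <= C p.
  move=> pD; rewrite -lee_fin -fC//; apply: integral_ge0 => x _.
  by rewrite lee_fin f0.
transitivity (\int[P]_x (H x * f a (X a x))%:E)%E.
  by apply: eq_integral => x _; rewrite (bigD1 a)//= mulrC.
rewrite (@ge0_integral_weighted _ _ _ _ H (X a) c); last 6 first.
- by apply: (@mprod (fun p => (p \in D) && (p != a))) => p /andP[+ _]; exact: mf.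
- by move=> x; apply: prodr_ge0 => p /andP[pD _]; exact: f0.
- by apply: prodr_ge0 => p /andP[pD _]; exact: C0.
(* With the indicator of A in place of [f a], the coordinate a leaves the list and the induction
   hypothesis applies. *)
- move=> A mA.
  have := IH (fun p => if p == a then \1_A else f p)
    (fun p => if p == a then fine (P (X a @^-1` A)) else C p).
  rewrite (bigD1 a)//= eqxx.
  have PA : (fine (P (X a @^-1` A)))%:E = P (X a @^-1` A).
    by rewrite fineK// fin_num_measure// -[X in measurable X]setTI; exact: mX.
  have -> : \prod_(i in D | i != a) (if i == a then fine (P (X a @^-1` A)) else C i) = c.
    by apply: eq_bigr => i /andP[_ /negPf ->].
  rewrite mulrC EFinM PA => <- //.
  + apply: eq_integral => x _; rewrite (bigD1 a)//= eqxx mulrC; congr EFin; congr (_ * _).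
    by apply: eq_bigr => i /andP[_ /negPf ->].
  + by move=> p pD; case: (p == a); [exact: measurable_indic|exact: mf].
  + by move=> p pD y; case: eqP => // _; exact: f0.
  + move=> p pD pK; case: eqVneq => [_|pa]; first by exists A.
    by apply: fA => //; rewrite inE negb_or pa.
  + move=> p pD; case: eqVneq => [->|pa]; last exact: fC.
    rewrite PA; transitivity (\int[P]_x (\1_(X a @^-1` A) x)%:E)%E.
      by apply: eq_integral => x _; rewrite !indicE.
    by rewrite integral_indic ?setIT// -[X in measurable X]setTI; exact: mX.
- exact: mf.
- exact: f0.
by rewrite fC// -EFinM mulrC [in RHS](bigD1 a).
Qed.

(** Induction on a list of the coordinates whose factor may change sign: the factor at a is the
    difference of its positive part u and its negative part v, and each part gives a product with
    one sign-changing coordinate fewer. *)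
Lemma integral_indep_prod (q : I -> measurableTypeR R -> R) :
  (forall p, p \in D -> measurable_fun setT (q p)) ->
  (forall p, p \in D -> P.-integrable setT (fun x => (q p (X p x))%:E)) ->
  P.-integrable setT (fun x => (\prod_(p in D) q p (X p x))%:E) /\
  \int[P]_x (\prod_(p in D) q p (X p x)) =
  \prod_(p in D) \int[P]_x (q p (X p x)).
Proof.
have [K Kq] : exists K : seq I, forall p, p \in D -> p \notin K ->
    forall y, 0 <= q p y.
  by exists (index_enum I) => p pD /negP; case; exact: mem_index_enum.
elim: K q Kq => [|a K IH] q Kq mq iq.
  have C p : p \in D ->
      (\int[P]_x (q p (X p x))%:E = (\int[P]_x (q p (X p x)))%:E)%E.
    by move=> pD; rewrite /Rintegral fineK//; exact: integrable_fin_num (iq p pD).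
  have E : (\int[P]_x (\prod_(p in D) q p (X p x))%:E =
      (\prod_(p in D) \int[P]_x (q p (X p x)))%:E)%E.
    apply: (@ge0_integral_indep_prod (index_enum I)) => //.
      by move=> p pD; exact: Kq.
    by move=> p _ /negP; case; exact: mem_index_enum.
  split; last by rewrite /Rintegral E.
  apply/integrableP; split.
    by apply/measurable_EFinP; exact: (@mprod (fun p => p \in D)).
  under eq_integral => x _.
    rewrite gee0_abs; last first.
      by rewrite lee_fin; apply: prodr_ge0 => p pD; exact: Kq.
    over.
  by rewrite E ltry.
have [aD|aD] := boolP (a \in D); last first.
  apply: IH => // p pD pK; apply: Kq => //.
  by rewrite inE negb_or pK andbT; apply: contraNneq aD => <-.
pose q1 (u : measurableTypeR R -> R) p := if p == a then u else q p.
pose u y := Num.max (q a y) 0.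
pose v y := Num.max (- q a y) 0.
have quv y : q a y = u y - v y.
  rewrite /u /v /Num.max oppr_lt0; case: ltrP => qa; case: ltrP => qb; lra.
have mu : measurable_fun setT u by apply: measurable_maxr => //; exact: mq.
have mv : measurable_fun setT v.
  by apply: measurable_maxr => //; apply: measurable_funN; exact: mq.
have iu (w : measurableTypeR R -> R) : measurable_fun setT w -> (forall y, 0 <= w y) ->
    (forall y, w y <= `|q a y|) -> [/\
    P.-integrable setT (fun x => (\prod_(p in D) q1 w p (X p x))%:E) &
    \int[P]_x (\prod_(p in D) q1 w p (X p x)) =
    \int[P]_x (w (X a x)) * \prod_(p in D | p != a) \int[P]_x (q p (X p x))]
    /\ P.-integrable setT (fun x => (w (X a x))%:E).
  move=> mw w0 wq.
  have iw : P.-integrable setT (fun x => (w (X a x))%:E).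
    apply: (le_integrable measurableT _ _ (iq a aD)).
      by apply/measurable_EFinP; exact: mcomp.
    by move=> x _ /=; rewrite lee_fin ger0_norm.
  have [] := IH (q1 w).
  - move=> p pD pK y; rewrite /q1; case: eqVneq => // pa.
    by apply: Kq => //; rewrite inE negb_or pa.
  - by move=> p pD; rewrite /q1; case: eqVneq => // _; exact: mq.
  - by move=> p pD; rewrite /q1; case: eqVneq => [->//|_]; exact: iq.
  move=> i1 ->; split=> //; split=> //.
  rewrite (bigD1 a)//= /q1 eqxx; congr (_ * _).
  by apply: eq_bigr => p /andP[_ /negPf ->].
have [[iu1 iu2] iu3] := iu u mu (fun y => ltac:(by rewrite /u le_max lexx orbT))
  (fun y => ltac:(by rewrite /u ge_max ler_norm normr_ge0)).
have [[iv1 iv2] iv3] := iu v mv (fun y => ltac:(by rewrite /v le_max lexx orbT))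
  (fun y => ltac:(by rewrite /v ge_max -normrN ler_norm normr_ge0)).
have E x : \prod_(p in D) q p (X p x) =
    \prod_(p in D) q1 u p (X p x) - \prod_(p in D) q1 v p (X p x).
  rewrite (bigD1 a)//= quv [in RHS](bigD1 a)//= [X in _ = _ - X](bigD1 a)//=.
  rewrite /q1 eqxx mulrBl; congr (_ * _ - _ * _);
    by apply: eq_bigr => p /andP[_ /negPf ->].
split.
  rewrite (_ : (fun x => _) = (fun x => (\prod_(p in D) q1 u p (X p x))%:E -
     (\prod_(p in D) q1 v p (X p x))%:E)%E); last first.
    by apply/funext => x; rewrite E EFinB.
  exact: integrableB.
rewrite (_ : (fun x => _) = (fun x => \prod_(p in D) q1 u p (X p x)
   - \prod_(p in D) q1 v p (X p x))); last exact/funext.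
rewrite RintegralB// iu2 iv2 -mulrBl [in RHS](bigD1 a)//=; congr (_ * _).
rewrite -RintegralB//; apply: eq_Rintegral => x _.
by rewrite quv.
Qed.

End independent_product.

(** * A five-point signed measure with the moments of the entry law *)

Section quadrature_nodes.
Context (R : realType) (m3 m4 : R).

Definition node5 (k : 'I_5) : R := k%:R - 2.

(* The even and odd parts of the weights are determined by the moments of
   order 2, 4 and 1, 3 respectively; the weights may be negative. *)
Definition wt5 (k : 'I_5) : R :=
  nth 0 [:: (m4 - 1) / 24 - m3 / 12; (1 - (m4 - 1) / 3) / 2 + m3 / 6;
            1 - (m4 - 1) / 12 - (1 - (m4 - 1) / 3);
            (1 - (m4 - 1) / 3) / 2 - m3 / 6; (m4 - 1) / 24 + m3 / 12] k.

Lemma wt5_sum : \sum_k wt5 k = 1.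
Proof. by rewrite !big_ord_recl big_ord0 /wt5 /=; field. Qed.

Lemma mom5 (e : nat) : (e < 5)%N ->
  mom wt5 node5 e = nth 0 [:: 1; 0; 1; m3; m4] e.
Proof.
rewrite /mom /qE1 !big_ord_recl big_ord0 /wt5 /node5 /=.
by case: e => [|[|[|[|[|e]]]]]//= _; rewrite ?expr0 ?expr1 ?exprS ?expr0 /bump /=; field.
Qed.

End quadrature_nodes.

Section poly_moments.
Context (R : realType) (Q : probability (measurableTypeR R) R).
Hypothesis Q_mean : (\int[Q]_x (x : R)%:E = 0)%E.
Hypothesis Q_var : (\int[Q]_x ((x : R) ^+ 2)%:E = 1)%E.
Hypothesis Q_moment4 : (\int[Q]_x ((x : R) ^+ 4)%:E < +oo)%E.

Definition law_mom (e : nat) : R := \int[Q]_x ((x : R) ^+ e).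

Lemma measurable_powR (e : nat) :
  measurable_fun setT (fun x : measurableTypeR R => (x : R) ^+ e).
Proof. by apply: measurable_funX; exact: measurable_id. Qed.

Lemma integrable_pow (e : nat) : (e <= 4)%N ->
  Q.-integrable setT (fun x : measurableTypeR R => ((x : R) ^+ e)%:E).
Proof.
move=> e4.
have i4 : Q.-integrable setT (fun x : measurableTypeR R => ((x : R) ^+ 4)%:E).
  apply/integrableP; split; first by apply/measurable_EFinP; exact: measurable_powR.
  under eq_integral => x _.
    rewrite gee0_abs ?lee_fin ?exprn_even_ge0//.
    over.
  exact: Q_moment4.
have i1 : Q.-integrable setT (fun x : measurableTypeR R => (1 + (x : R) ^+ 4)%:E).
  under eq_fun do rewrite EFinD.
  by apply: integrableD => //; exact: finite_measure_integrable_cst.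
apply: (le_integrable measurableT _ _ i1).
  by apply/measurable_EFinP; exact: measurable_powR.
move=> x _ /=; rewrite lee_fin [leRHS]ger0_norm ?addr_ge0 ?exprn_even_ge0//.
rewrite normrX; have [x1|x1] := lerP `|x : R| 1.
  rewrite (le_trans (exprn_ile1 _ _ _))// ?ler_wpDr ?exprn_even_ge0//.
rewrite (le_trans (ler_weXn2l (ltW x1) e4))//.
by rewrite -normrX ger0_norm ?exprn_even_ge0// ler_wpDl.
Qed.

Lemma law_momE (e : nat) : (e < 5)%N ->
  law_mom e = nth 0 [:: 1; 0; 1; law_mom 3; law_mom 4] e.
Proof.
case: e => [|[|[|[|[|e]]]]]//= _; rewrite /law_mom.
- under eq_Rintegral do rewrite expr0.
  rewrite Rintegral_cst//. by rewrite mul1r; exact: (congr1 fine (probability_setT Q)).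
- by under eq_Rintegral do rewrite expr1; rewrite /Rintegral Q_mean.
- by rewrite /Rintegral Q_var.
Qed.

Let wt := wt5 (law_mom 3) (law_mom 4).
Let node := @node5 R.

Lemma mom_law (e : nat) : (e < 5)%N -> mom wt node e = law_mom e.
Proof. by move=> e5; rewrite (law_momE e5) mom5. Qed.

Lemma poly_law (g : {poly R}) : (size g <= 5)%N ->
  Q.-integrable setT (fun x : measurableTypeR R => (g.[x])%:E) /\
  \int[Q]_x g.[x] = qE1 wt node (fun y => g.[y]).
Proof.
move=> g5.
have gE (x : R) : g.[x] = \sum_(e < 5) g`_e * x ^+ e by rewrite (horner_coef_wide _ g5).
have ie (e : 'I_5) : Q.-integrable setT
    (fun x : measurableTypeR R => (g`_e * (x : R) ^+ e)%:E).
  under eq_fun do rewrite EFinM.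
  by apply: integrableZl => //; apply: integrable_pow; rewrite -ltnS.
split.
  under eq_fun => x do rewrite gE -sumEFin.
  by apply: (integrable_sum measurableT) => e _; exact: ie.
transitivity (\sum_(e < 5) g`_e * law_mom e).
  transitivity (\int[Q]_x \sum_(e < 5) g`_e * (x : R) ^+ e).
    by apply: eq_Rintegral => x _; rewrite gE.
  rewrite /Rintegral; under eq_integral do rewrite -sumEFin.
  rewrite integral_sum//.
  rewrite -sum_fine; last by move=> e _; exact: integrable_fin_num.
  apply: eq_bigr => e _; rewrite -/(Rintegral _ _ _) RintegralZl//.
  by apply: integrable_pow; rewrite -ltnS.
rewrite /qE1; under [RHS]eq_bigr do rewrite gE mulr_sumr.
rewrite exchange_big; apply: eq_bigr => e _.
by rewrite -mom_law// mulr_sumr; apply: eq_bigr => k _; rewrite mulrCA.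
Qed.

End poly_moments.

Lemma Rintegral_fsum d (T : measurableType d) (R : realType)
    (mu : {measure set T -> \bar R}) (D : set T) (I : finType) (f : I -> T -> R) :
  measurable D -> (forall i, mu.-integrable D (fun x => (f i x)%:E)) ->
  mu.-integrable D (fun x => (\sum_i f i x)%:E) /\
  \int[mu]_(x in D) (\sum_i f i x) = \sum_i \int[mu]_(x in D) f i x.
Proof.
move=> mD fi; split.
  under eq_fun do rewrite -sumEFin.
  by apply: (integrable_sum mD) => i _; exact: fi.
rewrite /Rintegral; under eq_integral do rewrite -sumEFin.
rewrite integral_sum// -sum_fine// => i _.
exact: integrable_fin_num.
Qed.

Section entry_polynomials.
Context (R : realType) (n : nat) (la : R).

Definition pkey (i j : 'I_n) : 'I_n * 'I_n := if (i < j)%N then (i, j) else (j, i).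

Definition entry_poly (i j : 'I_n) : {poly R} :=
  if i == j then Num.sqrt 2 *: 'X - la%:P else 'X.

Lemma pkey_upper i j : pkey i j \in upper_triangle n.
Proof. by rewrite /pkey inE; case: ifP => /=; lia. Qed.

Lemma charm_entry (x : 'I_n * 'I_n -> R) i j :
  charm la x i j = (entry_poly i j).[x (pkey i j)].
Proof.
rewrite !mxE /entry_poly /pkey; have [<-|ij] := eqVneq i j.
  by rewrite ltnn !hornerE mulr1n.
by rewrite mulr0n subr0 hornerX; case: ifP.
Qed.

Lemma size_entry_poly i j : (size (entry_poly i j) <= 2)%N.
Proof.
rewrite /entry_poly; case: ifP => _; last by rewrite size_polyX.
rewrite (leq_trans (size_polyD _ _))// size_polyN geq_max.
rewrite (leq_trans (size_scale_leq _ _)) ?size_polyX//.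
by rewrite (leq_trans (size_polyC_leq1 _)).
Qed.

Definition key_poly (s : 'S_n) (p : 'I_n * 'I_n) : {poly R} :=
  \prod_(i | pkey i (s i) == p) entry_poly i (s i).

(** Row i uses the variable p only if i is [p.1] or [p.2], so p has degree at most 2 in each term of
    a determinant. In a product of two determinants the degree is at most 4, up to which the
    quadrature reproduces the moments of Q. *)
Lemma size_key_poly s p : (size (key_poly s p) <= 3)%N.
Proof.
rewrite (leq_trans (size_prod_leq _ _))//.
have c2 : (#|[pred i | pkey i (s i) == p]| <= 2)%N.
  apply: (@leq_trans #|[set p.1; p.2]%SET|); last first.
    by rewrite cards2; case: (_ != _).
  apply: subset_leq_card; apply/fintype.subsetP => i; rewrite !inE => /eqP <-.
  by rewrite /pkey; case: ifP => _ /=; rewrite eqxx ?orbT.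
have : (\sum_(i | pkey i (s i) == p) size (entry_poly i (s i)) <=
    \sum_(i : 'I_n | pkey i (s i) == p) 2)%N.
  by apply: leq_sum => i _; exact: size_entry_poly.
rewrite sum_nat_const => Sc; rewrite leq_subLR (leq_ltn_trans Sc)//.
by rewrite muln2 -addnn -addnS leq_add2l.
Qed.

Lemma key_poly_notin s p : p \notin upper_triangle n -> key_poly s p = 1.
Proof.
move=> np; rewrite /key_poly big1// => i /eqP ip.
by rewrite -ip pkey_upper in np.
Qed.

Lemma prod_charm (x : 'I_n * 'I_n -> R) (s : 'S_n) :
  \prod_i charm la x i (s i) = \prod_p (key_poly s p).[x p].
Proof.
rewrite (partition_big (fun i => pkey i (s i)) xpredT)//=.
apply: eq_bigr => p _; rewrite /key_poly horner_prod.
by apply: eq_bigr => i /eqP <-; exact: charm_entry.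
Qed.

End entry_polynomials.

Section expectation_of_determinants.
Context (R : realType) (Q : probability (measurableTypeR R) R).
Hypothesis Q_mean : (\int[Q]_x (x : R)%:E = 0)%E.
Hypothesis Q_var : (\int[Q]_x ((x : R) ^+ 2)%:E = 1)%E.
Hypothesis Q_moment4 : (\int[Q]_x ((x : R) ^+ 4)%:E < +oo)%E.
Context d (T : measurableType d) (P : probability T R) (n : nat).
Context (X : 'I_n * 'I_n -> {RV P >-> measurableTypeR R}).
Hypothesis X_iid : iid_RVs (upper_triangle n) X Q.

Local Notation wt := (wt5 (law_mom Q 3) (law_mom Q 4)).
Local Notation node := (@node5 R).
Local Notation at_ w := (fun p => X p w : R).

Definition matches (F : ('I_n * 'I_n -> R) -> R) : Prop :=
  P.-integrable setT (fun w => (F (at_ w))%:E) /\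
  \int[P]_w F (at_ w) = qE wt node F.

Lemma matchesZ c F : matches F -> matches (fun x => c * F x).
Proof.
move=> [iF EF]; split.
  by under eq_fun do rewrite EFinM; exact: integrableZl.
by rewrite RintegralZl// EF qEZ.
Qed.

Lemma matches_sum (I : finType) (F : I -> ('I_n * 'I_n -> R) -> R) :
  (forall i, matches (F i)) -> matches (fun x => \sum_i F i x).
Proof.
move=> mF.
have [i1 i2] := @Rintegral_fsum _ T R P setT I (fun i w => F i (at_ w))
  measurableT (fun i => (mF i).1).
split => //; rewrite i2 qE_sum.
by apply: eq_bigr => i _; rewrite (mF i).2.
Qed.

Lemma matches_ext F G : F =1 G -> matches F -> matches G.
Proof. by move=> /funext ->. Qed.

Lemma poly_entry (g : {poly R}) p : (size g <= 5)%N -> p \in upper_triangle n ->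
  P.-integrable setT (fun w => (g.[X p w])%:E) /\
  \int[P]_w g.[X p w] = qE1 wt node (fun y => g.[y]).
Proof.
move=> g5 pU; have [ig <-] := poly_law Q_mean Q_var Q_moment4 g5.
have mg : measurable_fun setT (fun y : measurableTypeR R => g.[y]).
  by apply/measurable_EFinP; exact: measurable_int ig.
have lawE (f : measurableTypeR R -> \bar R) : 
    (\int[distribution P (X p)]_x f x = \int[Q]_x f x)%E.
  by apply: eq_measure_integral => A mA _; exact: X_iid.2.
have iX : P.-integrable setT (fun w => (g.[X p w])%:E).
  apply/integrableP; split.
    apply/measurable_EFinP; apply: (measurableT_comp mg).
    exact: measurable_funPT.
  rewrite -(@ge0_integral_distribution _ _ _ _ _ P (X p)
    (fun y => `|(g.[y])%:E|%E))//; last first.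
    by apply: measurableT_comp => //; exact/measurable_EFinP.
  by rewrite lawE; move/integrableP : ig => [].
split=> //; rewrite /Rintegral -lawE.
by rewrite (@integral_distribution _ _ _ _ _ P (X p))//; exact/measurable_EFinP.
Qed.

(** Nothing is assumed of [X p] below the diagonal, hence the condition that the factor be 1 there;
    the quadrature, which runs over all pairs, gives 1 for such a factor. *)
Lemma matches_prod (q : 'I_n * 'I_n -> {poly R}) :
  (forall p, (size (q p) <= 5)%N) ->
  (forall p, p \notin upper_triangle n -> q p = 1) ->
  matches (fun x => \prod_p (q p).[x p]).
Proof.
move=> q5 q1.
have E x : \prod_p (q p).[x p] = \prod_(p in upper_triangle n) (q p).[x p].
  rewrite [RHS]big_mkcond; apply: eq_bigr => p _.
  by case: ifPn => // /q1 ->; rewrite hornerE.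
have mq p : measurable_fun setT (fun y : measurableTypeR R => (q p).[y]).
  apply/measurable_EFinP.
  by have [/measurable_int] := poly_law Q_mean Q_var Q_moment4 (q5 p).
have [i1 i2] := @integral_indep_prod _ T R P _ X _ X_iid.1
  (fun p y => (q p).[y]) (fun p _ => mq p)
  (fun p pU => (poly_entry (q5 p) pU).1).
split.
  by under eq_fun do rewrite E.
rewrite (@qE_prod _ _ wt node _ (fun p y => (q p).[y])).
under eq_Rintegral do rewrite E.
rewrite i2 big_mkcond; apply: eq_bigr => p _.
case: ifPn => [pU|/q1 ->]; first by rewrite (poly_entry (q5 p) pU).2.
rewrite /qE1; under eq_bigr do rewrite hornerE mulr1.
by rewrite wt5_sum.
Qed.

Lemma matches_det la : matches (fun x => \det (charm la x)).
Proof.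
apply: matches_sum => s; apply: matchesZ.
apply: (matches_ext (F := fun x => \prod_p (key_poly la s p).[x p])).
  by move=> x; rewrite prod_charm.
apply: matches_prod => p; first by rewrite (leq_trans (size_key_poly _ _ _)).
exact: key_poly_notin.
Qed.

Lemma matches_detdet la mu :
  matches (fun x => \det (charm la x) * \det (charm mu x)).
Proof.
apply: (matches_ext (F := fun x => \sum_(s : 'S_n) \sum_(t : 'S_n)
   ((-1) ^+ s * (-1) ^+ t) *
     \prod_p (key_poly la s p * key_poly mu t p).[x p])).
  move=> x; rewrite mulr_suml; apply: eq_bigr => s _.
  rewrite mulr_sumr; apply: eq_bigr => t _.
  rewrite !prod_charm mulrACA -big_split; congr (_ * _).
  by apply: eq_bigr => p _; rewrite hornerM.
apply: matches_sum => s; apply: matches_sum => t; apply: matchesZ.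
apply: matches_prod => p.
  rewrite (leq_trans (size_polyMleq _ _))//.
  have := size_key_poly la s p; have := size_key_poly mu t p; lia.
by move=> np; rewrite !key_poly_notin// mulr1.
Qed.

End expectation_of_determinants.

Section covariance_formula.
Context (R : realType) (Q : probability (measurableTypeR R) R).
Hypothesis Q_mean : (\int[Q]_x (x : R)%:E = 0)%E.
Hypothesis Q_var : (\int[Q]_x ((x : R) ^+ 2)%:E = 1)%E.
Hypothesis Q_moment4 : (\int[Q]_x ((x : R) ^+ 4)%:E < +oo)%E.
Context d (T : measurableType d) (P : probability T R) (n : nat).
Context (X : 'I_n * 'I_n -> {RV P >-> measurableTypeR R}).
Hypothesis X_iid : iid_RVs (upper_triangle n) X Q.

Definition half_excess : R := (law_mom Q 4 - 3) / 2.

Definition hermite_cov (b : R) (m : nat) (la mu : R) : R :=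
  \sum_(k < m) expsq_coef2 b (m - k)%N * hermite_pair la mu k.

(** In [detdet_closed] the term k = n has coefficient [expsq_coef2 b 0] = 1 and equals the product
    of the two means, the signs (-1)^n cancelling. The covariance is what remains, so [hermite_cov]
    stops before n. *)
Lemma covariance_char_det (la mu : R) :
  fine (covariance P (fun w => char_det (wigner_mx (fun p => X p w)) la)
                     (fun w => char_det (wigner_mx (fun p => X p w)) mu)) =
  n`!%:R * hermite_cov half_excess n la mu.
Proof.
have [i1 E1] := matches_det Q_mean Q_var Q_moment4 X_iid la.
have [i2 E2] := matches_det Q_mean Q_var Q_moment4 X_iid mu.
have [i12 E12] := matches_detdet Q_mean Q_var Q_moment4 X_iid la mu.
rewrite covarianceE; last 3 first.
- exact/Lfun1_integrable.
- exact/Lfun1_integrable.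
- exact/Lfun1_integrable.
have wt1 := wt5_sum (law_mom Q 3) (law_mom Q 4).
have mom1 : mom (wt5 (law_mom Q 3) (law_mom Q 4)) (@node5 R) 1 = 0 by rewrite mom5.
have mom2 : mom (wt5 (law_mom Q 3) (law_mom Q 4)) (@node5 R) 2 = 1 by rewrite mom5.
have fE (f : T -> R) : P.-integrable setT (EFin \o f) -> ('E_P[f] = (\int[P]_w f w)%:E)%E.
  by move=> fi; rewrite unlock /Rintegral fineK//; exact: integrable_fin_num.
rewrite !fE// -EFinM -EFinB /=.
move: E1 E2 E12; rewrite -/(det_mean _ _ _ _) -/(det_mean _ _ _ _) -/(detdet _ _ _ _ _).
rewrite !det_mean_hermite// detdet_closed// mom5//= => E1 E2 E12.
rewrite [X in X - _](_ : _ = n`!%:R * conv (expsq_coef2 half_excess) (hermite_pair la mu) n)//.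
rewrite [X in _ - X * _](_ : _ = (-1) ^+ n * hermite n la)//.
rewrite [X in _ - _ * X](_ : _ = (-1) ^+ n * hermite n mu)//.
rewrite mulrACA -exprD addnn -signr_odd odd_double mul1r.
rewrite /conv big_ord_recr/= subnn mulrDr /hermite_pair.
rewrite {2}/expsq_coef2 psum0 /expsq_coef1 psum0 /expsq_coef /= divr1 expr0.
by rewrite mul1r [X in _ + X - _]mulrC divfK ?addrK// pnatr_eq0 -lt0n fact_gt0.
Qed.

Lemma correlation_char_det (la mu : R) :
  correlation P (fun w => char_det (wigner_mx (fun p => X p w)) la)
                (fun w => char_det (wigner_mx (fun p => X p w)) mu) =
  hermite_cov half_excess n la mu /
    (Num.sqrt (hermite_cov half_excess n la la)
     * Num.sqrt (hermite_cov half_excess n mu mu)).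
Proof.
rewrite /correlation /variance !covariance_char_det.
have f0 : 0 <= n`!%:R :> R by [].
have fn0 : n`!%:R != 0 :> R by rewrite pnatr_eq0 -lt0n fact_gt0.
rewrite !sqrtrM// mulrACA -expr2 sqr_sqrtr// invfM mulrA.
by rewrite [n`!%:R * _]mulrC mulfK.
Qed.

End covariance_formula.

(** * Derivatives and integrals on the half line *)

Section derivatives.
Context (R : realType).
Implicit Types (f g : R -> R) (x c : R).

Lemma dif_cst c x : is_derive x 1 (fun=> c : R) 0.
Proof. exact: is_derive_cst. Qed.

Lemma dif_id x : is_derive x 1 (fun t : R => t) 1.
Proof. exact: is_derive_id. Qed.

Lemma dif_add f g x df dg : is_derive x 1 f df -> is_derive x 1 g dg ->
  is_derive x 1 (fun t => f t + g t) (df + dg).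
Proof. by move=> ? ?; exact: is_deriveD. Qed.

Lemma dif_opp f x df : is_derive x 1 f df ->
  is_derive x 1 (fun t => - f t) (- df).
Proof. by move=> ?; exact: is_deriveN. Qed.

Lemma dif_mul f g x df dg : is_derive x 1 f df -> is_derive x 1 g dg ->
  is_derive x 1 (fun t => f t * g t) (df * g x + f x * dg).
Proof.
move=> df' dg'; apply: (is_derive_eq (is_deriveM df' dg')).
by rewrite /GRing.scale /= addrC mulrC.
Qed.

Lemma dif_pow f n x df : is_derive x 1 f df ->
  is_derive x 1 (fun t => f t ^+ n) (n%:R * f x ^+ n.-1 * df).
Proof.
move=> df'; rewrite (_ : (fun t => _) = f ^+ n); last first.
  by apply/funext => t; rewrite exprfctE.
exact: is_deriveX.
Qed.

Lemma dif_comp f g x a b : is_derive (g x) 1 f a -> is_derive x 1 g b ->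
  is_derive x 1 (fun t => f (g t)) (a * b).
Proof. by move=> ? ?; exact: (@is_derive1_comp R f g x a b). Qed.

Lemma dif_exp f x df : is_derive x 1 f df ->
  is_derive x 1 (fun t => expR (f t)) (expR (f x) * df).
Proof. by move=> ?; exact: dif_comp. Qed.

Lemma dif_cos f x df : is_derive x 1 f df ->
  is_derive x 1 (fun t => cos (f t)) (- sin (f x) * df).
Proof. by move=> ?; exact: dif_comp. Qed.

Lemma dif_sin f x df : is_derive x 1 f df ->
  is_derive x 1 (fun t => sin (f t)) (cos (f x) * df).
Proof. by move=> ?; exact: dif_comp. Qed.

Lemma dif_eq f x a b : is_derive x 1 f a -> a = b -> is_derive x 1 f b.
Proof. by move=> ? <-. Qed.

Lemma dif_continuous f (df : R -> R) : (forall x, is_derive x 1 f (df x)) ->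
  continuous f.
Proof.
move=> fdf x; apply: differentiable_continuous.
by apply/derivable1_diffP; have [] := fdf x.
Qed.

End derivatives.

Ltac dif :=
  repeat first
    [ eassumption | apply: dif_cst | apply: dif_id
    | apply: dif_add | apply: dif_opp | apply: dif_mul | apply: dif_pow
    | apply: dif_exp | apply: dif_cos | apply: dif_sin ].

Section half_line_integrals.
Context (R : realType).
Local Notation mu := (@lebesgue_measure R).
Local Notation Y := (`[0, +oo[%classic : set R).
Implicit Types (f g F : R -> R).

Lemma measurable_cont f (D : set R) : continuous f -> measurable_fun D f.
Proof.
by move=> cf; apply: measurable_funTS; exact: continuous_measurable_fun.
Qed.

Lemma Rint_FTC f F (a b : R) : a <= b -> continuous f ->
  (forall x : R, is_derive x 1 F (f x)) ->
  \int[mu]_(x in `[a, b]) f x = F b - F a.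
Proof.
move=> ab cf dF; have [->|/negPf ba] := eqVneq a b.
  by rewrite set_itv1 Rintegral_set1 subrr.
have {ba}ab : a < b by rewrite lt_def eq_sym ba.
have cF := dif_continuous dF.
rewrite /Rintegral (@continuous_FTC2 _ f F)//.
- exact: continuous_subspaceT.
- split => [x _||]; first by have [] := dF x.
  + by apply: cvg_at_right_filter; exact: cF.
  + by apply: cvg_at_left_filter; exact: cF.
- by move=> x _; rewrite derive1E; have [_ <-] := dF x.
Qed.

Lemma integrable_dom f g (D : set R) : measurable D -> measurable_fun D f ->
  (forall x, D x -> `|f x| <= g x) -> mu.-integrable D (EFin \o g) ->
  mu.-integrable D (EFin \o f).
Proof.
move=> mD mf fg ig; apply: le_integrable ig => //.
  exact/measurable_EFinP.
move=> x Dx /=; rewrite lee_fin (le_trans (fg x Dx))//.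
by rewrite ler_norm.
Qed.

Lemma integrable_segment f (a b : R) : continuous f ->
  mu.-integrable `[a, b] (EFin \o f).
Proof.
move=> cf; apply: continuous_compact_integrable; first exact: segment_compact.
exact: continuous_subspaceT.
Qed.

Lemma Rdominated_cvg (D : set R) (f_ : nat -> R -> R) f g :
  measurable D -> (forall n, measurable_fun D (f_ n)) ->
  (forall x, D x -> f_ n x @[n --> \oo] --> f x) ->
  mu.-integrable D (EFin \o g) ->
  (forall n x, D x -> `|f_ n x| <= g x) ->
  mu.-integrable D (EFin \o f) /\
  \int[mu]_(x in D) f_ n x @[n --> \oo] --> \int[mu]_(x in D) f x.
Proof.
move=> mD mf_ f_f ig f_g.
have mfE n : measurable_fun D (fun x => (f_ n x)%:E) by exact/measurable_EFinP.
have f_fE x : D x -> (f_ n x)%:E @[n --> \oo] --> (f x)%:E.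
  by move=> Dx; apply: cvg_EFin; [exact: nearW|exact: f_f].
have mf : measurable_fun D (EFin \o f) by apply: emeasurable_fun_cvg f_fE.
have ae1 : {ae mu, forall x, D x -> (f_ n x)%:E @[n --> \oo] --> (EFin \o f) x}.
  exact: aeW.
have ae2 : {ae mu, forall x n, D x -> (`|(f_ n x)%:E| <= (EFin \o g) x)%E}.
  by apply: aeW => x n Dx; rewrite /= lee_fin f_g.
have [i1 _ i3] := @dominated_convergence _ _ _ mu D mD
  (fun n x => (f_ n x)%:E) (EFin \o f) (EFin \o g) mfE mf ae1 ig ae2.
split => //; apply: fine_cvg.
by rewrite /Rintegral fineK//; exact: integrable_fin_num.
Qed.

Lemma gauss_integrable (k : R) : 0 < k ->
  mu.-integrable Y (fun t => (expR (- (k * t ^+ 2)))%:E).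
Proof.
move=> k0; pose s := Num.sqrt (2 * k)^-1.
have k20 : 0 < 2 * k by rewrite mulr_gt0.
have s0 : s != 0 by rewrite sqrtr_eq0 -ltNge invr_gt0.
have s2 : s ^+ 2 = (2 * k)^-1 by rewrite sqr_sqrtr// invr_ge0 ltW.
have iS : mu.-integrable Y (fun x => (normal_pdf 0 s x)%:E).
  by apply: (integrableS measurableT) => //; exact: integrable_normal_pdf.
rewrite (_ : (fun t => _) =
    (fun t => (normal_peak s)^-1%:E * (normal_pdf 0 s t)%:E)%E); last first.
  apply/funext => t; rewrite /normal_pdf (negPf s0) -EFinM mulKf ?gt_eqF ?normal_peak_gt0//.
  rewrite /normal_fun subr0 s2; congr (expR _)%:E.
  by field; rewrite gt_eqF.
exact: integrableZl.
Qed.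

Lemma cvg_Rint_y f : continuous f -> mu.-integrable Y (EFin \o f) ->
  \int[mu]_(x in `[0, b]) f x @[b --> +oo] --> \int[mu]_(x in Y) f x.
Proof.
move=> cf iF; apply/cvg_pinftyP => u uy.
have E n : \int[mu]_(x in `[0, u n]) f x =
    \int[mu]_(x in Y) (f \_ `[0, u n]) x.
  rewrite Rintegral_mkcond [in RHS]Rintegral_mkcond; congr Rintegral.
  rewrite -patch_setI setIC; congr (_ \_ _).
  by apply/esym/setIidl => x /=; rewrite !in_itv/= => /andP[->].
under eq_fun do rewrite E.
apply: (@Rdominated_cvg Y (fun n => f \_ `[0, u n]) f (fun x => `|f x|) _ _ _ _ _).2 => //.
- move=> n; apply: (measurable_funS measurableT) => //.
  by apply/(measurable_restrictT _ _).1 => //; exact: measurable_cont.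
- move=> x /=; rewrite in_itv/= andbT => x0.
  apply: cvg_near_cst; move/cvgryPge : uy => /(_ x).
  apply: filterS => n xu; rewrite /patch mem_set//= in_itv/= x0//.
- exact: integrable_norm.
- by move=> n x _; rewrite /patch; case: ifP; rewrite ?normr0.
Qed.

Lemma Rint_FTCy f F (l : R) : continuous f -> mu.-integrable Y (EFin \o f) ->
  (forall x : R, is_derive x 1 F (f x)) -> F x @[x --> +oo] --> l ->
  \int[mu]_(x in Y) f x = l - F 0.
Proof.
move=> cf iF dF Fl.
suff h : \int[mu]_(x in `[0, b]) f x @[b --> +oo] --> l - F 0.
  exact: (cvg_unique _ (cvg_Rint_y cf iF) h).
have Fl0 : F x - F 0 @[x --> +oo] --> l - F 0 by apply: cvgB => //; exact: cvg_cst.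
apply: cvg_trans Fl0; apply: near_eq_cvg.
by near=> b; rewrite (@Rint_FTC f F).
Unshelve. all: by end_near. Qed.

Lemma Rint_abs_le (D : set R) f g : measurable D ->
  mu.-integrable D (EFin \o f) -> mu.-integrable D (EFin \o g) ->
  (forall x, D x -> `|f x| <= g x) ->
  `|\int[mu]_(x in D) f x| <= \int[mu]_(x in D) g x.
Proof.
move=> mD i1 i2 fg; apply: (le_trans (le_normr_Rintegral _ _)) => //.
by apply: le_Rintegral => //; exact: integrable_norm.
Qed.

(** By continuity g stays above [g v / 2] on a short interval, and the step function of that height
    is a minorant with positive integral. *)
Lemma Rint_Y_gt0 (g : R -> R) (v : R) : continuous g ->
  mu.-integrable Y (EFin \o g) -> (forall u, 0 <= u -> 0 <= g u) ->
  0 <= v -> 0 < g v -> 0 < \int[mu]_(u in Y) g u.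
Proof.
move=> cg ig g0 v0 gv.
have gv2 : 0 < g v / 2 by rewrite divr_gt0.
have /cvgrPdist_lt/(_ _ gv2)/nbhs_ballP[e /= e0 eP] : g u @[u --> v] --> g v.
  exact: cg.
pose z := v + e / 2; have vz : v < z by rewrite ltrDl divr_gt0.
have gz u : v <= u <= z -> g v / 2 <= g u.
  move=> /andP[vu uz]; have : ball v e u.
    by rewrite /ball /= ltr_norml; move: uz e0; rewrite /z => uz e0; apply/andP; split; lra.
  move=> /eP /=; rewrite ltr_norml => /andP[_ h]; lra.
pose h := (fun=> g v / 2) \_ `[v, z].
have hg u : 0 <= u -> 0 <= h u <= g u.
  move=> u0; rewrite /h /patch; case: ifPn => [/set_mem /=|_]; last by rewrite lexx g0.
  by rewrite in_itv/= => /gz ->; rewrite ltW.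
have ccst : continuous (fun _ : R => g v / 2) by move=> ?; exact: cvg_cst.
have mh : measurable_fun Y h.
  apply: (measurable_funS measurableT) => //.
  by apply/(measurable_restrictT _ _).1 => //; exact: measurable_cont.
have ih : mu.-integrable Y (EFin \o h).
  apply: (@integrable_dom _ g) => //.
  by move=> u /=; rewrite in_itv/= andbT => /hg/andP[h0 h1]; rewrite ger0_norm.
apply: (@lt_le_trans _ _ (\int[mu]_(u in Y) h u)); last first.
  apply: le_Rintegral => //.
  by move=> u /=; rewrite in_itv/= andbT => /hg/andP[].
have -> : \int[mu]_(u in Y) h u = \int[mu]_(u in `[v, z]) (g v / 2).
  rewrite Rintegral_mkcond [in RHS]Rintegral_mkcond; congr Rintegral.
  rewrite /h -patch_setI setIC; congr (_ \_ _); apply/setIidl => u /=.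
  rewrite !in_itv/= andbT => /andP[vu _].
  exact: le_trans vu.
have d (u : R) : is_derive u 1 (fun u => g v / 2 * u) (g v / 2).
  apply: (dif_eq (dif_mul (dif_cst (g v / 2) u) (dif_id u))).
  by rewrite mul0r mulr1 add0r.
by rewrite (Rint_FTC (ltW vz) ccst d) -mulrBr mulr_gt0// subr_gt0.
Qed.

Lemma dif_Rint (D : set R) (F dF : R -> R -> R) (G : R -> R) (u v a : R) :
  measurable D -> u < a < v ->
  (forall x, continuous (F x)) ->
  (forall x, u < x < v -> mu.-integrable D (EFin \o F x)) ->
  (forall (x : R) y, u < x < v -> D y -> is_derive x 1 (F ^~ y) (dF x y)) ->
  (forall y, 0 <= G y) -> mu.-integrable D (EFin \o G) ->
  (forall x y, u < x < v -> D y -> `|dF x y| <= G y) ->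
  is_derive a 1 (fun x => \int[mu]_(y in D) F x y) (\int[mu]_(y in D) dF a y).
Proof.
move=> mD auv cF iF dFP G0 iG dFG.
have Ia : (`]u, v[%classic : set R) a by rewrite /= in_itv/=.
have I2 x : (`]u, v[%classic : set R) x -> u < x < v by rewrite /= in_itv/=.
have pE x y : u < x < v -> D y -> partial1of2 F x y = dF x y.
  by move=> xuv Dy; rewrite partial1of2E; have [_ ->] := dFP x y xuv Dy.
have h1 x : (`]u, v[%classic : set R) x -> mu.-integrable D (EFin \o F x).
  by move=> /I2; exact: iF.
have h2 x y : (`]u, v[%classic : set R) x -> D y -> derivable (F ^~ y) x 1.
  by move=> /I2 xuv Dy; have [] := dFP x y xuv Dy.
have h3 x y : (`]u, v[%classic : set R) x -> D y -> `|partial1of2 F x y| <= G y.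
  by move=> /I2 xuv Dy; rewrite pE// dFG.
apply: DeriveDef.
  exact: (@derivable_under_integral _ _ _ mu F D mD a u v Ia h1 h2 G G0 iG h3).
rewrite -derive1E.
rewrite (@differentiation_under_integral _ _ _ mu F D mD a u v Ia h1 h2 G G0 iG h3).
by apply: eq_Rintegral => y /set_mem Dy; rewrite pE.
Qed.

End half_line_integrals.

(** * The Airy function *)

Section contour_shift.
Context (R : realType).
Local Notation mu := (@lebesgue_measure R).
Local Notation Y := (`[0, +oo[%classic : set R).
Implicit Types (s t x a b : R).

Lemma trig_bound (B C u : R) : `|B * cos u + C * sin u| <= `|B| + `|C|.
Proof.
rewrite (le_trans (ler_normD _ _))// !normrM lerD// ler_piMr//.
  by rewrite ler_norml cos_geN1 cos_le1.
by rewrite ler_norml sin_geN1 sin_le1.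
Qed.

Lemma norm_cos_le1 t : `|cos t| <= 1.
Proof. by rewrite ler_norml cos_geN1 cos_le1. Qed.

Lemma norm_sin_le1 t : `|sin t| <= 1.
Proof. by rewrite ler_norml sin_geN1 sin_le1. Qed.

(* exp(i z^3 / 3 + i x z) at z = t + i s has modulus airy_mod s x t and
   argument airy_arg s x t. *)
Definition airy_mod s x t := expR (s ^+ 3 / 3 - x * s - s * t ^+ 2).
Definition airy_arg s x t := t ^+ 3 / 3 - s ^+ 2 * t + x * t.
Definition airy_re s x t := airy_mod s x t * cos (airy_arg s x t).
Definition airy_im s x t := airy_mod s x t * sin (airy_arg s x t).
Definition airy_dt s x t := airy_mod s x t *
  ((t ^+ 2 - s ^+ 2 + x) * cos (airy_arg s x t)
   + (- 2 * s * t) * sin (airy_arg s x t)).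
Definition airy_dt_re s x t := airy_mod s x t *
  ((- 2 * s * t) * cos (airy_arg s x t)
   + (- (t ^+ 2 - s ^+ 2 + x)) * sin (airy_arg s x t)).

Lemma airy_re_ds s x t : is_derive s 1 (fun s => airy_re s x t) (- airy_dt s x t).
Proof.
rewrite /airy_re /airy_mod /airy_arg; apply: dif_eq; first dif.
by rewrite /airy_dt /airy_mod /airy_arg /GRing.scale /=; field.
Qed.

Lemma airy_im_dt s x t : is_derive t 1 (airy_im s x) (airy_dt s x t).
Proof.
rewrite /airy_im /airy_mod /airy_arg; apply: dif_eq; first dif.
by rewrite /airy_dt /airy_mod /airy_arg /GRing.scale /=; field.
Qed.

Lemma airy_re_dt s x t : is_derive t 1 (airy_re s x) (airy_dt_re s x t).
Proof.
rewrite /airy_re /airy_mod /airy_arg; apply: dif_eq; first dif.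
by rewrite /airy_dt_re /airy_mod /airy_arg /GRing.scale /=; field.
Qed.

Lemma airy_im_ds s x t : is_derive s 1 (fun s => airy_im s x t) (airy_dt_re s x t).
Proof.
rewrite /airy_im /airy_mod /airy_arg; apply: dif_eq; first dif.
by rewrite /airy_dt_re /airy_mod /airy_arg /GRing.scale /=; field.
Qed.

Lemma continuous_airy_re s x : continuous (airy_re s x).
Proof. exact: dif_continuous (airy_re_dt s x). Qed.

Lemma continuous_airy_dt s x : continuous (airy_dt s x).
Proof.
by apply: (@dif_continuous _ _ (fun t => _)) => t.
Qed.

(** Cauchy's theorem on a rectangle in real form: by a Cauchy-Riemann equation the derivative in the
    height s is an exact derivative in t, so only end points contribute, and at t = 0 the imaginary
    part vanishes. *)
Lemma integral_airy_re_ds b x s : 0 <= b ->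
  is_derive s 1 (fun s => \int[mu]_(t in `[0, b]) airy_re s x t)
    (- airy_im s x b).
Proof.
move=> b0.
have -> : - airy_im s x b = \int[mu]_(t in `[0, b]) (- airy_dt s x t).
  have c1 : continuous (fun t => - airy_dt s x t).
    by move=> t; apply: cvgN; exact: continuous_airy_dt.
  have d1 (t : R) : is_derive t 1 (fun t => - airy_im s x t) (- airy_dt s x t).
    by apply: dif_opp; exact: airy_im_dt.
  rewrite (Rint_FTC b0 c1 d1) [X in _ - - X](_ : _ = 0) ?opprK ?addr0//.
  by rewrite /airy_im /airy_arg expr0n/= mul0r !mulr0 subr0 addr0 sin0 mulr0.
(* M bounds the heights within distance 1 of s, and K bounds the s-derivative of the integrand on
   the corresponding rectangle. *)
pose M := `|s| + 1.
have M0 : 0 <= M by rewrite /M addr_ge0.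
pose K := expR (M ^+ 3 + `|x| * M + M * b ^+ 2) * (b ^+ 2 + M ^+ 2 + `|x| + 2 * M * b).
apply: (@dif_Rint _ _ (fun s => airy_re s x) (fun s t => - airy_dt s x t)
  (fun=> K) (s - 1) (s + 1)) => //.
- by apply/andP; split; rewrite ?ltrBlDr ltrDl.
- by move=> u; exact: continuous_airy_re.
- by move=> u _; apply: integrable_segment; exact: continuous_airy_re.
- by move=> u t _ _; exact: airy_re_ds.
- by move=> t; rewrite /K mulr_ge0 ?expR_ge0// addr_ge0 ?mulr_ge0// !addr_ge0 ?sqr_ge0.
- exact/integrable_segment/cst_continuous.
move=> u t /andP[su us] /=; rewrite in_itv/= => /andP[t0 tb].
have uM : `|u| <= M.
  by rewrite /M -lerBlDl (le_trans (lerB_dist _ _))// ler_norml; lra.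
rewrite normrN /airy_dt normrM ger0_norm ?expR_ge0//.
have t2 : 0 <= t ^+ 2 <= b ^+ 2 by rewrite sqr_ge0 /= lerXn2r// nnegrE.
have u2 : 0 <= u ^+ 2 <= M ^+ 2.
  by rewrite sqr_ge0 /= -[u ^+ 2]real_normK ?num_real// lerXn2r// nnegrE.
have [uM1 uM2] : - M <= u /\ u <= M by move: uM; rewrite ler_norml => /andP.
have ut : `|u * t| <= M * b by rewrite normrM ler_pM// ger0_norm.
apply: ler_pM => //; first exact: expR_ge0.
  rewrite ler_expR lerD//.
    rewrite lerD//.
      rewrite (le_trans (ler_norm _))// normrM normrX (ger0_norm (_ : 0 <= 3^-1 :> R))//.
      rewrite ler_pdivrMr// (le_trans (lerXn2r _ _ _ uM)) ?nnegrE//.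
      by rewrite ler_peMr ?exprn_ge0// ler1n.
    by rewrite -mulrN (le_trans (ler_norm _))// normrM normrN ler_wpM2l.
  rewrite -mulNr (le_trans (ler_norm _))// normrM normrN ler_pM//.
  by rewrite ger0_norm; case/andP: t2.
rewrite (le_trans (trig_bound _ _ _))// lerD//.
  rewrite (le_trans (ler_normD _ _))// lerD// (le_trans (ler_normB _ _))//.
  by rewrite !ger0_norm; [apply: lerD; lra|lra..].
by rewrite -mulrA normrM normrN (ger0_norm (_ : 0 <= 2 :> R))// -mulrA ler_wpM2l.
Qed.

End contour_shift.

Section airy_formula.
Context (R : realType).
Local Notation mu := (@lebesgue_measure R).
Local Notation Y := (`[0, +oo[%classic : set R).
Implicit Types (s t x a b : R).

Lemma airy_re_bound a x t :
  `|airy_re a x t| <= expR (a ^+ 3 / 3 - x * a) * expR (- (a * t ^+ 2)).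
Proof.
rewrite /airy_re /airy_mod normrM ger0_norm ?expR_ge0// -expRD ler_piMr ?expR_ge0//.
exact: norm_cos_le1.
Qed.

Lemma airy_re_integrable a x : 0 < a -> mu.-integrable Y (EFin \o airy_re a x).
Proof.
move=> a0.
apply: (@integrable_dom _ _
  (fun t => expR (a ^+ 3 / 3 - x * a) * expR (- (a * t ^+ 2)))) => //.
- by apply: measurable_cont; exact: continuous_airy_re.
- by move=> t _; exact: airy_re_bound.
- rewrite (_ : EFin \o _ = (fun t => (expR (a ^+ 3 / 3 - x * a))%:E *
    (expR (- (a * t ^+ 2)))%:E)%E); last by apply/funext => t; rewrite -EFinM.
  by apply: integrableZl => //; exact: gauss_integrable.
Qed.

(** This is the vertical side at abscissa b: the modulus decays like exp (- b^2 s), whose integral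
    over s is at most 1 / b^2. *)
Lemma contour_correction a b x : 0 <= a -> 0 < b ->
  `|\int[mu]_(s in `[0, a]) airy_im s x b| <= expR (a ^+ 3 / 3 + `|x| * a) / b ^+ 2.
Proof.
move=> a0 b0; set C := expR (_ + _).
have b20 : b != 0 by rewrite gt_eqF.
pose g s := C * expR (- (b ^+ 2 * s)).
have dg s : is_derive s 1 (fun s => - (C / b ^+ 2) * expR (- (b ^+ 2 * s))) (g s).
  have [K KE] : exists K, K = C / b ^+ 2 by eexists.
  have CE : C = K * b ^+ 2 by rewrite KE; field.
  rewrite /g -KE CE; move: (b ^+ 2) => B; apply: dif_eq.
  by rewrite /GRing.scale /=; ring.
have cg : continuous g by apply: (@dif_continuous _ _ (fun t => _)).
have cim : continuous (fun s => airy_im s x b).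
  exact: dif_continuous (fun s => airy_im_ds s x b).
apply: (@le_trans _ _ (\int[mu]_(s in `[0, a]) g s)).
  apply: Rint_abs_le => //; try exact: integrable_segment.
  move=> s /=; rewrite in_itv/= => /andP[s0 sa].
  rewrite /airy_im /airy_mod normrM ger0_norm ?expR_ge0//.
  apply: (@le_trans _ _ (expR (s ^+ 3 / 3 - x * s - s * b ^+ 2))).
    by rewrite ler_piMr ?expR_ge0// norm_sin_le1.
  rewrite /g /C -expRD ler_expR [s * _]mulrC lerD// lerD//.
    by rewrite ler_pM2r// lerXn2r// nnegrE.
  by rewrite -mulNr (le_trans (ler_norm _))// normrM normrN ler_pM// ger0_norm.
rewrite (Rint_FTC a0 cg dg) mulr0 oppr0 expR0 mulr1 mulNr opprK -[leRHS]add0r.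
by rewrite lerD2r oppr_le0 mulr_ge0 ?expR_ge0// divr_ge0 ?expR_ge0// sqr_ge0.
Qed.

(** Lifting the segment from the real axis to height a changes the integral by the vertical side
    only, which vanishes as b grows; at height a the integral converges absolutely. *)
Lemma airy_integral_cvg a x : 0 < a ->
  \int[mu]_(t in `[0, b]) cos (t ^+ 3 / 3 + x * t) @[b --> +oo] -->
  \int[mu]_(t in Y) airy_re a x t.
Proof.
move=> a0.
have h1 : \int[mu]_(t in `[0, b]) airy_re a x t
    + \int[mu]_(s in `[0, a]) airy_im s x b @[b --> +oo] -->
    \int[mu]_(t in Y) airy_re a x t + 0.
  apply: cvgD.
    exact: (cvg_Rint_y (@continuous_airy_re _ a x) (airy_re_integrable x a0)).
  apply/cvgrPdist_le => /= e e0.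
  have C0 : 0 < expR (a ^+ 3 / 3 + `|x| * a) by exact: expR_gt0.
  near=> b.
  have b1 : 1 <= b by near: b; exact: nbhs_pinfty_ge.
  have bC : expR (a ^+ 3 / 3 + `|x| * a) / e <= b.
    by near: b; apply: nbhs_pinfty_ge; rewrite num_real.
  have b0 : 0 < b by exact: (lt_le_trans ltr01 b1).
  rewrite sub0r normrN (le_trans (contour_correction _ (ltW a0) b0))//.
  rewrite ler_pdivrMr ?exprn_gt0//.
  rewrite ler_pdivrMr// in bC; rewrite (le_trans bC)// mulrC ler_pM2l//.
  by rewrite ler_eXnr.
rewrite addr0 in h1.
apply: cvg_trans h1; apply: near_eq_cvg; near=> b.
have b0 : 0 <= b by near: b; exact: nbhs_pinfty_ge.
have cim : continuous (fun s => - airy_im s x b).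
  move=> s; apply: cvgN.
  exact: (dif_continuous (fun s => airy_im_ds s x b)).
have E := Rint_FTC (ltW a0) cim (fun s => integral_airy_re_ds x s b0).
have i0 : \int[mu]_(t in `[0, b]) airy_re 0 x t =
    \int[mu]_(t in `[0, b]) cos (t ^+ 3 / 3 + x * t).
  apply: eq_Rintegral => t _; rewrite /airy_re /airy_mod /airy_arg.
  by rewrite !expr0n /= !mul0r !mulr0 !subr0 expR0 mul1r.
have E2 : \int[mu]_(s in `[0, a]) (- airy_im s x b) =
    - \int[mu]_(s in `[0, a]) airy_im s x b.
  rewrite -mulN1r -RintegralZl//; last first.
    apply: integrable_segment.
    exact: (dif_continuous (fun s => airy_im_ds s x b)).
  by apply: eq_Rintegral => s _; rewrite mulN1r.
move: E; rewrite E2 i0 => /eqP; rewrite eq_sym subr_eq => /eqP ->.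
by rewrite addrAC addNr add0r.
Unshelve. all: by end_near. Qed.

Lemma Ai_contour a x : 0 < a -> Ai x = pi^-1 * \int[mu]_(t in Y) airy_re a x t.
Proof.
move=> a0; rewrite /Ai; congr (_ * _); apply/cvg_lim => //.
exact: airy_integral_cvg.
Qed.

End airy_formula.

Section airy_equation.
Context (R : realType).
Local Notation mu := (@lebesgue_measure R).
Local Notation Y := (`[0, +oo[%classic : set R).
Implicit Types (t x : R).

Lemma dif_int_cos (rho p : R -> R) x : continuous rho -> continuous p ->
  mu.-integrable Y (EFin \o rho) ->
  mu.-integrable Y (EFin \o (fun t => t * rho t)) ->
  is_derive x 1 (fun x => \int[mu]_(t in Y) (rho t * cos (p t + x * t)))
    (- \int[mu]_(t in Y) (t * rho t * sin (p t + x * t))) /\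
  is_derive x 1 (fun x => \int[mu]_(t in Y) (rho t * sin (p t + x * t)))
    (\int[mu]_(t in Y) (t * rho t * cos (p t + x * t))).
Proof.
move=> crho cp irho itrho.
have carg y : continuous (fun t => p t + y * t).
  by move=> t; apply: cvgD; [exact: cp|apply: cvgM; [exact: cvg_cst|exact: cvg_id]].
have ccos y : continuous (fun t => cos (p t + y * t)).
  move=> t; apply: (@continuous_comp _ _ _ (fun t => p t + y * t) cos).
    exact: carg.
  exact: continuous_cos.
have csin y : continuous (fun t => sin (p t + y * t)).
  move=> t; apply: (@continuous_comp _ _ _ (fun t => p t + y * t) sin).
    exact: carg.
  exact: continuous_sin.
have cF (f : R -> R) : continuous f -> continuous (fun t => rho t * f t).
  by move=> cf t; apply: cvgM; [exact: crho|exact: cf].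
have iF (f g : R -> R) : continuous f -> continuous g ->
    mu.-integrable Y (EFin \o g) -> (forall t, `|f t| <= 1) ->
    mu.-integrable Y (EFin \o (fun t => g t * f t)).
  move=> cf cg ig f1; apply: (@integrable_dom _ _ (fun t => `|g t|)) => //.
  - by apply: measurable_cont => t; apply: cvgM; [exact: cg|exact: cf].
  - by move=> t _; rewrite normrM ler_piMr.
  - exact: integrable_norm.
have ctrho : continuous (fun t => t * rho t).
  by move=> t; apply: cvgM; [exact: cvg_id|exact: crho].
split.
  rewrite -mulN1r -RintegralZl//; last first.
    by apply: (iF (fun t => sin (p t + x * t)) _ (csin x) ctrho itrho) => t; exact: norm_sin_le1.
  apply: (@dif_Rint _ _ (fun x t => rho t * cos (p t + x * t))
    (fun x t => -1 * (t * rho t * sin (p t + x * t)))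
    (fun t => `|t * rho t|) (x - 1) (x + 1)) => //.
  - by apply/andP; split; rewrite ?ltrBlDr ltrDl.
  - by move=> y; apply: cF.
  - by move=> y _; apply: iF => // t; exact: norm_cos_le1.
  - move=> y t _ _; move: (rho t) (p t) => r q; apply: dif_eq.
    by rewrite /GRing.scale /=; ring.
  - exact: integrable_norm.
  - by move=> y t _ _; rewrite mulN1r normrN normrM ler_piMr// norm_sin_le1.
apply: (@dif_Rint _ _ (fun x t => rho t * sin (p t + x * t))
  (fun x t => (t * rho t * cos (p t + x * t)))
  (fun t => `|t * rho t|) (x - 1) (x + 1)) => //.
- by apply/andP; split; rewrite ?ltrBlDr ltrDl.
- by move=> y; apply: cF.
- by move=> y _; apply: iF => // t; exact: norm_sin_le1.
- move=> y t _ _; move: (rho t) (p t) => r q; apply: dif_eq.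
  by rewrite /GRing.scale /=; ring.
- exact: integrable_norm.
- by move=> y t _ _; rewrite normrM ler_piMr// norm_cos_le1.
Qed.

(** The line of height 1: there the modulus is exp (1 / 3 - x) exp (- t^2) and the argument is
    [q t + x * t]. The power t^j counts the derivatives taken in x. *)
Let w (j : nat) t := t ^+ j * expR (- t ^+ 2).
Let q t := t ^+ 3 / 3 - t.

Let cw j : continuous (w j).
Proof.
move=> t; apply: cvgM; first exact: exprn_continuous.
exact: (@continuous_gauss_fun R t).
Qed.

Let cq : continuous q.
Proof. by rewrite /q; apply: (@dif_continuous _ _ (fun t => _)). Qed.

Let iw j : (j <= 2)%N -> mu.-integrable Y (EFin \o w j).
Proof.
move=> j2.
apply: (@integrable_dom _ _ (fun t => 2 * expR (- (2^-1 * t ^+ 2)))) => //.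
- by apply: measurable_cont; exact: cw.
- move=> t /=; rewrite in_itv/= andbT => t0.
  rewrite /w normrM normrX ger0_norm// [X in _ * X]ger0_norm ?expR_ge0//.
  have -> : - t ^+ 2 = - (2^-1 * t ^+ 2) + - (2^-1 * t ^+ 2) by field.
  rewrite expRD mulrA ler_pM2r ?expR_gt0// expRN ler_pdivrMr ?expR_gt0//.
  have := expR_ge1Dx (2^-1 * t ^+ 2); set e := expR _ => e1.
  have t2 := sqr_ge0 t; have : 0 <= (t - 1) ^+ 2 := sqr_ge0 _.
  have -> : (t - 1) ^+ 2 = t ^+ 2 - 2 * t + 1 by ring.
  by case: j j2 => [|[|[|//]]] _; rewrite ?expr0 ?expr1 => t1; lra.
- rewrite (_ : EFin \o _ = (fun t => 2%:E * (expR (- (2^-1 * t ^+ 2)))%:E)%E).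
    by apply: integrableZl => //; apply: gauss_integrable; rewrite invr_gt0.
  by apply/funext => t; rewrite -EFinM.
Qed.

Definition airyC (j : nat) x : R := \int[mu]_(t in Y) (w j t * cos (q t + x * t)).
Definition airyS (j : nat) x : R := \int[mu]_(t in Y) (w j t * sin (q t + x * t)).

Let wS j : (fun t => t * w j t) = w j.+1.
Proof. by apply/funext => t; rewrite /w (exprS t j) mulrA. Qed.

Let difCS j x : (j < 2)%N ->
  is_derive x 1 (airyC j) (- airyS j.+1 x) /\
  is_derive x 1 (airyS j) (airyC j.+1 x).
Proof.
move=> j2; have := @dif_int_cos (w j) q x (@cw j) cq (iw (ltnW j2)).
rewrite wS => /(_ (iw j2)) [dC dS]; rewrite /airyC /airyS.
have E t : w j.+1 t = t * w j t by rewrite -wS.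
under [X in is_derive _ _ _ (- X)]eq_Rintegral do rewrite E.
by under [X in _ /\ is_derive _ _ _ X]eq_Rintegral do rewrite E.
Qed.

Let ctrig x (f : R -> R) : continuous f -> continuous (fun t => f (q t + x * t)).
Proof.
move=> cf t; apply: (@continuous_comp _ _ _ (fun t => q t + x * t) f); last exact: cf.
by apply: cvgD; [exact: cq|apply: cvgM; [exact: cvg_cst|exact: cvg_id]].
Qed.

Let itrig j x (f : R -> R) : (j <= 2)%N -> continuous f ->
  (forall t, `|f t| <= 1) ->
  mu.-integrable Y (EFin \o (fun t => w j t * f (q t + x * t))).
Proof.
move=> j2 cf f1; apply: (@integrable_dom _ _ (fun t => `|w j t|)) => //.
- apply: measurable_cont => t; apply: cvgM; first exact: cw.
  exact: ctrig.
- by move=> t _; rewrite normrM ler_piMr.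
- by apply: integrable_norm => //; exact: iw.
Qed.

Let iC j x : (j <= 2)%N -> mu.-integrable Y (EFin \o (fun t => w j t * cos (q t + x * t))).
Proof.
by move=> j2; apply: itrig => //; [exact: continuous_cos|exact: norm_cos_le1].
Qed.

Let iS j x : (j <= 2)%N -> mu.-integrable Y (EFin \o (fun t => w j t * sin (q t + x * t))).
Proof.
by move=> j2; apply: itrig => //; [exact: continuous_sin|exact: norm_sin_le1].
Qed.

(* The integral of the derivative of expR (- t ^+ 2) * sin (q t + x * t). *)
Let airy_rel x : airyC 2 x + (x - 1) * airyC 0 x - 2 * airyS 1 x = 0.
Proof.
pose f t := w 2 t * cos (q t + x * t) + (x - 1) * (w 0 t * cos (q t + x * t))
  - 2 * (w 1 t * sin (q t + x * t)).
have df t : is_derive t 1 (fun t => expR (- t ^+ 2) * sin (q t + x * t)) (f t).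
  rewrite /q; apply: dif_eq.
  by rewrite /f /w /q /GRing.scale /=; field.
have cf : continuous f.
  move=> t; apply: cvgB; first apply: cvgD.
  - by apply: cvgM; [exact: cw|apply: ctrig; exact: continuous_cos].
  - apply: cvgM; first exact: cvg_cst.
    by apply: cvgM; [exact: cw|apply: ctrig; exact: continuous_cos].
  - apply: cvgM; first exact: cvg_cst.
    by apply: cvgM; [exact: cw|apply: ctrig; exact: continuous_sin].
have i1 : mu.-integrable Y (EFin \o (fun t => (x - 1) * (w 0 t * cos (q t + x * t)))).
  rewrite (_ : EFin \o _ = (fun t => (x - 1)%:E * (w 0 t * cos (q t + x * t))%:E)%E).
    by apply: integrableZl => //; exact: iC.
  by apply/funext => t; rewrite -EFinM.
have i2 : mu.-integrable Y (EFin \o (fun t => 2 * (w 1 t * sin (q t + x * t)))).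
  rewrite (_ : EFin \o _ = (fun t => 2%:E * (w 1 t * sin (q t + x * t))%:E)%E).
    by apply: integrableZl => //; exact: iS.
  by apply/funext => t; rewrite -EFinM.
have i3 : mu.-integrable Y (EFin \o
    (fun t => w 2 t * cos (q t + x * t) + (x - 1) * (w 0 t * cos (q t + x * t)))).
  rewrite (_ : EFin \o _ = (fun t => (w 2 t * cos (q t + x * t))%:E +
    ((x - 1) * (w 0 t * cos (q t + x * t)))%:E)%E).
    by apply: integrableD => //; exact: iC.
  by apply/funext => t; rewrite -EFinD.
have i_f : mu.-integrable Y (EFin \o f).
  rewrite (_ : EFin \o _ = (fun t => (w 2 t * cos (q t + x * t) +
    (x - 1) * (w 0 t * cos (q t + x * t)))%:E - (2 * (w 1 t * sin (q t + x * t)))%:E)%E).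
    exact: integrableB.
  by apply/funext => t; rewrite -EFinB.
have F0 : expR (- t ^+ 2) * sin (q t + x * t) @[t --> +oo] --> (0 : R).
  apply: norm_cvg0; apply: (@squeeze_cvgr _ _ _ _ (cst 0) (@gauss_fun R)).
  - apply: nearW => t; rewrite normr_ge0/= normrM ger0_norm ?expR_ge0//.
    by rewrite ler_piMr ?expR_ge0// norm_sin_le1.
  - exact: cvg_cst.
  - exact: cvg_gauss_fun.
have := Rint_FTCy cf i_f df F0.
have -> : expR (- 0 ^+ 2) * sin (q 0 + x * 0) = 0.
  by rewrite mulr0 addr0 /q subr0 !expr0n/= mul0r sin0 mulr0.
rewrite subr0 => E.
have j2 := @iC 2 x isT; have j0 := @iC 0 x isT; have j1 := @iS 1 x isT.
by rewrite -E /f RintegralB// RintegralD// !RintegralZl.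
Qed.

(** The factor exp (- x) is the part of the modulus at height 1 that depends on x, so [airyL] is Ai
    up to the constant [airy_const], and [airyDL] its derivative. *)
Definition airyL x : R := expR (- x) * airyC 0 x.
Definition airyDL x : R := expR (- x) * (- airyC 0 x - airyS 1 x).

Lemma dif_airyL x : is_derive x 1 airyL (airyDL x).
Proof.
have [dC _] := @difCS 0 x isT; have [_ dS] := @difCS 1 x isT.
apply: (dif_eq (dif_mul (dif_exp (dif_opp (dif_id x))) dC)).
by rewrite /airyDL; ring.
Qed.

Lemma dif_airyDL x : is_derive x 1 airyDL (x * airyL x).
Proof.
have [dC _] := @difCS 0 x isT; have [_ dS] := @difCS 1 x isT.
apply: (dif_eq (dif_mul (dif_exp (dif_opp (dif_id x)))
  (dif_add (dif_opp dC) (dif_opp dS)))).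
rewrite /airyL; have := airy_rel x; move: (expR _) => e.
set c2 := airyC 2 x; set c0 := airyC 0 x; set s1 := airyS 1 x => E.
have -> : c2 = 2 * s1 - (x - 1) * c0.
  by rewrite -[LHS](subrK (2 * s1 - (x - 1) * c0)) -[RHS]add0r -E; ring.
ring.
Qed.

(** Bounding sine and cosine by 1 leaves only the factor exp (- x). This is far from the true decay,
    but it holds for every real x and suffices for all later integrals. *)
Lemma airyL_decay : exists2 M, 0 < M &
  forall x, `|airyL x| <= M * expR (- x) /\ `|airyDL x| <= M * expR (- x).
Proof.
pose M0 := \int[mu]_(t in Y) `|w 0 t|; pose M1 := \int[mu]_(t in Y) `|w 1 t|.
have M00 : 0 <= M0 by apply: Rintegral_ge0 => t _; exact: normr_ge0.
have M10 : 0 <= M1 by apply: Rintegral_ge0 => t _; exact: normr_ge0.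
exists (M0 + M1 + 1); first by rewrite ltr_wpDl// addr_ge0.
move=> x.
have C0 : `|airyC 0 x| <= M0.
  apply: Rint_abs_le => //; first exact: iC.
    by apply: integrable_norm => //; exact: iw.
  by move=> t _; rewrite normrM ler_piMr// norm_cos_le1.
have S1 : `|airyS 1 x| <= M1.
  apply: Rint_abs_le => //; first exact: iS.
    by apply: integrable_norm => //; exact: iw.
  by move=> t _; rewrite normrM ler_piMr// norm_sin_le1.
rewrite /airyL /airyDL !normrM !(ger0_norm (expR_ge0 _)).
split; rewrite mulrC ler_pM2r ?expR_gt0//.
  by rewrite (le_trans C0)// -addrA lerDl addr_ge0.
rewrite (le_trans (ler_normB _ _))// normrN.
by rewrite (le_trans (lerD C0 S1))// lerDl.
Qed.

Definition airy_const : R := expR 3^-1 / pi.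

Lemma airy_const_gt0 : 0 < airy_const.
Proof. by rewrite divr_gt0 ?expR_gt0 ?pi_gt0. Qed.

Lemma AiE x : Ai x = airy_const * airyL x.
Proof.
rewrite (Ai_contour x ltr01) /airy_const /airyL [expR _ / pi]mulrC -mulrA.
congr (_ * _); rewrite mulrA -expRD /airyC -RintegralZl//; last exact: iC.
apply: eq_Rintegral => t _; rewrite /airy_re /airy_mod /airy_arg /w /q.
rewrite expr0 mul1r mulrA -expRD; by congr (expR _ * cos _); [field|ring].
Qed.

Lemma derive1_Ai x : derive1 (@Ai R) x = airy_const * airyDL x.
Proof.
rewrite (_ : @Ai R = fun x => airy_const * airyL x); last exact/funext/AiE.
have d : is_derive x 1 (fun x => airy_const * airyL x) (airy_const * airyDL x).
  apply: (dif_eq (dif_mul (dif_cst airy_const x) (dif_airyL x))).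
  by rewrite mul0r add0r.
by rewrite derive1E; have [_ <-] := d.
Qed.

End airy_equation.

(** * The kernel B as an integral over the half line *)

Section airy_kernel.
Context (R : realType).
Local Notation mu := (@lebesgue_measure R).
Local Notation Y := (`[0, +oo[%classic : set R).
Local Notation L := (@airyL R).
Local Notation DL := (@airyDL R).
Implicit Types (t u x y a b : R).

Lemma MVT_everywhere (f df : R -> R) a b : a <= b ->
  (forall x : R, is_derive x 1 f (df x)) ->
  exists2 c, a <= c <= b & f b - f a = df c * (b - a).
Proof.
move=> ab d; have [|c cab E] := @MVT_segment R f df a b ab (fun x _ => d x).
  by apply: continuous_subspaceT; exact: dif_continuous d.
by exists c => //; move: cab; rewrite in_itv.
Qed.

Lemma cvg_expRN : expR (- u) @[u --> +oo] --> (0 : R).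
Proof. exact: cvgr_expR. Qed.

Lemma mul_expRN_le u : 0 <= u -> u * expR (- u) <= 2 * expR (- (u / 2)).
Proof.
move=> u0; have -> : - u = - (u / 2) + - (u / 2) by field.
rewrite expRD mulrA ler_pM2r ?expR_gt0// expRN ler_pdivrMr ?expR_gt0//.
by have := expR_ge1Dx (u / 2); lra.
Qed.

Lemma cvg_mul_expRN : u * expR (- u) @[u --> +oo] --> (0 : R).
Proof.
have h : 2 * expR (- (u / 2)) @[u --> +oo] --> (0 : R).
  rewrite -[X in _ --> X](mulr0 2); apply: cvgM; first exact: cvg_cst.
  apply: (cvg_comp (fun u => u / 2) (fun u => expR (- u))); last exact: cvgr_expR.
  by apply: gt0_cvgMly; [rewrite invr_gt0|exact: cvg_id].
apply: (@squeeze_cvgr _ _ _ _ (cst 0) (fun u => 2 * expR (- (u / 2)))) => //.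
  near=> u; have u0 : 0 <= u by near: u; exact: nbhs_pinfty_ge.
  by rewrite mulr_ge0 ?expR_ge0//= mul_expRN_le.
exact: cvg_cst.
Unshelve. all: by end_near. Qed.

Lemma expRN_integral : mu.-integrable Y (EFin \o (fun u => expR (- u))) /\
  forall k, 0 < k -> mu.-integrable Y (EFin \o (fun u => expR (- (k * u)))) /\
  \int[mu]_(u in Y) expR (- (k * u)) = k^-1.
Proof.
have H k : 0 < k -> mu.-integrable Y (EFin \o (fun u => expR (- (k * u)))) /\
    \int[mu]_(u in Y) expR (- (k * u)) = k^-1.
  move=> k0; have k0' : k != 0 by rewrite gt_eqF.
  have d u : is_derive u 1 (fun u => - k^-1 * expR (- (k * u))) (expR (- (k * u))).
    apply: (dif_eq (dif_mul (dif_cst (- k^-1) u)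
       (dif_exp (dif_opp (dif_mul (dif_cst k u) (dif_id u)))))).
    by field.
  have c : continuous (fun u => expR (- (k * u))).
    exact: (@dif_continuous _ _ (fun t => _)).
  have E : (\int[mu]_(u in Y) (expR (- (k * u)))%:E =
      0%:E - (- k^-1 * expR (- (k * 0)))%:E)%E.
    apply: (@ge0_continuous_FTC2y _ _ (fun u => - k^-1 * expR (- (k * u)))).
    - by move=> u _; exact: expR_ge0.
    - exact: continuous_subspaceT.
    - rewrite -[X in _ --> X](mulr0 (- k^-1)); apply: cvgM; first exact: cvg_cst.
      apply: (cvg_comp (fun u => k * u) (fun u => expR (- u))); last exact: cvgr_expR.
      by apply: gt0_cvgMry => //; exact: cvg_id.
    - by move=> u _; have [] := d u.
    - by apply: cvg_at_right_filter; exact: (dif_continuous d).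
    - by move=> u _; rewrite derive1E; have [_ <-] := d u.
  rewrite mulr0 oppr0 expR0 mulr1 -EFinB sub0r opprK in E.
  split; last by rewrite /Rintegral E.
  apply/integrableP; split; first by apply/measurable_EFinP; exact: measurable_cont.
  by under eq_integral do rewrite /= ger0_norm ?expR_ge0//; rewrite E ltry.
split=> //; have [i _] := H 1 ltr01.
rewrite (_ : (fun u => expR (- u)) = (fun u => expR (- (1 * u))))//.
by apply/funext => u; rewrite mul1r.
Qed.

Lemma dif_airyL_shift x u : is_derive u 1 (fun u => L (x + u)) (DL (x + u)).
Proof.
apply: (dif_eq (dif_comp (dif_airyL (x + u)) (dif_add (dif_cst x u) (dif_id u)))).
by rewrite add0r mulr1.
Qed.

Lemma dif_airyDL_shift x u :
  is_derive u 1 (fun u => DL (x + u)) ((x + u) * L (x + u)).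
Proof.
apply: (dif_eq (dif_comp (dif_airyDL (x + u)) (dif_add (dif_cst x u) (dif_id u)))).
by rewrite add0r mulr1.
Qed.

Definition airy_kernel x y : R := \int[mu]_(u in Y) (u * (L (x + u) * L (y + u))).

Lemma airyL_shift_decay x : exists2 M, 0 < M & forall u,
  `|L (x + u)| <= M * expR (- u) /\ `|DL (x + u)| <= M * expR (- u).
Proof.
have [M M0 MP] := airyL_decay R.
exists (M * expR (- x)); first by rewrite mulr_gt0 ?expR_gt0.
by move=> u; rewrite -mulrA -expRD -opprD; exact: MP.
Qed.

Lemma continuous_kernel_fun x y :
  continuous (fun u => u * (L (x + u) * L (y + u))).
Proof.
move=> u; apply: cvgM; first exact: cvg_id.
by apply: cvgM; [exact: (dif_continuous (dif_airyL_shift x))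
                |exact: (dif_continuous (dif_airyL_shift y))].
Qed.

Lemma le_expRN u : 0 <= u -> u * expR (- u) <= 1.
Proof.
move=> u0; rewrite expRN ler_pdivrMr ?expR_gt0// mul1r.
by have := expR_ge1Dx u; lra.
Qed.

Lemma kernel_fun_bound x y : exists M, forall u, 0 <= u ->
  `|u * (L (x + u) * L (y + u))| <= M * expR (- u).
Proof.
have [M M0 MP] := airyL_shift_decay x; have [W W0 WP] := airyL_shift_decay y.
exists (M * W) => u u0; rewrite normrM ger0_norm// normrM.
have [h1 _] := MP u; have [h2 _] := WP u.
apply: (@le_trans _ _ (u * (M * expR (- u) * (W * expR (- u))))).
  by rewrite ler_wpM2l// ler_pM.
rewrite (_ : u * _ = M * W * expR (- u) * (u * expR (- u))); last by ring.
by rewrite ler_piMr ?le_expRN// !mulr_ge0 ?expR_ge0// ltW.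
Qed.

Lemma integrable_cexpRN (M : R) :
  mu.-integrable Y (EFin \o (fun u => M * expR (- u))).
Proof.
rewrite (_ : EFin \o _ = (fun u => M%:E * (expR (- u))%:E)%E); last first.
  by apply/funext => u; rewrite -EFinM.
by apply: integrableZl => //; exact: expRN_integral.1.
Qed.

Lemma integrable_kernel_fun x y :
  mu.-integrable Y (EFin \o (fun u => u * (L (x + u) * L (y + u)))).
Proof.
have [M MP] := kernel_fun_bound x y.
apply: (@integrable_dom _ _ (fun u => M * expR (- u))) => //.
- by apply: measurable_cont; exact: continuous_kernel_fun.
- by move=> u /=; rewrite in_itv/= andbT => /MP.
- exact: integrable_cexpRN.
Qed.

Lemma cvg0_dominated (f g : R -> R) : (forall u, 0 <= u -> `|f u| <= g u) ->
  g u @[u --> +oo] --> (0 : R) -> f u @[u --> +oo] --> (0 : R).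
Proof.
move=> fg g0; apply: norm_cvg0; apply: (@squeeze_cvgr _ _ _ _ (cst 0) g) => //.
  near=> u; have u0 : 0 <= u by near: u; exact: nbhs_pinfty_ge.
  by rewrite normr_ge0 fg.
exact: cvg_cst.
Unshelve. all: by end_near. Qed.

Lemma cvg0_scaled_decay (f : R -> R) M : (forall u, `|f u| <= M * expR (- u)) ->
  f u @[u --> +oo] --> (0 : R) /\ u * f u @[u --> +oo] --> (0 : R).
Proof.
move=> fM; split.
  apply: (@cvg0_dominated f (fun u => M * expR (- u))) => //.
  by rewrite -[X in _ --> X](mulr0 M); apply: cvgM; [exact: cvg_cst|exact: cvg_expRN].
apply: (@cvg0_dominated _ (fun u => M * (u * expR (- u)))).
  by move=> u u0; rewrite normrM ger0_norm// mulrCA ler_wpM2l.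
by rewrite -[X in _ --> X](mulr0 M); apply: cvgM; [exact: cvg_cst|exact: cvg_mul_expRN].
Qed.

(* The antiderivative is - (u K + B) at (x + u, y + u), where
   K = (L L' - L' L) / (x - y) and B is the off-diagonal formula: by L'' = x L
   the derivatives of K and B along (1, 1) are - L L and - K. *)
Lemma airy_kernel_offdiag x y : x != y ->
  airyB_offdiag x y = airy_const R ^+ 2 * airy_kernel x y.
Proof.
move=> xy; have xy0 : x - y != 0 by rewrite subr_eq0.
pose a u := L (x + u); pose a' u := DL (x + u).
pose b u := L (y + u); pose b' u := DL (y + u).
pose c := (x - y)^-1.
pose G u := - (c * (u * a u) * b' u - c * (u * a' u) * b u
  + ((x + y) * c ^+ 2 * a u * b u + 2 * c ^+ 2 * (u * a u) * b u
     - 2 * c ^+ 2 * a' u * b' u)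
  + 2 * c ^+ 3 * (a u * b' u - a' u * b u)).
have c0 : c != 0 by rewrite invr_neq0.
(* Writing x as y + 1 / c lets [field] check the derivative with c as the only denominator. *)
have xyE : x = y + c^-1 by rewrite /c invrK addrC subrK.
have dG u : is_derive u 1 G (u * (a u * b u)).
  have da := dif_airyL_shift x u; have da' := dif_airyDL_shift x u.
  have db := dif_airyL_shift y u; have db' := dif_airyDL_shift y u.
  have dua := dif_mul (dif_id u) da; have dua' := dif_mul (dif_id u) da'.
  have t1 := dif_mul (dif_mul (dif_cst c u) dua) db'.
  have t2 := dif_mul (dif_mul (dif_cst c u) dua') db.
  have t3 := dif_mul (dif_mul (dif_cst ((x + y) * c ^+ 2) u) da) db.
  have t4 := dif_mul (dif_mul (dif_cst (2 * c ^+ 2) u) dua) db.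
  have t5 := dif_mul (dif_mul (dif_cst (2 * c ^+ 2) u) da') db'.
  have t6 := dif_mul (dif_cst (2 * c ^+ 3) u)
    (dif_add (dif_mul da db') (dif_opp (dif_mul da' db))).
  apply: (dif_eq (dif_opp (dif_add (dif_add (dif_add t1 (dif_opp t2))
    (dif_add (dif_add t3 t4) (dif_opp t5))) t6))).
  rewrite /a /b; move: (L (x + u)) (DL (x + u)) (L (y + u)) (DL (y + u)).
  by move=> A A' B B'; rewrite xyE; field.
have [M M0 MP] := airyL_shift_decay x; have [W W0 WP] := airyL_shift_decay y.
have [a0 ua0] := cvg0_scaled_decay (fun u => (MP u).1).
have [a0' ua0'] := cvg0_scaled_decay (fun u => (MP u).2).
have [b0 _] := cvg0_scaled_decay (fun u => (WP u).1).
have [b0' _] := cvg0_scaled_decay (fun u => (WP u).2).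
have m0 (k : R) (f g : R -> R) : f u @[u --> +oo] --> (0 : R) ->
    g u @[u --> +oo] --> (0 : R) -> k * f u * g u @[u --> +oo] --> (0 : R).
  move=> f0 g0; rewrite -[X in _ --> X](mulr0 (k * 0)).
  by apply: cvgM => //; apply: cvgM => //; exact: cvg_cst.
have G0 : G u @[u --> +oo] --> (0 : R).
  have z : 0 = - ((0 - 0) + ((0 + 0) - 0) + 2 * c ^+ 3 * (0 * 0 - 0 * 0)) :> R by ring.
  rewrite [X in _ --> X]z.
  apply: cvgN; apply: cvgD; first apply: cvgD.
  - by apply: cvgB; apply: m0.
  - by apply: cvgB; [apply: cvgD|]; apply: m0.
  - apply: cvgM; first exact: cvg_cst.
    by apply: cvgB; apply: cvgM.
have := Rint_FTCy (@continuous_kernel_fun x y) (integrable_kernel_fun x y) dG G0.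
rewrite -/(airy_kernel x y) => ->.
rewrite /airyB_offdiag !derive1_Ai !AiE /G /a /b /a' /b' !addr0.
move: (airy_const R) (L x) (DL x) (L y) (DL y) => k A A' B B'.
by rewrite /c; field.
Qed.

End airy_kernel.

Section airy_diagonal.
Context (R : realType).
Local Notation mu := (@lebesgue_measure R).
Local Notation Y := (`[0, +oo[%classic : set R).
Local Notation L := (@airyL R).
Local Notation DL := (@airyDL R).
Implicit Types (t u x y a b : R).

(** Mean value theorem with the decay of [airyDL]. The factor exp (- u) keeps the estimate
    integrable after the shift by u, and the exponent 1 - x in W covers all points within distance 1
    of x. *)
Lemma airyL_lipschitz x : exists2 W, 0 < W & forall y u, `|y - x| <= 1 ->
  `|L (y + u)| <= W * expR (- u) /\
  `|L (y + u) - L (x + u)| <= W * expR (- u) * `|y - x|.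
Proof.
have [M M0 MP] := airyL_decay R; pose W := M * expR (1 - x).
have MW z u : x - 1 + u <= z -> M * expR (- z) <= W * expR (- u).
  move=> xz; rewrite /W -mulrA -expRD ler_pM2l// ler_expR; lra.
exists W; first by rewrite mulr_gt0 ?expR_gt0.
move=> y u yx; have := yx; rewrite ler_norml => /andP[yx1 yx2]; split.
  by rewrite (le_trans (MP _).1)// MW//; lra.
have [xy|/ltW yx'] := leP x y.
  have xyu : x + u <= y + u by rewrite lerD2r.
  have [c /andP[c1 c2] ->] := MVT_everywhere xyu (@dif_airyL R).
  have E : y + u - (x + u) = y - x by ring.
  rewrite normrM E ler_wpM2r//.
  by rewrite (le_trans (MP _).2)// MW//; lra.
have xyu : y + u <= x + u by rewrite lerD2r.
have [c /andP[c1 c2] E] := MVT_everywhere xyu (@dif_airyL R).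
have E' : x + u - (y + u) = x - y by ring.
rewrite distrC E normrM E' (distrC x) ler_wpM2r//.
by rewrite (le_trans (MP _).2)// MW//; lra.
Qed.

Lemma airy_kernel_near x : exists W, forall y z,
  `|y - x| <= 1 -> `|z - x| <= 1 ->
  `|airy_kernel y z - airy_kernel x x| <= W * (`|y - x| + `|z - x|).
Proof.
have [W W0 WP] := airyL_lipschitz x.
exists (W ^+ 2) => y z yx zx.
set d := `|y - x| + `|z - x|.
rewrite /airy_kernel -RintegralB//; [|exact: integrable_kernel_fun..].
apply: (@le_trans _ _ (\int[mu]_(u in Y) (W ^+ 2 * d * expR (- u)))).
  apply: Rint_abs_le => //.
  - rewrite (_ : EFin \o _ = (fun u => (u * (L (y + u) * L (z + u)))%:E
      - (u * (L (x + u) * L (x + u)))%:E)%E); last first.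
      by apply/funext => u; rewrite -EFinB.
    by apply: integrableB => //; exact: integrable_kernel_fun.
  - exact: integrable_cexpRN.
  - move=> u /=; rewrite in_itv/= andbT => u0.
    have x0 : `|x - x| <= 1 by rewrite subrr normr0.
    have [y1 y2] := WP y u yx; have [z1 z2] := WP z u zx; have [x1 _] := WP x u x0.
    rewrite -mulrBr normrM ger0_norm//.
    have -> : L (y + u) * L (z + u) - L (x + u) * L (x + u) =
      (L (y + u) - L (x + u)) * L (z + u) + L (x + u) * (L (z + u) - L (x + u)).
      by ring.
    set e := expR (- u) in y1 y2 z1 z2 x1 *.
    have e0 : 0 <= e by exact: expR_ge0.
    apply: (@le_trans _ _ (u * (W * e * `|y - x| * (W * e) +
                                W * e * (W * e * `|z - x|)))).
      rewrite ler_wpM2l//; apply: (le_trans (ler_normD _ _)).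
      rewrite (normrM (L (y + u) - _)) (normrM (L (x + u))).
      by apply: lerD; apply: ler_pM.
    have -> : u * (W * e * `|y - x| * (W * e) + W * e * (W * e * `|z - x|))
      = W ^+ 2 * d * e * (u * e) by rewrite /d; ring.
    by rewrite ler_piMr ?le_expRN// mulr_ge0// mulr_ge0 ?sqr_ge0// /d addr_ge0.
rewrite RintegralZl//; last exact: (expRN_integral R).1.
have [_ E] := expRN_integral R; have [_ E1] := E 1 ltr01.
rewrite (_ : (fun u => expR (- u)) = (fun u => expR (- (1 * u)))); last first.
  by apply/funext => u; rewrite mul1r.
by rewrite E1 invr1 mulr1.
Qed.

(** On the diagonal, [airyB] is a limit of off-diagonal values, which [airy_kernel_offdiag]
    identifies with the kernel; the kernel is continuous at (x, x) by [airy_kernel_near]. *)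
Lemma airyBE x y : airyB x y = airy_const R ^+ 2 * airy_kernel x y.
Proof.
rewrite /airyB; have [<-|xy] := eqVneq x y; last exact: airy_kernel_offdiag.
have [W WP] := airy_kernel_near x.
(* Uniqueness of the limit requires off-diagonal points arbitrarily close to (x, x). *)
have PF : ProperFilter (within [set q : R * R | q.1 != q.2] (nbhs (x, x))).
  apply: within_nbhs_proper => B [[B1 B2] /= [B1x B2x] BB].
  move: B1x => /nbhs_ballP[e /= e0 eB1].
  exists (x + e / 2, x); split => /=.
    by rewrite -subr_eq0 addrAC subrr add0r mulf_neq0 ?gt_eqF ?invr_gt0.
  apply: BB; split => /=; last exact: nbhs_singleton.
  apply: eB1; rewrite /ball /= opprD addNKr normrN ger0_norm; last first.
    by rewrite divr_ge0// ltW.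
  by rewrite ltr_pdivrMr// ltr_pMr// ltr1n.
apply/cvg_lim => //; apply/cvgrPdist_le => /= e e0.
pose K := airy_const R ^+ 2; have K0 : 0 < K by rewrite exprn_gt0 ?airy_const_gt0.
pose W' := `|W| + 1; have W'0 : 0 < W' by rewrite ltr_wpDl.
pose r := Num.min 1 (e / (2 * K * W')).
have KW : 0 < 2 * K * W' by apply: mulr_gt0 => //; exact: mulr_gt0.
have r0 : 0 < r by rewrite lt_min ltr01 divr_gt0.
near=> q.
have q12 : q.1 != q.2 by near: q; exact: withinT.
have qb : ball (x, x) r q.
  near: q; apply: (@cvg_within _ (nbhs (x, x))); exact: nbhsx_ballx.
case: qb; rewrite /ball /= => q1 q2.
rewrite airy_kernel_offdiag// -/K -mulrBr normrM (gtr0_norm K0) distrC.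
have h1 : `|q.1 - x| <= r by rewrite distrC ltW.
have h2 : `|q.2 - x| <= r by rewrite distrC ltW.
have r1 : r <= 1 by rewrite ge_min lexx.
have rE : r <= e / (2 * K * W') by rewrite ge_min lexx orbT.
have := WP q.1 q.2 (le_trans h1 r1) (le_trans h2 r1).
move=> /(ler_wpM2l (ltW K0))/le_trans; apply.
apply: (@le_trans _ _ (K * (W' * (r + r)))).
  rewrite ler_pM2l// (@le_trans _ _ (W' * (`|q.1 - x| + `|q.2 - x|)))//.
    rewrite ler_wpM2r ?addr_ge0// /W' (le_trans (ler_norm _))// lerDl//.
  by rewrite ler_pM2l// lerD.
rewrite (_ : K * _ = r * (2 * K * W')); last by ring.
by rewrite -ler_pdivlMr.
Unshelve. all: by end_near. Qed.

Lemma cos_ge_onem y : 0 <= y -> 1 - y <= cos y.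
Proof.
move=> y0; have [c _ E] := @MVT_everywhere R (@cos R) (fun t => - sin t) 0 y y0
  (fun t => is_derive_cos t).
have -> : cos y = 1 - sin c * y.
  by rewrite -[LHS](subrK (cos 0)) E cos0 subr0; ring.
by rewrite lerD2l lerN2 ler_piMl// sin_le1.
Qed.

(** The line of height a passes through the saddle point i a of the phase at [a ^+ 2], so the linear
    term of the argument cancels and, up to a positive factor, the integrand is exp (- a t^2) cos
    (t^3 / 3). The mass near 0, where the cosine is positive, outweighs the rest. *)
Lemma airyL_sqr_gt0 a : 2 <= a -> 0 < L (a ^+ 2).
Proof.
move=> a2; have a0 : 0 < a by rewrite (lt_le_trans _ a2).
have h : 0 < Ai (a ^+ 2); last first.
  by move: h; rewrite AiE pmulr_rgt0// airy_const_gt0.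
rewrite (Ai_contour _ a0) mulr_gt0 ?invr_gt0 ?pi_gt0//.
pose f t := expR (- (a * t ^+ 2)) * cos (t ^+ 3 / 3).
have cf : continuous f by rewrite /f; exact: (@dif_continuous _ _ (fun t => _)).
have i_f : mu.-integrable Y (EFin \o f).
  apply: (@integrable_dom _ _ (fun t => expR (- (a * t ^+ 2)))) => //.
  - exact: measurable_cont.
  - move=> t _; rewrite /f normrM ger0_norm ?expR_ge0// ler_piMr ?expR_ge0//.
    exact: norm_cos_le1.
  - exact: gauss_integrable.
have -> : \int[mu]_(t in Y) airy_re a (a ^+ 2) t =
    expR (a ^+ 3 / 3 - a ^+ 2 * a) * \int[mu]_(t in Y) f t.
  rewrite -RintegralZl//; apply: eq_Rintegral => t _.
  rewrite /airy_re /airy_mod /airy_arg /f expRD -mulrA; congr (_ * (_ * cos _)).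
  ring.
rewrite mulr_gt0 ?expR_gt0//.
pose g t := expR (- (a * t)).
have [_ /(_ a a0)[ig Eg]] := expRN_integral R.
have cg : continuous g by rewrite /g; exact: (@dif_continuous _ _ (fun t => _)).
have ig1 : mu.-integrable Y (EFin \o (g \_ `[0, 1])).
  apply: (@integrable_dom _ _ g) => //.
    by apply: measurable_funTS; apply/(measurable_restrictT _ _).1 => //; exact: measurable_cont.
  move=> t _; rewrite /patch; case: ifP => _; rewrite ?normr0 ?expR_ge0//.
  by rewrite ger0_norm ?expR_ge0.
have I1 : \int[mu]_(t in Y) (g \_ `[0, 1]) t = (1 - expR (- a)) / a.
  transitivity (\int[mu]_(t in `[0, 1]) g t).
    rewrite Rintegral_mkcond [in RHS]Rintegral_mkcond; congr Rintegral.
    rewrite -patch_setI setIC; congr (_ \_ _).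
    by apply/setIidl => x /=; rewrite !in_itv/= => /andP[->].
  have d t : is_derive t 1 (fun t => - a^-1 * expR (- (a * t))) (g t).
    apply: (dif_eq (dif_mul (dif_cst (- a^-1) t)
       (dif_exp (dif_opp (dif_mul (dif_cst a t) (dif_id t)))))).
    by rewrite /g; field; rewrite gt_eqF.
  rewrite (Rint_FTC ler01 cg d) mulr1 mulr0 oppr0 expR0; field.
  by rewrite gt_eqF.
have ih : mu.-integrable Y (EFin \o (fun t => 3 / 2 * (g \_ `[0, 1]) t)).
  rewrite (_ : EFin \o _ = (fun t => (3 / 2)%:E * ((g \_ `[0, 1]) t)%:E)%E).
    exact: integrableZl.
  by apply/funext => t; rewrite -EFinM.
(* With g = exp (- a t), the integrand is at least g / 2 on [0, 1], where t^2 <= t and the cosine is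
   at least 1 / 2, and at least - g beyond. This minorant has positive integral when 3 exp (- a) <
   1, which follows from exp a > 1 + a and a >= 2. *)
apply: (@lt_le_trans _ _ (\int[mu]_(t in Y) (3 / 2 * (g \_ `[0, 1]) t - g t))).
  rewrite RintegralB// RintegralZl// I1 Eg mulrA -{2}[a^-1]mul1r -mulrBl.
  rewrite divr_gt0// -(pmulr_rgt0 _ (_ : 0 < 2))//.
  have : 3 * expR (- a) < 1.
    rewrite expRN ltr_pdivrMr ?expR_gt0// mul1r.
    by have := expR_gt1Dx (lt0r_neq0 a0); lra.
  lra.
apply: le_Rintegral => //.
  rewrite (_ : EFin \o _ = (fun t => (3 / 2 * (g \_ `[0, 1]) t)%:E - (g t)%:E)%E).
    exact: integrableB.
  by apply/funext => t; rewrite -EFinB.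
move=> t /=; rewrite in_itv/= andbT => t0.
rewrite /patch; case: ifPn => [/set_mem|tn].
  rewrite /= in_itv/= => /andP[_ t1].
  have gf : g t <= expR (- (a * t ^+ 2)).
    by rewrite /g ler_expR lerN2 ler_pM2l// expr2 ler_piMr.
  have ct : 1 / 2 <= cos (t ^+ 3 / 3).
    apply: (@le_trans _ _ (1 - t ^+ 3 / 3)); last by apply: cos_ge_onem; rewrite divr_ge0 ?exprn_ge0.
    have : t ^+ 3 <= 1 by rewrite exprn_ile1.
    lra.
  have g0 : 0 <= g t by exact: expR_ge0.
  rewrite /f; have : g t * (1 / 2) <= expR (- (a * t ^+ 2)) * cos (t ^+ 3 / 3).
    by rewrite ler_pM// divr_ge0.
  lra.
have t1 : 1 < t.
  rewrite ltNge; apply: contra tn => t1; apply/mem_set.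
  by rewrite /= in_itv/= t0 t1.
rewrite mulr0 sub0r lerNl.
apply: (@le_trans _ _ (expR (- (a * t ^+ 2)) * `|cos (t ^+ 3 / 3)|)).
  by rewrite /f -mulrN ler_wpM2l ?expR_ge0// -normrN ler_norm.
apply: (@le_trans _ _ (expR (- (a * t ^+ 2)))).
  by rewrite ler_piMr ?expR_ge0// norm_cos_le1.
by rewrite /g ler_expR lerN2 ler_pM2l// expr2 ler_peMr// ltW.
Qed.

(** The integrand is u times a square, and it is positive at the point v where x + v is the square
    of a number at least 2. This keeps the denominator of the limiting correlation away from 0. *)
Lemma airy_kernel_diag_gt0 x : 0 < airy_kernel x x.
Proof.
pose a := Num.max 2 (`|x| + 2).
have a2 : 2 <= a by rewrite le_max lexx.
have ax : `|x| + 2 <= a by rewrite le_max lexx orbT.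
pose v := a ^+ 2 - x.
have v0 : 1 < v.
  by rewrite /v; have := ler_norm x; nra.
have E : x + v = a ^+ 2 by rewrite /v; ring.
have La := airyL_sqr_gt0 a2.
apply: (@Rint_Y_gt0 _ (fun u => u * (L (x + u) * L (x + u))) v).
- exact: continuous_kernel_fun.
- exact: integrable_kernel_fun.
- by move=> u u0; rewrite mulr_ge0// -expr2 sqr_ge0.
- by rewrite (le_trans ler01)// ltW.
- by rewrite E; apply: mulr_gt0; [exact: lt_trans v0|exact: mulr_gt0].
Qed.

End airy_diagonal.

(** * An integral representation of the Hermite polynomials *)

Section real_integrable.
Context (R : realType) (D : set R) (mD : measurable D).
Local Notation mu := (@lebesgue_measure R).
Implicit Types (f g : R -> R).

Lemma integrable_scale (r : R) f : mu.-integrable D (EFin \o f) ->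
  mu.-integrable D (EFin \o (fun t => r * f t)).
Proof.
move=> ig; rewrite (_ : EFin \o _ = (fun t => r%:E * (f t)%:E)%E).
  exact: integrableZl.
by apply/funext => t; rewrite -EFinM.
Qed.

Lemma integrable_add f g : mu.-integrable D (EFin \o f) ->
  mu.-integrable D (EFin \o g) -> mu.-integrable D (EFin \o (fun t => f t + g t)).
Proof.
move=> i1 i2; rewrite (_ : EFin \o _ = (fun t => (f t)%:E + (g t)%:E)%E).
  exact: integrableD.
by apply/funext => t; rewrite -EFinD.
Qed.

Lemma integrable_sub f g : mu.-integrable D (EFin \o f) ->
  mu.-integrable D (EFin \o g) -> mu.-integrable D (EFin \o (fun t => f t - g t)).
Proof.
move=> i1 i2; rewrite (_ : EFin \o _ = (fun t => (f t)%:E - (g t)%:E)%E).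
  exact: integrableB.
by apply/funext => t; rewrite -EFinB.
Qed.

End real_integrable.

Section hermite_integral.
Context (R : realType).
Local Notation mu := (@lebesgue_measure R).
Local Notation Y := (`[0, +oo[%classic : set R).
Context (c s : R) (c0 : 0 < c) (s0 : 0 < s).
Implicit Types (t b x : R) (n : nat).

(** Logarithm of the modulus, and argument, of 1 + i s t / c; taking the n-th power multiplies both
    by n. *)
Definition pol_log t := ln (1 + (s * t / c) ^+ 2) / 2.
Definition pol_arg t := atan (s * t / c).

(* (c + i s t)^n exp ((i s t - b)^2 / 2), up to the factor c^n exp (b^2 / 2). *)
Definition herm_exp n t := n%:R * pol_log t - (s * t) ^+ 2 / 2.
Definition herm_phase n b t := n%:R * pol_arg t - b * (s * t).
Definition herm_re n b t := expR (herm_exp n t) * cos (herm_phase n b t).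
Definition herm_im n b t := expR (herm_exp n t) * sin (herm_phase n b t).

Let y_ t := s * t / c.

Let y2_gt0 t : 0 < 1 + y_ t ^+ 2.
Proof. by rewrite ltr_wpDr ?sqr_ge0. Qed.

Lemma expR_pol_log t : expR (pol_log t) = Num.sqrt (1 + y_ t ^+ 2).
Proof.
apply/eqP; rewrite -(@eqrXn2 _ 2) ?expR_ge0 ?sqrtr_ge0// sqr_sqrtr ?ltW//.
rewrite -expRM_natl /pol_log mulrC divfK// lnK// posrE.
exact: y2_gt0.
Qed.

Lemma cos_pol t : expR (pol_log t) * cos (pol_arg t) = 1.
Proof.
by rewrite expR_pol_log /pol_arg cos_atan mulfV// gt_eqF// sqrtr_gt0.
Qed.

Lemma sin_pol t : expR (pol_log t) * sin (pol_arg t) = y_ t.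
Proof.
have cn0 : cos (pol_arg t) != 0.
  by apply/eqP => z; have := cos_pol t; rewrite z mulr0 => /eqP; rewrite eq_sym oner_eq0.
rewrite -[sin _](divfK cn0) -/(tan _) {1}/pol_arg atanK mulrCA.
by rewrite cos_pol mulr1.
Qed.

Lemma herm_reS n b t :
  herm_re n.+1 b t = herm_re n b t - y_ t * herm_im n b t.
Proof.
rewrite /herm_re /herm_im (_ : herm_exp n.+1 t = herm_exp n t + pol_log t); last first.
  by rewrite /herm_exp -natr1; ring.
rewrite (_ : herm_phase n.+1 b t = herm_phase n b t + pol_arg t); last first.
  by rewrite /herm_phase -natr1; ring.
rewrite expRD cosD -(sin_pol t); move: (cos_pol t).
move: (expR (pol_log t)) (cos (pol_arg t)) => p ca E.
by rewrite -[X in _ = X - _]mulr1 -E; ring.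
Qed.

Lemma herm_imS n b t :
  herm_im n.+1 b t = herm_im n b t + y_ t * herm_re n b t.
Proof.
rewrite /herm_re /herm_im (_ : herm_exp n.+1 t = herm_exp n t + pol_log t); last first.
  by rewrite /herm_exp -natr1; ring.
rewrite (_ : herm_phase n.+1 b t = herm_phase n b t + pol_arg t); last first.
  by rewrite /herm_phase -natr1; ring.
rewrite expRD sinD -(sin_pol t); move: (cos_pol t).
move: (expR (pol_log t)) (cos (pol_arg t)) => p ca E.
by rewrite -[X in _ = X + _]mulr1 -E; ring.
Qed.

Let cn0 : c != 0. Proof. by rewrite gt_eqF. Qed.

Lemma dif_y t : is_derive t 1 y_ (s / c).
Proof.
apply: (dif_eq (dif_mul (dif_mul (dif_cst s t) (dif_id t)) (dif_cst c^-1 t))).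
by ring.
Qed.

Lemma dif_pol_log t : is_derive t 1 pol_log (s / c * y_ t / (1 + y_ t ^+ 2)).
Proof.
have d1 := dif_add (dif_cst 1 t) (dif_pow 2 (dif_y t)).
have d2 := @is_derive1_ln R _ (y2_gt0 t).
have d3 := @dif_comp R (@ln R) (fun t => 1 + y_ t ^+ 2) t _ _ d2 d1.
have d4 := dif_mul d3 (dif_cst 2^-1 t).
apply: (dif_eq d4).
have := y2_gt0 t; move: (y_ t) => y y0 /=.
by field; rewrite cn0 gt_eqF.
Qed.

Lemma dif_pol_arg t : is_derive t 1 pol_arg (s / c / (1 + y_ t ^+ 2)).
Proof.
have d2 := @is_derive1_atan R (y_ t).
apply: (dif_eq (dif_comp d2 (dif_y t))).
by rewrite mulrC.
Qed.

Lemma dif_herm_exp n t : is_derive t 1 (herm_exp n)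
  (n%:R * (s / c * y_ t / (1 + y_ t ^+ 2)) - s ^+ 2 * t).
Proof.
have d := dif_mul (dif_pow 2 (dif_mul (dif_cst s t) (dif_id t))) (dif_cst 2^-1 t).
apply: (dif_eq (dif_add (dif_mul (dif_cst n%:R t) (dif_pol_log t)) (dif_opp d))).
by rewrite /=; field; rewrite cn0 gt_eqF.
Qed.

Lemma dif_herm_phase n b t : is_derive t 1 (herm_phase n b)
  (n%:R * (s / c / (1 + y_ t ^+ 2)) - b * s).
Proof.
have d := dif_mul (dif_cst b t) (dif_mul (dif_cst s t) (dif_id t)).
apply: (dif_eq (dif_add (dif_mul (dif_cst n%:R t) (dif_pol_arg t)) (dif_opp d))).
by ring.
Qed.

Lemma continuous_herm_re n b : continuous (herm_re n b).
Proof.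
apply: (@dif_continuous _ _ (fun t => _)) => t.
exact: (dif_mul (dif_exp (dif_herm_exp n t)) (dif_cos (dif_herm_phase n b t))).
Qed.

Lemma pol_log_le t : pol_log t <= y_ t ^+ 2 / 2.
Proof.
rewrite /pol_log ler_pM2r ?invr_gt0// -ler_expR lnK.
  exact: expR_ge1Dx.
by rewrite posrE; exact: y2_gt0.
Qed.

(* With w = c + i s t and e = (w - x)^2 / 2, this is
   d (w^n e^..) = (n w^(n-1) + (w - x) w^n) e^.. dw. *)
Lemma dif_herm_im n b t : is_derive t 1 (herm_im n b)
  (s * (n%:R / c * shift (fun k => herm_re k b t) n + c * herm_re n.+1 b t
   - (b + c) * herm_re n b t)).
Proof.
apply: (dif_eq (dif_mul (dif_exp (dif_herm_exp n t)) (dif_sin (dif_herm_phase n b t)))).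
have yE : s * t = c * y_ t by rewrite /y_; field.
have y0 : 1 + y_ t ^+ 2 != 0 by rewrite gt_eqF.
rewrite (_ : s ^+ 2 * t = s * c * y_ t); last by rewrite expr2 -!mulrA yE.
rewrite herm_reS; case: n => [|n] /=.
  by rewrite !mul0r /herm_re /herm_im; ring.
rewrite herm_reS /herm_re -/(herm_im n.+1 b t) -/(herm_re n.+1 b t).
rewrite (_ : expR _ * _ * sin _ + _ =
   (n.+1%:R * (s / c * y_ t / (1 + y_ t ^+ 2)) - s * c * y_ t) * herm_im n.+1 b t
   + (n.+1%:R * (s / c / (1 + y_ t ^+ 2)) - b * s) * herm_re n.+1 b t); last first.
  rewrite /herm_re /herm_im; ring.
rewrite !herm_reS !herm_imS -/(herm_re n b t).
move: (herm_re n b t) (herm_im n b t) (y_ t) y0 => A B y y0.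
by field; rewrite cn0.
Qed.

(** By [pol_log_le] the n-th power grows at most like exp (n (s t / c)^2 / 2), which the Gaussian
    factor beats when n < c^2. Hence an abscissa beyond n^(1/2). *)
Lemma herm_bound n b t : n%:R <= c ^+ 2 ->
  `|herm_re n b t| <= expR (- ((1 - n%:R / c ^+ 2) / 2 * s ^+ 2 * t ^+ 2)) /\
  `|herm_im n b t| <= expR (- ((1 - n%:R / c ^+ 2) / 2 * s ^+ 2 * t ^+ 2)).
Proof.
move=> nc.
have E : expR (herm_exp n t) <= expR (- ((1 - n%:R / c ^+ 2) / 2 * s ^+ 2 * t ^+ 2)).
  rewrite ler_expR /herm_exp.
  have h : n%:R * pol_log t <= n%:R * (y_ t ^+ 2 / 2) by rewrite ler_wpM2l// pol_log_le.
  apply: (le_trans (lerB h (lexx _))).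
  by rewrite le_eqVlt; apply/orP; left; apply/eqP; rewrite /y_; field.
split; rewrite normrM ger0_norm ?expR_ge0// (le_trans _ E)// ler_piMr ?expR_ge0//.
  exact: norm_cos_le1.
exact: norm_sin_le1.
Qed.

Section subcritical.
Context n (nc : n%:R < c ^+ 2).

Let k := (1 - n%:R / c ^+ 2) / 2 * s ^+ 2.

Let k0 : 0 < k.
Proof.
rewrite /k mulr_gt0 ?exprn_gt0// divr_gt0// subr_gt0 ltr_pdivrMr ?exprn_gt0//.
by rewrite mul1r.
Qed.

Lemma herm_re_integrable b : mu.-integrable Y (EFin \o herm_re n b).
Proof.
apply: (@integrable_dom _ _ (fun t => expR (- (k * t ^+ 2)))) => //.
- by apply: measurable_cont; exact: continuous_herm_re.
- by move=> t _; have [] := herm_bound b t (ltW nc).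
- exact: gauss_integrable.
Qed.

Lemma cvg_gaussian : expR (- (k * t ^+ 2)) @[t --> +oo] --> (0 : R).
Proof.
apply: (cvg_comp (fun t => k * t ^+ 2) (fun t => expR (- t))); last exact: cvgr_expR.
by apply: gt0_cvgMry => //; exact: cvgr_expr2.
Qed.

Lemma cvg_herm_im b : herm_im n b t @[t --> +oo] --> (0 : R).
Proof.
apply: (@cvg0_dominated _ _ (fun t => expR (- (k * t ^+ 2)))).
  by move=> t _; have [] := herm_bound b t (ltW nc).
exact: cvg_gaussian.
Qed.

End subcritical.

Definition herm_int n b : R := \int[mu]_(t in Y) herm_re n b t.

Lemma herm_im0 n b : herm_im n b 0 = 0.
Proof.
by rewrite /herm_im /herm_phase /pol_arg !mulr0 mul0r atan0 mulr0 subr0 sin0 mulr0.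
Qed.

(** [dif_herm_im] integrated over the half line. The imaginary part vanishes at t = 0, where the
    point c is real, and at infinity, so no boundary term is left. *)
Lemma herm_int_rec n b : n.+1%:R < c ^+ 2 ->
  c * herm_int n.+1 b =
  (b + c) * herm_int n b - n%:R / c * shift (fun k => herm_int k b) n.
Proof.
move=> nc1.
have ncn : n%:R < c ^+ 2 by rewrite (le_lt_trans _ nc1)// ler_nat.
pose f t := s * (n%:R / c * shift (fun k => herm_re k b t) n + c * herm_re n.+1 b t
   - (b + c) * herm_re n b t).
have i1 := herm_re_integrable nc1 b; have i0 := herm_re_integrable ncn b.
have im : mu.-integrable Y (EFin \o (fun t => shift (fun k => herm_re k b t) n)).
  case: n ncn {nc1 i0 i1 f} => [|n] ncn /=; last first.
    by apply: herm_re_integrable; rewrite (le_lt_trans _ ncn)// ler_nat.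
  exact: integrable0.
have mY : measurable Y by [].
have iZ := @integrable_scale R Y mY.
have iD := @integrable_add R Y mY.
have iB := @integrable_sub R Y mY.
have a1 := iZ (n%:R / c) _ im; have a2 := iZ c _ i1; have a3 := iZ (b + c) _ i0.
have a12 := iD _ _ a1 a2; have a123 := iB _ _ a12 a3.
have i_f : mu.-integrable Y (EFin \o f) by exact: iZ.
have cf : continuous f.
  move=> t; apply: cvgM; first exact: cvg_cst.
  apply: cvgB; first apply: cvgD; (apply: cvgM; first exact: cvg_cst).
  - case: (n) => [|m] /=; first exact: cvg_cst.
    exact: continuous_herm_re.
  - exact: continuous_herm_re.
  - exact: continuous_herm_re.
have := Rint_FTCy cf i_f (dif_herm_im n b) (cvg_herm_im ncn b).
rewrite herm_im0 subr0 /f RintegralZl// => /eqP.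
rewrite mulf_eq0 gt_eqF//= RintegralB// RintegralD// !RintegralZl//.
rewrite -/(herm_int n b) -/(herm_int n.+1 b).
have -> : \int[mu]_(t in Y) shift (fun k => herm_re k b t) n =
    shift (fun k => herm_int k b) n.
  by case: (n) => [|m] //=; rewrite Rintegral_cst ?mul0r.
by rewrite subr_eq0 addrC => /eqP <-; rewrite addrK.
Qed.

Definition gauss_mass : R := \int[mu]_(t in Y) expR (- (s ^+ 2 / 2 * t ^+ 2)).

Lemma gauss_mass_gt0 : 0 < gauss_mass.
Proof.
apply: (@Rint_Y_gt0 _ _ 0) => //.
- exact: (@dif_continuous _ _ (fun t => _)).
- by apply: gauss_integrable; rewrite divr_gt0 ?exprn_gt0.
- exact: expR_gt0.
Qed.

Lemma herm_re0 b t : herm_re 0 b t = expR (- (s ^+ 2 / 2 * t ^+ 2)) * cos (b * (s * t)).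
Proof.
rewrite /herm_re /herm_exp /herm_phase !mul0r !sub0r cosN; congr (expR (- _) * _).
by field.
Qed.

(* The derivative in b of exp (b^2 / 2) * herm_re 0 b t is, up to 1 / s, the
   derivative in t of exp (b^2 / 2) * herm_im 0 b t. *)
Lemma herm_int0 b : expR (b ^+ 2 / 2) * herm_int 0 b = gauss_mass.
Proof.
have c20 : 0%:R < c ^+ 2 by rewrite exprn_gt0.
pose rho t := expR (- (s ^+ 2 / 2 * t ^+ 2)).
have crho : continuous rho by exact: (@dif_continuous _ _ (fun t => _)).
have k0 : 0 < s ^+ 2 / 2 by rewrite divr_gt0 ?exprn_gt0.
have irho : mu.-integrable Y (EFin \o rho) by exact: gauss_integrable.
have itrho : mu.-integrable Y (EFin \o (fun t => t * rho t)).
  apply: (@integrable_dom _ _ (fun t => (1 + (s ^+ 2 / 4)^-1) *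
    expR (- (s ^+ 2 / 4 * t ^+ 2)))) => //.
  - by apply: measurable_cont => t; apply: cvgM; [exact: cvg_id|exact: crho].
  - move=> t /=; rewrite in_itv/= andbT => t0.
    rewrite normrM ger0_norm// ger0_norm ?expR_ge0// /rho.
    have -> : - (s ^+ 2 / 2 * t ^+ 2) =
      - (s ^+ 2 / 4 * t ^+ 2) + - (s ^+ 2 / 4 * t ^+ 2) by field.
    rewrite expRD mulrA ler_pM2r ?expR_gt0// expRN ler_pdivrMr ?expR_gt0//.
    set r := s ^+ 2 / 4; have r0 : 0 < r by rewrite divr_gt0 ?exprn_gt0.
    apply: (@le_trans _ _ ((1 + r^-1) * (1 + r * t ^+ 2))); last first.
      by rewrite ler_pM2l ?addr_gt0 ?invr_gt0// expR_ge1Dx.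
    have -> : (1 + r^-1) * (1 + r * t ^+ 2) = 1 + t ^+ 2 + (r^-1 + r * t ^+ 2).
      by field; rewrite gt_eqF.
    have h : 0 <= r^-1 + r * t ^+ 2.
      apply: addr_ge0; first by rewrite invr_ge0 ltW.
      by apply: mulr_ge0; [exact: ltW|exact: sqr_ge0].
    have : 0 <= (t - 1) ^+ 2 by exact: sqr_ge0.
    have -> : (t - 1) ^+ 2 = t ^+ 2 - 2 * t + 1 by ring.
    by have := sqr_ge0 t; lra.
  - by apply: integrable_scale => //; apply: gauss_integrable; rewrite divr_gt0 ?exprn_gt0.
have hE b' : herm_int 0 b' = \int[mu]_(t in Y) (rho t * cos (0 + (b' * s) * t)).
  apply: eq_Rintegral => t _; rewrite herm_re0 add0r mulrA //.
have dJ b' : is_derive b' 1 (fun b => expR (b ^+ 2 / 2) * herm_int 0 b) 0.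
  rewrite (_ : (fun b => _) = (fun b => expR (b ^+ 2 / 2) *
    \int[mu]_(t in Y) (rho t * cos (0 + (b * s) * t)))); last first.
    by apply/funext => z; rewrite hE.
  pose I2 := \int[mu]_(t in Y) (t * rho t * sin (0 + b' * s * t)).
  have [d1 _] : is_derive (b' * s) 1
      (fun z => \int[mu]_(t in Y) (rho t * cos (0 + z * t))) (- I2) /\ _ :=
    dif_int_cos (b' * s) crho (@cst_continuous _ _ 0) irho itrho.
  have d2 := dif_mul (dif_id b') (dif_cst s b').
  have d3 := @dif_comp R (fun z => \int[mu]_(t in Y) (rho t * cos (0 + z * t)))
    (fun b => b * s) b' _ _ d1 d2.
  apply: (dif_eq (dif_mul (dif_exp (dif_mul (dif_pow 2 (dif_id b')) (dif_cst 2^-1 b'))) d3)).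
  rewrite -hE.
  set I1 := herm_int 0 b'.
  suff E : s * I2 = b' * I1.
    rewrite !mulr0 !addr0 mul1r mulr1 (_ : - I2 * s = - (s * I2)); last by ring.
    by rewrite E /=; field.
  have iI2 : mu.-integrable Y (EFin \o (fun t => t * rho t * sin (0 + b' * s * t))).
    apply: (@integrable_dom _ _ (fun t => `|t * rho t|)) => //.
    - apply: measurable_cont => t; apply: cvgM.
        by apply: cvgM; [exact: cvg_id|exact: crho].
      by apply: (@dif_continuous _ (fun t => sin (0 + b' * s * t)) (fun t => _)).
    - by move=> t _; rewrite normrM ler_piMr// norm_sin_le1.
    - exact: integrable_norm.
  have iI1 := @herm_re_integrable 0 c20 b'.
  pose f t := s * b' * herm_re 0 b' t - s ^+ 2 * (t * rho t * sin (0 + b' * s * t)).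
  have df (t : R) : is_derive t 1 (fun t => rho t * sin (b' * s * t)) (f t).
    rewrite /f /rho herm_re0 add0r [b' * (s * t)]mulrA; move: (b' * s) (mulrC s b') => q ->.
    have d4 := dif_exp (dif_opp (dif_mul (dif_cst (s ^+ 2 / 2) t) (dif_pow 2 (dif_id t)))).
    have d5 := dif_sin (dif_mul (dif_cst q t) (dif_id t)).
    apply: (dif_eq (dif_mul d4 d5)).
    by rewrite /=; field.
  have cf : continuous f.
    move=> t; apply: cvgB; apply: cvgM; try exact: cvg_cst.
      exact: continuous_herm_re.
    apply: cvgM; first by apply: cvgM; [exact: cvg_id|exact: crho].
    by apply: (@dif_continuous _ (fun t => sin (0 + b' * s * t)) (fun t => _)).
  have i_f : mu.-integrable Y (EFin \o f).
    by apply: integrable_sub => //; apply: integrable_scale.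
  have F0 : rho t * sin (b' * s * t) @[t --> +oo] --> (0 : R).
    apply: (@cvg0_dominated _ _ rho).
      by move=> t _; rewrite normrM ger0_norm ?expR_ge0// ler_piMr ?expR_ge0// norm_sin_le1.
    apply: (cvg_comp (fun t => s ^+ 2 / 2 * t ^+ 2) (fun t => expR (- t))); last exact: cvgr_expR.
    by apply: gt0_cvgMry => //; exact: cvgr_expr2.
  have := Rint_FTCy cf i_f df F0.
  rewrite mulr0 sin0 mulr0 subr0 /f RintegralB//; [|exact: integrable_scale..].
  rewrite !RintegralZl// -/I2 -/(herm_int 0 b') -/I1 => /eqP.
  rewrite subr_eq0 expr2 -!mulrA => /eqP/(mulfI _) -> //.
  by rewrite gt_eqF.
have [le0b|lb0] := leP 0 b.
  have [z _] := MVT_everywhere le0b dJ.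
  rewrite mul0r => /eqP; rewrite subr_eq0 => /eqP ->.
  rewrite expr0n/= mul0r expR0 mul1r; apply: eq_Rintegral => t _.
  by rewrite herm_re0 mul0r cos0 mulr1.
have [z _] := MVT_everywhere (ltW lb0) dJ.
rewrite mul0r => /eqP; rewrite subr_eq0 => /eqP <-.
rewrite expr0n/= mul0r expR0 mul1r; apply: eq_Rintegral => t _.
by rewrite herm_re0 mul0r cos0 mulr1.
Qed.

(** Both sides obey the three-term Hermite recursion and start from [gauss_mass], whose value is
    left open because it cancels in the correlation. *)
Lemma herm_int_hermite n x : n%:R < c ^+ 2 ->
  expR ((x - c) ^+ 2 / 2) * c ^+ n * herm_int n (x - c) = gauss_mass * hermite n x.
Proof.
set b := x - c; set e := expR _.
have xE : b + c = x by rewrite subrK.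
(* Carrying the preceding index along through [shift] turns the two-step recursion into a simple
   induction. *)
suff: forall m, (m <= n)%N -> n%:R < c ^+ 2 ->
    e * c ^+ m * herm_int m b = gauss_mass * hermite m x /\
    shift (fun k => e * c ^+ k * herm_int k b) m =
    gauss_mass * shift (fun k => hermite k x) m.
  by move=> H nc; have [] := H n (leqnn n) nc.
move=> m mn nc; elim: m mn => [|m IH] mn.
  by rewrite expr0 !mulr1 herm_int0 /= mulr0.
have [IH1 IH2] := IH (ltnW mn); split => //.
have mc : m.+1%:R < c ^+ 2 by rewrite (le_lt_trans _ nc)// ler_nat.
have := herm_int_rec b mc; rewrite xE => E.
rewrite exprS (_ : e * (c * c ^+ m) * _ = e * c ^+ m * (c * herm_int m.+1 b)); last by ring.
rewrite E hermiteS mulrBr (mulrCA _ x) IH1 mulrBr (mulrCA gauss_mass x); congr (_ - _).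
rewrite [RHS]mulrCA -IH2; case: m {IH IH1 IH2 E mn mc} => [|m] /=; first by rewrite !(mul0r, mulr0).
by rewrite exprS; field.
Qed.

End hermite_integral.

(** * Asymptotics at the edge *)

Section elementary_bounds.
Context (R : realType).
Implicit Types (x y : R).

Lemma monotone_ge0 (f df : R -> R) : (forall x : R, is_derive x 1 f (df x)) ->
  (forall x, 0 <= x -> 0 <= df x) -> f 0 = 0 -> forall y, 0 <= y -> 0 <= f y.
Proof.
move=> d d0 f0 y y0; have [z /andP[z0 _]] := MVT_everywhere y0 d.
by rewrite f0 !subr0 => ->; rewrite mulr_ge0// d0.
Qed.

(** Applied with y of order d = N^(-1/3) and multiplied by k <= d^-3: the quadratic term is the one
    that counts and the quartic error is of order d. *)
Lemma ln1sqr_bounds y : 0 <= y ->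
  y ^+ 2 - y ^+ 4 / 2 <= ln (1 + y ^+ 2) <= y ^+ 2.
Proof.
move=> y0.
have p x : 0 < 1 + x ^+ 2 by rewrite ltr_wpDr ?sqr_ge0.
have dl x : is_derive x 1 (fun x => ln (1 + x ^+ 2)) (2 * x / (1 + x ^+ 2)).
  have d1 := dif_add (dif_cst 1 x) (dif_pow 2 (dif_id x)).
  apply: (dif_eq (@dif_comp R (@ln R) (fun x => 1 + x ^+ 2) x _ _ (@is_derive1_ln R _ (p x)) d1)).
  by rewrite /=; field; rewrite gt_eqF.
apply/andP; split; last first.
  by rewrite -ler_expR lnK ?posrE ?p// expR_ge1Dx.
rewrite -subr_ge0; apply: (@monotone_ge0 (fun y => ln (1 + y ^+ 2) - (y ^+ 2 - y ^+ 4 / 2))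
  (fun y => 2 * y ^+ 5 / (1 + y ^+ 2))) => //.
- move=> x; have d2 := dif_pow 2 (dif_id x).
  have d4 := dif_mul (dif_pow 4 (dif_id x)) (dif_cst 2^-1 x).
  apply: (dif_eq (dif_add (dl x) (dif_opp (dif_add d2 (dif_opp d4))))).
  by rewrite /=; field; rewrite gt_eqF.
- by move=> x x0; rewrite divr_ge0 ?(ltW (p x))// mulr_ge0// exprn_ge0.
- by rewrite !expr0n /= addr0 ln1 mul0r !subr0.
Qed.

(** The differences have derivatives y^4 / (1 + y^2) and y^6 / (1 + y^2). After multiplication by k
    <= d^-3 with y of order d, the cubic term becomes the t^3 / 3 of the Airy phase and the quintic
    one is of order d^2. *)
Lemma atan_bounds y : 0 <= y ->
  y - y ^+ 3 / 3 <= atan y <= y - y ^+ 3 / 3 + y ^+ 5 / 5.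
Proof.
move=> y0.
have p x : 0 < 1 + x ^+ 2 by rewrite ltr_wpDr ?sqr_ge0.
have dp x n : is_derive x 1 (fun x => x ^+ n.+1 / n.+1%:R) (x ^+ n).
  apply: (dif_eq (dif_mul (dif_pow n.+1 (dif_id x)) (dif_cst n.+1%:R^-1 x))).
  have q0 : n.+1%:R != 0 :> R by rewrite pnatr_eq0.
  by move: (n.+1%:R : R) q0 => q q0 /=; field.
have d3 x : is_derive x 1 (fun x => x - x ^+ 3 / 3) (1 - x ^+ 2).
  exact: (dif_add (dif_id x) (dif_opp (dp x 2))).
apply/andP; split; rewrite -subr_ge0.
  apply: (@monotone_ge0 (fun y => atan y - (y - y ^+ 3 / 3))
    (fun y => y ^+ 4 / (1 + y ^+ 2))) => //.
  - move=> x; apply: (dif_eq (dif_add (is_derive1_atan x) (dif_opp (d3 x)))).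
    by field; rewrite gt_eqF.
  - by move=> x x0; rewrite divr_ge0 ?(ltW (p x))// exprn_ge0.
  - by rewrite atan0 expr0n /= mul0r !subr0.
apply: (@monotone_ge0 (fun y => y - y ^+ 3 / 3 + y ^+ 5 / 5 - atan y)
    (fun y => y ^+ 6 / (1 + y ^+ 2))) => //.
- move=> x; apply: (dif_eq (dif_add (dif_add (d3 x) (dp x 4))
    (dif_opp (is_derive1_atan x)))).
  by field; rewrite gt_eqF.
- by move=> x x0; rewrite divr_ge0 ?(ltW (p x))// exprn_ge0.
- by rewrite atan0 !expr0n /= !mul0r !subr0 addr0.
Qed.

Lemma cvg_continuous (h : R -> R) (f : nat -> R) l : continuous h ->
  f n @[n --> \oo] --> l -> h (f n) @[n --> \oo] --> h l.
Proof. by move=> ch fl; exact: (cvg_comp _ _ fl (ch l)). Qed.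

Lemma expR_quotient_cvg (a : R) (d : nat -> R) : (forall n, 0 < d n) ->
  d n @[n --> \oo] --> (0 : R) ->
  (expR (a * d n) - 1) / d n @[n --> \oo] --> a.
Proof.
move=> d0 dc.
have dd : is_derive (0 : R) 1 (fun z : R => expR (a * z)) a.
  apply: (dif_eq (dif_exp (dif_mul (dif_cst a 0) (dif_id (0 : R))))).
  by rewrite mulr0 expR0; ring.
have [/cvg_ex[/= l fl] dv] := dd.
have la : l = a.
  by rewrite -dv; apply/esym/cvg_lim.
rewrite la in fl.
have h : (forall n, d n != 0) /\ d n @[n --> \oo] --> (0 : R).
  by split => // n; rewrite gt_eqF.
move: fl => /cvgr_dnbhsP/(_ _ h); apply: cvg_trans; apply: near_eq_cvg.
apply: nearW => n /=.
by rewrite /GRing.scale /= mulr1 addr0 mulr0 expR0 mulrC.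
Qed.

End elementary_bounds.

Section edge_scaling.
Context (R : realType).
Local Notation mu := (@lebesgue_measure R).
Local Notation Y := (`[0, +oo[%classic : set R).

(* With N = n + 1, edge_d = N^(-1/3), and edge_c = N^(1/2) exp (N^(-1/3)) is
   the abscissa of the vertical line carrying the integral for the Hermite
   polynomials; edge_x a is the spectral point 2 N^(1/2) + a / N^(1/6). *)
Definition edge_s (n : nat) : R := n.+1%:R `^ (1 / 6).
Definition edge_d n : R := (edge_s n ^+ 2)^-1.
Definition edge_c n : R := edge_s n ^+ 3 * expR (edge_d n).
Definition edge_x (a : R) n : R := 2 * edge_s n ^+ 3 + a / edge_s n.

Lemma edge_s_gt0 n : 0 < edge_s n. Proof. by rewrite powR_gt0. Qed.

Lemma edge_s6 n : edge_s n ^+ 6 = n.+1%:R.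
Proof.
rewrite /edge_s -powR_mulrn ?powR_ge0// -powRrM.
by rewrite (_ : 1 / 6 * 6%:R = 1) ?powRr1//; field.
Qed.

Lemma edge_sqrt n : Num.sqrt n.+1%:R = edge_s n ^+ 3.
Proof.
rewrite -edge_s6 (_ : edge_s n ^+ 6 = (edge_s n ^+ 3) ^+ 2); last by rewrite -exprM.
by rewrite sqrtr_sqr ger0_norm// exprn_ge0// ltW// edge_s_gt0.
Qed.

Lemma edge_d_gt0 n : 0 < edge_d n.
Proof. by rewrite invr_gt0 exprn_gt0// edge_s_gt0. Qed.

Lemma edge_d3 n : edge_d n ^+ 3 = n.+1%:R^-1.
Proof. by rewrite /edge_d exprVn -exprM edge_s6. Qed.

Lemma edge_d_le1 n : edge_d n <= 1.
Proof.
rewrite leNgt; apply/negP => d1.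
have : 1 < edge_d n ^+ 3 by rewrite exprn_egt1.
by rewrite edge_d3 ltNge invf_le1// ler1n.
Qed.

Lemma edge_d_cvg : edge_d n @[n --> \oo] --> (0 : R).
Proof.
apply/cvgrPdist_lt => e e0; near=> n.
rewrite sub0r normrN gtr0_norm ?edge_d_gt0//.
rewrite -(@ltr_pXn2r _ 3) ?nnegrE ?(ltW e0) ?(ltW (edge_d_gt0 n))//.
rewrite edge_d3 invf_plt ?posrE ?exprn_gt0//.
apply: (@lt_le_trans _ _ n%:R); last by rewrite ler_nat.
by near: n; exact: nbhs_infty_gtr.
Unshelve. all: by end_near. Qed.

Lemma edge_c_gt0 n : 0 < edge_c n.
Proof. by rewrite mulr_gt0 ?expR_gt0// exprn_gt0// edge_s_gt0. Qed.

Lemma edge_c_sqr n : n.+1%:R / edge_c n ^+ 2 = expR (- (2 * edge_d n)).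
Proof.
by rewrite /edge_c exprMn -exprM edge_s6 -expRM_natl invfM mulrA divff ?mul1r ?expRN.
Qed.

Lemma edge_subcritical n (k : nat) : (k <= n.+1)%N -> k%:R < edge_c n ^+ 2.
Proof.
move=> kn; apply: (@le_lt_trans _ _ n.+1%:R); first by rewrite ler_nat.
have c2 : 0 < edge_c n ^+ 2 by rewrite exprn_gt0// edge_c_gt0.
rewrite -[ltRHS]mul1r -ltr_pdivrMr// edge_c_sqr.
by rewrite -expR0 ltr_expR oppr_lt0 mulr_gt0// edge_d_gt0.
Qed.

Definition edge_int (a : R) n (k : nat) : R :=
  herm_int (edge_c n) (edge_s n) k (edge_x a n - edge_c n).

(** With d = [edge_d n], one has k / c^2 <= exp (- 2 d) <= 1 / (1 + 2 d), so the rate is at least 1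
    / (1 + 2 d), hence at least 1 / 3 as d <= 1. *)
Lemma edge_rate n (k : nat) : (k <= n.+1)%N ->
  1 / 3 <= (1 - k%:R / edge_c n ^+ 2) / 2 * edge_s n ^+ 2.
Proof.
move=> kn; have d0 := edge_d_gt0 n; have d1 := edge_d_le1 n.
have c2 : 0 < edge_c n ^+ 2 by rewrite exprn_gt0// edge_c_gt0.
have h1 : k%:R / edge_c n ^+ 2 <= expR (- (2 * edge_d n)).
  by rewrite -edge_c_sqr ler_pM2r ?invr_gt0// ler_nat.
have h2 : expR (- (2 * edge_d n)) <= (1 + 2 * edge_d n)^-1.
  rewrite expRN lef_pV2 ?posrE ?expR_gt0 ?expR_ge1Dx//.
  by rewrite addr_gt0// mulr_gt0.
have sE : edge_s n ^+ 2 = (edge_d n)^-1 by rewrite /edge_d invrK.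
rewrite sE ler_pdivlMr//.
move: (edge_d n) d0 d1 (le_trans h1 h2) => d d0 d1 {h1 h2}.
move: (_ / _) => r h2.
have h3 : (1 + 2 * d)^-1 <= 1 - 2 / 3 * d.
  rewrite -[leLHS]mul1r ler_pdivrMr; last by lra.
  have h : 0 <= 4 / 3 * (d * (1 - d)).
    by rewrite mulr_ge0// mulr_ge0 ?subr_ge0// ltW.
  rewrite -subr_ge0; apply: le_trans h _; rewrite le_eqVlt; apply/orP; left.
  by apply/eqP; field.
by have := le_trans h2 h3; lra.
Qed.

(** Everything is expressed through d = N^(-1/3): the degree is [th / d ^+ 3] and s t / c is y = t d
    exp (- d). Exponent and phase are then squeezed by the Taylor bounds for ln and atan. *)
Lemma edge_integrand_cvg (a u t : R) (j : nat -> nat) : 0 <= t ->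
  (forall n, (j n <= n.+1)%N) ->
  (j n)%:R * edge_d n @[n --> \oo] --> u ->
  herm_re (edge_c n) (edge_s n) (n.+1 - j n)%N (edge_x a n - edge_c n) t
    @[n --> \oo] --> expR (- t ^+ 2) * cos (t ^+ 3 / 3 - t + (a + u) * t).
Proof.
move=> t0 jn ju.
pose d n := edge_d n; pose e n := expR (- d n).
have d0 n : 0 < d n by exact: edge_d_gt0.
have dc : d n @[n --> \oo] --> (0 : R) by exact: edge_d_cvg.
have ec : e n @[n --> \oo] --> (1 : R).
  have -> : (1 : R) = expR (- 0) by rewrite oppr0 expR0.
  by apply: (cvg_continuous (@continuous_expR R)); exact: cvgN.
(* The ratio (N - j) / N, since 1 / N = d^3, written with the convergent product j d. *)
pose th n : R := 1 - (j n)%:R * d n * d n ^+ 2.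
have thc : th n @[n --> \oo] --> (1 : R).
  have -> : (1 : R) = 1 - u * (0 * 0) by rewrite !mulr0 subr0.
  apply: cvgB; first exact: cvg_cst.
  apply: cvgM => //.
  by under eq_fun do rewrite expr2; exact: cvgM.
pose y n := t * (d n * e n).
have y0 n : 0 <= y n by rewrite mulr_ge0// mulr_ge0 ?expR_ge0// ltW.
have s0 n := edge_s_gt0 n.
have sn0 n : edge_s n != 0 by rewrite gt_eqF.
have yE n : edge_s n * t / edge_c n = y n.
  rewrite /y /e /d expRN /edge_c /edge_d.
  by have := expR_gt0 (edge_s n ^+ 2)^-1; move: (expR _) => E E0; field; rewrite sn0 gt_eqF.
have kE n : (n.+1 - j n)%:R = th n / d n ^+ 3.
  rewrite natrB// /th /d -[n.+1%:R]invrK -edge_d3.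
  by have := d0 n; rewrite /d => dn0; field; rewrite gt_eqF.
have dn n : d n != 0 by rewrite gt_eqF.
have y4c m : th n * d n ^+ m.+1 * (t ^+ m.+4 * e n ^+ m.+4) @[n --> \oo] --> (0 : R).
  have -> : (0 : R) = 1 * 0 * (t ^+ m.+4 * 1).
    by rewrite mulr0 mul0r.
  apply: cvgM; [apply: cvgM => //|].
  - rewrite -[X in _ --> X](expr0n R m.+1).
    exact: (cvg_comp _ (fun x : R => x ^+ m.+1) dc (@exprn_continuous R m.+1 0)).
  - apply: cvgM; first exact: cvg_cst.
    rewrite -[X in _ --> X](expr1n R m.+4).
    exact: (cvg_comp _ (fun x : R => x ^+ m.+4) ec (@exprn_continuous R m.+4 1)).
have expc : herm_exp (edge_c n) (edge_s n) (n.+1 - j n) t @[n --> \oo] --> - t ^+ 2.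
  (* The exponent with ln (1 + y^2) replaced by y^2; B below is the quartic error. *)
  pose A n := t ^+ 2 / 2 * ((expR (- 2 * d n) - 1) / d n
                - (j n)%:R * d n * d n * expR (- 2 * d n)).
  have Ac : A n @[n --> \oo] --> - t ^+ 2.
    have -> : - t ^+ 2 = t ^+ 2 / 2 * (- 2 - u * 0 * expR (- 2 * 0)) by rewrite mulr0 mul0r; field.
    apply: cvgM; first exact: cvg_cst.
    apply: cvgB; first exact: expR_quotient_cvg.
    apply: cvgM; first exact: cvgM.
    by apply: (cvg_continuous (@continuous_expR R)); apply: cvgM => //; exact: cvg_cst.
  pose B n := th n * d n ^+ 1 * (t ^+ 4 * e n ^+ 4) / 4.
  have Bc : A n - B n @[n --> \oo] --> - t ^+ 2.
    rewrite -[X in _ --> X]subr0 -[in X in _ --> _ - X](mul0r 4^-1).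
    apply: cvgB => //; apply: cvgM; [exact: (y4c 0)|exact: cvg_cst].
  apply: (squeeze_cvgr _ Bc Ac); apply: nearW => n.
  have e2 : expR (- 2 * d n) = e n ^+ 2 by rewrite /e -expRM_natl; congr expR; ring.
  have k0 : 0 <= th n / d n ^+ 3 by rewrite -kE.
  rewrite /herm_exp /pol_log yE kE.
  have /andP[l1 l2] := ln1sqr_bounds (y0 n).
  have E1 : A n = th n / d n ^+ 3 * (y n ^+ 2 / 2) - (edge_s n * t) ^+ 2 / 2.
    rewrite /A e2 /y /th (exprMn 2 (edge_s n) t).
    rewrite (_ : edge_s n ^+ 2 = (d n)^-1); last by rewrite /d /edge_d invrK.
    by move: (d n) (e n) (dn n) => dd ee ddn; field.
  have E2 : B n = th n / d n ^+ 3 * (y n ^+ 4 / 4).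
    by rewrite /B /y; move: (d n) (e n) (dn n) => dd ee ddn; field.
  rewrite E1 E2; apply/andP; split.
    rewrite addrAC lerD2r -mulrBr ler_wpM2l//.
    by move: l1; set z := ln _; lra.
  by rewrite lerD2r ler_wpM2l// ler_pM2r// invr_gt0.
have phc : herm_phase (edge_c n) (edge_s n) (n.+1 - j n) (edge_x a n - edge_c n) t
    @[n --> \oo] --> - (t ^+ 3 / 3 - t + (a + u) * t).
  (* The square of q is (exp d - 2 + exp (- d)) / d^2, which collects the terms of order d^-2 in the
     phase. They add up to a finite limit because the two saddle points merge at the edge. *)
  pose q n := (expR (1 / 2 * d n) - 1) / d n - (expR (- (1 / 2) * d n) - 1) / d n.
  have qc : q n @[n --> \oo] --> (1 : R).
    have -> : (1 : R) = 1 / 2 - (- (1 / 2)) by field.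
    by apply: cvgB; exact: expR_quotient_cvg.
  pose A n := t * (q n ^+ 2 - (j n)%:R * d n * e n - a)
     - th n * (t ^+ 3 * e n ^+ 3) / 3.
  have Ac : A n @[n --> \oo] --> - (t ^+ 3 / 3 - t + (a + u) * t).
    have -> : - (t ^+ 3 / 3 - t + (a + u) * t) =
        t * (1 ^+ 2 - u * 1 - a) - 1 * (t ^+ 3 * 1 ^+ 3) / 3 by rewrite !expr1n; field.
    apply: cvgB.
      apply: cvgM; first exact: cvg_cst.
      apply: cvgB; last exact: cvg_cst.
      apply: cvgB; last exact: cvgM.
      exact: (cvg_comp _ (fun x : R => x ^+ 2) qc (@exprn_continuous R 2 1)).
    apply: cvgM; last exact: cvg_cst.
    apply: cvgM => //; apply: cvgM; first exact: cvg_cst.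
    exact: (cvg_comp _ (fun x : R => x ^+ 3) ec (@exprn_continuous R 3 1)).
  pose B n := th n * d n ^+ 2 * (t ^+ 5 * e n ^+ 5) / 5.
  have Bc : A n + B n @[n --> \oo] --> - (t ^+ 3 / 3 - t + (a + u) * t).
    rewrite -[X in _ --> X]addr0 -[in X in _ --> _ + X](mul0r 5^-1).
    by apply: cvgD => //; apply: cvgM; [exact: (y4c 1)|exact: cvg_cst].
  apply: (squeeze_cvgr _ Ac Bc); apply: nearW => n.
  have k0 : 0 <= th n / d n ^+ 3 by rewrite -kE.
  rewrite /herm_phase /pol_arg yE kE.
  have /andP[l1 l2] := atan_bounds (y0 n).
  have E1 : A n = th n / d n ^+ 3 * (y n - y n ^+ 3 / 3)
      - (edge_x a n - edge_c n) * (edge_s n * t).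
    have -> : (edge_x a n - edge_c n) * (edge_s n * t) =
        t * ((2 - (e n)^-1) / d n ^+ 2 + a).
      rewrite /edge_x /edge_c /e expRN invrK /d /edge_d.
      by move: (expR _) => E; field.
    pose h := expR (1 / 2 * d n).
    have h0 : h != 0 by rewrite gt_eqF ?expR_gt0.
    have eE : e n = (h ^+ 2)^-1.
      by rewrite /e /h -expRM_natl expRN; congr (_^-1); congr expR; field.
    have qE : q n = (h - h^-1) / d n.
      by rewrite /q mulNr expRN -/h; field; rewrite dn h0.
    rewrite /A qE eE /y eE /th.
    by move: (d n) (dn n) => dd ddn; field; rewrite ddn h0.
  have E2 : B n = th n / d n ^+ 3 * (y n ^+ 5 / 5).
    by rewrite /B /y; move: (d n) (e n) (dn n) => dd ee ddn; field.
  rewrite E1 E2; apply/andP; split.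
    by rewrite lerD2r ler_wpM2l.
  have := ler_wpM2l k0 l2; rewrite mulrDr.
  by move: (_ * atan _) (_ * (edge_s n * t)) (_ * (y n - _)) (_ * (_ / 5)) => *; lra.
rewrite -[cos _]cosN; apply: cvgM.
  exact: (cvg_continuous (@continuous_expR R) expc).
exact: (cvg_continuous (@continuous_cos R) phc).
Qed.

Lemma edge_int_bound a n (k : nat) : (k <= n.+1)%N -> forall t,
  `|herm_re (edge_c n) (edge_s n) k (edge_x a n - edge_c n) t| <=
  expR (- (1 / 3 * t ^+ 2)).
Proof.
move=> kn t.
have [h _] := herm_bound (edge_s n) (edge_c_gt0 n) (edge_x a n - edge_c n) t
  (ltW (edge_subcritical kn)).
rewrite (le_trans h)// ler_expR lerN2 ler_wpM2r ?sqr_ge0//.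
exact: edge_rate.
Qed.

Lemma edge_int_cvg (a u : R) (j : nat -> nat) : (forall n, (j n <= n.+1)%N) ->
  (j n)%:R * edge_d n @[n --> \oo] --> u ->
  edge_int a n (n.+1 - j n)%N @[n --> \oo] --> airyC 0 (a + u).
Proof.
move=> jn ju.
have p3 : 0 < 1 / 3 :> R by lra.
have [|||||_ h] := @Rdominated_cvg R Y (fun n t =>
    herm_re (edge_c n) (edge_s n) (n.+1 - j n)%N (edge_x a n - edge_c n) t)
  (fun t => expR (- t ^+ 2) * cos (t ^+ 3 / 3 - t + (a + u) * t))
  (fun t => expR (- (1 / 3 * t ^+ 2))).
- by [].
- move=> n; apply: measurable_cont.
  exact: (continuous_herm_re (edge_c_gt0 n)).
- by move=> t; rewrite /= in_itv/= andbT => t0; exact: edge_integrand_cvg.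
- exact: gauss_integrable p3.
- by move=> n t _; apply: edge_int_bound; exact: leq_subr.
rewrite /airyC; under eq_Rintegral do rewrite expr0 mul1r.
exact: h.
Qed.

(** The spectral parameter a enters only the phase, so the Gaussian bound is uniform in it as
    well. *)
Lemma edge_int_le : exists2 M, 0 < M & forall a n (k : nat), (k <= n.+1)%N ->
  `|edge_int a n k| <= M.
Proof.
have p3 : 0 < 1 / 3 :> R by lra.
exists (\int[mu]_(t in Y) expR (- (1 / 3 * t ^+ 2))).
  apply: (@Rint_Y_gt0 _ _ 0) => //.
    exact: (@dif_continuous _ _ (fun t => _)).
  exact: gauss_integrable p3.
move=> a n k kn; apply: Rint_abs_le => //.
- exact: (herm_re_integrable (edge_c_gt0 n) (edge_s_gt0 n) (edge_subcritical kn)).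
- exact: gauss_integrable p3.
- by move=> t _; exact: edge_int_bound.
Qed.

End edge_scaling.

(** * Growth of the coefficients *)

Section expsq_asymptotics.
Context (R : realType) (b : R).

(** Only even indices contribute, so these are partial sums of the exponential series at b, cut at
    half the index. *)
Lemma expsq_coef1_series n :
  expsq_coef1 b n = series (exp_coeff b) (n./2).+1.
Proof.
have E m : expsq_coef1 b m.*2 = series (exp_coeff b) m.+1.
  elim: m => [|m IH].
    by rewrite /expsq_coef1 /psum /series /= big_ord1 big_nat1.
  have -> : series (exp_coeff b) m.+2 = series (exp_coeff b) m.+1 + exp_coeff b m.+1.
    by rewrite /series /= big_nat_recr.
  by rewrite -IH doubleS /expsq_coef1 !psumS -doubleS expsq_coef_odd addr0 expsq_coef_double.
rewrite -{1}(odd_double_half n); case: (odd n) => /=; last exact: E.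
by rewrite add1n /expsq_coef1 psumS expsq_coef_odd addr0; exact: E.
Qed.

Lemma expsq_coef1_cvg : expsq_coef1 b n @[n --> \oo] --> expR b.
Proof.
under eq_fun do rewrite expsq_coef1_series.
have h : series (exp_coeff b) n.+1 @[n --> \oo] --> expR b.
  have := cvg_shiftS (series (exp_coeff b)) => ->.
  exact: (is_cvg_series_exp_coeff b).
apply: (cvg_comp (fun n => n./2) (fun n => series (exp_coeff b) n.+1)); last exact: h.
apply/cvgnyPge => A; near=> n; rewrite -[A]doubleK; apply: half_leq.
by near: n; exact: nbhs_infty_ge.
Unshelve. all: by end_near. Qed.

(** [expsq_coef2] sums [expsq_coef1], so the quotient is a Cesaro mean of a convergent sequence. *)
Lemma expsq_coef2_cvg : expsq_coef2 b n / n.+1%:R @[n --> \oo] --> expR b.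
Proof.
have := cesaro expsq_coef1_cvg; rewrite /arithmetic_mean /=.
apply: cvg_trans; apply: near_eq_cvg; apply: nearW => n /=.
by rewrite /series /= big_mkord mulrC.
Qed.

Lemma expsq_coef2_le : exists2 C, 0 < C &
  forall n, `|expsq_coef2 b n| <= C * n.+1%:R.
Proof.
have : cvgn (fun n => expsq_coef2 b n / n.+1%:R).
  by apply/cvg_ex; exists (expR b); exact: expsq_coef2_cvg.
move=> /cvg_seq_bounded [M [Mr MP]].
exists (`|M| + 1); first by rewrite ltr_pwDr.
have M1 : M < `|M| + 1 by rewrite (le_lt_trans (ler_norm _))// ltrDl.
move=> n; have /= := MP _ M1 n I.
by rewrite normrM normfV normr_nat ler_pdivrMr.
Qed.

End expsq_asymptotics.

(** * The covariance as a Riemann sum *)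

Section edge_limit.
Context (R : realType).
Local Notation mu := (@lebesgue_measure R).
Local Notation Y := (`[0, +oo[%classic : set R).
Local Notation d := (@edge_d R).

(** With N = n + 1, the ratio N! / ((N - j)! N^j): what the factor 1 / k! of [hermite_pair] leaves
    after normalisation. It is close to 1 when j^2 / N is small, as for j of order N^(1/3). *)
Definition edge_weight n j : R := (n.+1 ^_ j)%:R / n.+1%:R ^+ j.

Lemma edge_weightS n j : (j <= n.+1)%N ->
  edge_weight n j.+1 = edge_weight n j * (1 - j%:R / n.+1%:R).
Proof.
move=> jn; rewrite /edge_weight ffactnSr natrM natrB// exprSr invfM.
have : n.+1%:R != 0 :> R by rewrite pnatr_eq0.
by move: (n.+1%:R : R) (_ ^_ j)%:R (_ ^- j) => q f p q0; field.
Qed.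

Lemma edge_weight_bounds n j : (j <= n.+1)%N ->
  [/\ 0 <= edge_weight n j, edge_weight n j <= 1
    & 1 - j%:R ^+ 2 / n.+1%:R <= edge_weight n j].
Proof.
elim: j => [|j IH] jn.
  by rewrite /edge_weight ffactn0 expr0 divr1 ler01 lexx expr0n /= mul0r subr0.
have [w0 w1 w2] := IH (ltnW jn).
have p : 0 < n.+1%:R :> R by rewrite ltr0n.
rewrite (edge_weightS (ltnW jn)).
have r0 : 0 <= j%:R / n.+1%:R :> R by rewrite divr_ge0.
have r1 : j%:R / n.+1%:R <= 1 :> R by rewrite ler_pdivrMr// mul1r ler_nat ltnW.
have E : (j.+1%:R ^+ 2 : R) / n.+1%:R =
    j%:R ^+ 2 / n.+1%:R + j%:R / n.+1%:R + (j%:R / n.+1%:R + n.+1%:R^-1).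
  by rewrite -natr1; ring.
have q0 : 0 <= j%:R ^+ 2 / n.+1%:R :> R by rewrite divr_ge0 ?sqr_ge0.
have s0 : 0 < n.+1%:R^-1 :> R by rewrite invr_gt0.
have h1 : 0 <= (edge_weight n j - (1 - j%:R ^+ 2 / n.+1%:R)) * (1 - j%:R / n.+1%:R).
  by rewrite mulr_ge0 ?subr_ge0.
have h2 := mulr_ge0 q0 r0.
have h3 := mulr_ge0 w0 r0.
rewrite E; move: h1 h2 h3 w0 w1 w2 r0 r1 q0 s0.
move: (edge_weight n j) (j%:R / n.+1%:R : R) (j%:R ^+ 2 / n.+1%:R : R) (n.+1%:R^-1 : R).
move=> w r q z *.
by split; [rewrite mulr_ge0 ?subr_ge0|lra|lra].
Qed.

(** The factors free of j come first and treat a and a' separately, so they cancel in the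
    correlation. The powers of c, combined with the N^j released by [edge_weight], give exactly exp
    (- 2 j d), shared equally between the two profiles. *)
Lemma hermite_pair_edge a a' n j : (j <= n.+1)%N ->
  hermite_pair (edge_x a n) (edge_x a' n) (n.+1 - j) =
  (gauss_mass (edge_s R n)) ^- 2 * (edge_c R n ^+ n.+1 ^+ 2 / n.+1`!%:R) *
  (expR ((edge_x a n - edge_c R n) ^+ 2 / 2) * expR ((edge_x a' n - edge_c R n) ^+ 2 / 2)) *
  (edge_weight n j * (expR (- (j%:R * d n)) * edge_int a n (n.+1 - j) *
    (expR (- (j%:R * d n)) * edge_int a' n (n.+1 - j)))).
Proof.
move=> jn; have sub := edge_subcritical R (leq_subr j n.+1).
have gn : gauss_mass (edge_s R n) != 0 by rewrite gt_eqF// gauss_mass_gt0 ?edge_s_gt0.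
have hE x := herm_int_hermite (edge_c_gt0 R n) (edge_s_gt0 R n) x sub.
have c0 : edge_c R n != 0 by rewrite gt_eqF ?edge_c_gt0.
have HE x : hermite (n.+1 - j) x = (gauss_mass (edge_s R n))^-1 *
    (expR ((x - edge_c R n) ^+ 2 / 2) * edge_c R n ^+ (n.+1 - j) *
     herm_int (edge_c R n) (edge_s R n) (n.+1 - j) (x - edge_c R n)).
  by rewrite hE mulKf.
have fE : (n.+1`!%:R : R) = (n.+1 ^_ j)%:R * (n.+1 - j)`!%:R by rewrite -natrM ffact_fact.
have f0 m : m`!%:R != 0 :> R by rewrite pnatr_eq0 -lt0n fact_gt0.
have F0 : (n.+1 ^_ j)%:R != 0 :> R.
  by have := f0 n.+1; rewrite fE mulf_eq0 negb_or => /andP[].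
have cE : edge_c R n ^+ n.+1 = edge_c R n ^+ (n.+1 - j) * edge_c R n ^+ j.
  by rewrite -exprD subnK.
have eE : expR (- (j%:R * d n)) * expR (- (j%:R * d n)) =
    n.+1%:R ^+ j / (edge_c R n ^+ j) ^+ 2.
  rewrite -expRD -exprM mulnC exprM -expr_div_n edge_c_sqr -expRM_natl; congr expR.
  by ring.
rewrite /hermite_pair !HE -!/(edge_int _ _ _) /edge_weight fE cE.
have N0 : n.+1%:R ^+ j != 0 :> R by rewrite expf_neq0// pnatr_eq0.
have c1 : edge_c R n ^+ j != 0 by rewrite expf_neq0.
move: eE (edge_int a n _) (edge_int a' n _); move: (expR (- (j%:R * d n))) => e eE I1 I2.
have -> : e * I1 * (e * I2) = e * e * (I1 * I2) by ring.
rewrite eE; move: (f0 (n.+1 - j)%N) gn F0 c1 N0.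
move: (expR _) (expR _) (_ `!%:R) (gauss_mass _) (_ ^_ _)%:R (edge_c R n ^+ j).
move: (n.+1%:R ^+ j) (edge_c R n ^+ (n.+1 - j)).
move=> G H A B C D F K C0 D0 F0 K0 G0; field.
by rewrite K0 G0 C0 F0 D0.
Qed.

Definition edge_prof a n j : R := expR (- (j%:R * d n)) * edge_int a n (n.+1 - j).

(** The index is j = N - k = i + 1; j = 0 would be the product of the means, absent from the
    covariance. *)
Definition edge_term b a a' n i : R := expsq_coef2 b i.+1 *
  (edge_weight n i.+1 * (edge_prof a n i.+1 * edge_prof a' n i.+1)).

(** One factor d is the mesh of the Riemann sum in u = j d, the other normalises the coefficient,
    which is of order j. *)
Definition edge_cov b a a' n : R :=
  d n ^+ 2 * \sum_(i < n.+1) edge_term b a a' n i.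

(** Only the shape K E(a) E(a') of the prefactor matters, since [cosine_rescale] removes it from the
    correlation. *)
Lemma hermite_cov_edge b n : exists K (E : R -> R), [/\ 0 < K, (forall a, 0 < E a) &
  forall a a', hermite_cov b n.+1 (edge_x a n) (edge_x a' n) =
    K * (E a * E a') * edge_cov b a a' n].
Proof.
exists ((gauss_mass (edge_s R n)) ^- 2 * (edge_c R n ^+ n.+1 ^+ 2 / n.+1`!%:R) / d n ^+ 2).
exists (fun a => expR ((edge_x a n - edge_c R n) ^+ 2 / 2)).
have d0 := edge_d_gt0 R n.
split.
- have g0 := gauss_mass_gt0 (edge_s_gt0 R n); have c0 := edge_c_gt0 R n.
  by rewrite !mulr_gt0// ?invr_gt0 ?exprn_gt0// ltr0n fact_gt0.
- by move=> a; exact: expR_gt0.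
move=> a a'; rewrite /hermite_cov (reindex_inj rev_ord_inj) /= /edge_cov.
rewrite mulrA; under eq_bigr => i _.
  rewrite hermite_pair_edge// subKn// mulrCA; over.
rewrite -mulr_sumr; congr (_ * _).
by rewrite [RHS]mulrAC divfK// expf_neq0// gt_eqF.
Qed.

End edge_limit.

Section step_function.
Context (R : realType).
Local Notation mu := (@lebesgue_measure R).
Local Notation Y := (`[0, +oo[%classic : set R).

Definition step_fun (h : R) (m : nat) (g : nat -> R) (u : R) : R :=
  \sum_(i < m) g i * \1_(`[i%:R * h, i.+1%:R * h[%classic) u.

Lemma step_funE h m g u : 0 < h -> 0 <= u ->
  step_fun h m g u =
  if (Num.truncn (u / h) < m)%N then g (Num.truncn (u / h)) else 0.
Proof.
move=> h0 u0; have E (i : nat) : \1_(`[i%:R * h, i.+1%:R * h[%classic) u =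
    (Num.truncn (u / h) == i)%:R :> R.
  rewrite indicE truncn_eq ?divr_ge0 ?(ltW h0)// ler_pdivlMr// ltr_pdivrMr//.
  congr ((nat_of_bool _)%:R).
  by rewrite mem_setE in_itv.
rewrite /step_fun; under eq_bigr do rewrite E.
case: ifPn => [tm|tm].
  rewrite (bigD1 (Ordinal tm))//= eqxx mulr1 big1 ?addr0// => i it.
  by rewrite (_ : (_ == _) = false) ?mulr0//; apply/negbTE; rewrite eq_sym.
rewrite big1// => i _; rewrite (_ : (_ == _) = false) ?mulr0//.
by apply: contraNF tm => /eqP ->.
Qed.

Lemma measurable_step h m g D : measurable_fun D (step_fun h m g).
Proof.
apply: measurable_funTS; apply: measurable_sum => i.
by apply: measurable_funM.
Qed.

Lemma step_integral (h : R) m g : 0 < h ->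
  mu.-integrable Y (EFin \o step_fun h m g) /\
  \int[mu]_(u in Y) step_fun h m g u = h * \sum_(i < m) g i.
Proof.
move=> h0; pose J i := (`[i%:R * h, i.+1%:R * h[%classic : set R).
have iJ i : mu.-integrable Y (EFin \o (fun u => g i * \1_(J i) u)).
  apply: integrable_scale => //; apply: (@integrableS _ _ _ _ setT) => //.
  exact: integrable_indic_itv.
have vJ i : \int[mu]_(u in Y) (g i * \1_(J i) u) = h * g i.
  rewrite RintegralZl//; last first.
    by apply: (@integrableS _ _ _ _ setT) => //; exact: integrable_indic_itv.
  have -> : \int[mu]_(u in Y) \1_(J i) u = fine (mu (J i `&` Y)).
    by rewrite /Rintegral integral_indic //; exact: measurable_itv.
  rewrite (_ : J i `&` Y = J i); last first.
    apply/setIidl => u; rewrite /J /= !in_itv/= andbT => /andP[+ _].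
    by apply: le_trans; rewrite mulr_ge0// ltW.
  rewrite lebesgue_measure_itv /= lte_fin ltr_pM2r// ltr_nat ltnSn -EFinB /=.
  by rewrite -mulrBl -natrB// subSnn mul1r mulrC.
elim: m => [|m [IH1 IH2]].
  have E : step_fun h 0 g = cst 0 by apply/funext => u; rewrite /step_fun big_ord0.
  rewrite E big_ord0 mulr0; split; first exact: integrable0.
  by rewrite Rintegral_cst// mul0r.
have E : step_fun h m.+1 g = (fun u => step_fun h m g u + g m * \1_(J m) u).
  by apply/funext => u; rewrite /step_fun big_ord_recr.
rewrite E; split; first exact: integrable_add.
by rewrite RintegralD// IH2 vJ big_ord_recr /= mulrDr.
Qed.

End step_function.

Section edge_cov_limit.
Context (R : realType).
Local Notation mu := (@lebesgue_measure R).
Local Notation Y := (`[0, +oo[%classic : set R).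
Local Notation d := (@edge_d R).

Let cell n (u : R) : nat := Num.truncn (u / d n).
(** The cap makes this a valid index for every n; by [cell_lt] it is eventually inactive. *)
Let idx n u : nat := minn (cell n u).+1 n.+1.

Let d0 n : 0 < d n. Proof. exact: edge_d_gt0. Qed.

Let cell_lt u : 0 <= u -> \forall n \near \oo, (cell n u < n.+1)%N.
Proof.
move=> u0; have u1 : 0 < u + 1 by rewrite ltr_wpDl.
have u2 : 0 < (u + 1)^-1 by rewrite invr_gt0.
have h := proj1 (cvgrPdist_lt _ _) (@edge_d_cvg R) _ u2; near=> n.
have : `|0 - d n| < (u + 1)^-1 by near: n; exact: h.
rewrite sub0r normrN gtr0_norm// => dn.
rewrite /cell truncn_lt_nat ?divr_ge0 ?(ltW (d0 n))//.
have -> : n.+1%:R = (d n ^+ 3)^-1 by rewrite edge_d3 invrK.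
rewrite ltr_pdivrMr// (_ : _ * d n = (d n ^+ 2)^-1); last first.
  by field; rewrite gt_eqF.
have h2 : u + 1 < (d n)^-1 by rewrite -[ltLHS]invrK ltf_pV2 ?posrE.
have h3 : 1 <= (d n)^-1 by rewrite invf_ge1 ?edge_d_le1.
rewrite expr2 invfM (@lt_le_trans _ _ ((d n)^-1))//.
  by rewrite (lt_trans _ h2)// ltrDl.
by rewrite ler_peMl// (le_trans _ h3).
Unshelve. all: by end_near. Qed.

Let idx_cvg u : 0 <= u -> (idx n u)%:R * d n @[n --> \oo] --> u.
Proof.
move=> u0.
have c1 : u + d n @[n --> \oo] --> u.
  by rewrite -[X in _ --> X]addr0; apply: cvgD; [exact: cvg_cst|exact: edge_d_cvg].
apply: (squeeze_cvgr _ (cvg_cst u) c1); near=> n.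
have -> : idx n u = (cell n u).+1.
  by apply/minn_idPl; near: n; exact: cell_lt.
have /truncn_itv/andP[] : 0 <= u / d n by rewrite divr_ge0// ltW.
rewrite -/(cell n u) ler_pdivlMr// ltr_pdivrMr// => h1 /ltW ->/=.
by rewrite -natr1 mulrDl mul1r lerD2r.
Unshelve. all: by end_near. Qed.

Let coef_cvg b u : 0 <= u ->
  d n * expsq_coef2 b (idx n u) @[n --> \oo] --> u * expR b.
Proof.
move=> u0; have [C C0 CP] := expsq_coef2_le b.
have c1 : (idx n u).+1%:R * d n @[n --> \oo] --> u.
  rewrite -[X in _ --> X]addr0; under eq_fun do rewrite -natr1 mulrDl mul1r.
  by apply: cvgD; [exact: idx_cvg|exact: edge_d_cvg].
(* At u = 0 the index need not tend to infinity, so the asymptotics of the coefficient is replaced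
   by its linear bound. *)
have [u_0|un0] := eqVneq u 0.
  have c2 : C * ((idx n u).+1%:R * d n) @[n --> \oo] --> (0 : R).
    have <- : C * u = 0 by rewrite u_0 mulr0.
    by apply: cvgM => //; exact: cvg_cst.
  have -> : u * expR b = 0 by rewrite u_0 mul0r.
  apply: norm_cvg0; apply: (squeeze_cvgr _ (cvg_cst (0 : R)) c2).
  apply: nearW => n /=; rewrite normr_ge0 normrM (gtr0_norm (d0 n)) mulrC.
  by rewrite mulrA ler_pM2r// CP.
have up : 0 < u by rewrite lt_def un0.
have E n : d n * expsq_coef2 b (idx n u) = (idx n u).+1%:R * d n *
    (expsq_coef2 b (idx n u) / (idx n u).+1%:R).
  have : (idx n u).+1%:R != 0 :> R by rewrite pnatr_eq0.
  by move: (idx n u).+1%:R => q q0; field.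
under eq_fun do rewrite E.
apply: cvgM => //.
apply: (cvg_comp (fun n => idx n u) _ _ (@expsq_coef2_cvg _ b)).
apply/cvgnyPge => A.
have u2 : 0 < u / 2 by rewrite divr_gt0.
have A2 : 0 < u / 2 / A.+1%:R by rewrite divr_gt0.
have h1 := proj1 (cvgrPdist_lt _ _) (idx_cvg u0) _ u2.
have h2 := proj1 (cvgrPdist_lt _ _) (@edge_d_cvg R) _ A2.
near=> n.
have k1 : `|u - (idx n u)%:R * d n| < u / 2 by near: n; exact: h1.
have k2 : `|0 - d n| < u / 2 / A.+1%:R by near: n; exact: h2.
move: k2; rewrite sub0r normrN gtr0_norm// ltr_pdivlMr// => k2.
have k3 : u / 2 < (idx n u)%:R * d n by move: k1; rewrite ltr_norml; lra.
have : d n * A.+1%:R < d n * (idx n u)%:R by rewrite (lt_trans k2)// (mulrC (d n)).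
by rewrite ltr_pM2l// ltr_nat => /ltnW/ltnW.
Unshelve. all: by end_near. Qed.

Let idx_le n u : (idx n u <= n.+1)%N. Proof. exact: geq_minr. Qed.

Let weight_cvg u : 0 <= u -> edge_weight R n (idx n u) @[n --> \oo] --> (1 : R).
Proof.
move=> u0.
have c1 : 1 - ((idx n u)%:R * d n) ^+ 2 * d n @[n --> \oo] --> (1 : R).
  rewrite -[X in _ --> X]subr0 -[in X in _ --> X](mulr0 (u ^+ 2)).
  apply: cvgB; first exact: cvg_cst.
  apply: cvgM; last exact: edge_d_cvg.
  exact: (cvg_comp _ (fun x : R => x ^+ 2) (idx_cvg u0) (@exprn_continuous R 2 u)).
apply: (squeeze_cvgr _ c1 (cvg_cst (1 : R))); apply: nearW => n /=.
have [_ -> h] := edge_weight_bounds R (idx_le n u); rewrite andbT.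
apply: le_trans h; rewrite le_eqVlt; apply/orP; left; apply/eqP.
by rewrite -edge_d3; ring.
Qed.

Let prof_cvg a u : 0 <= u ->
  edge_prof a n (idx n u) @[n --> \oo] --> expR a * airyL (a + u).
Proof.
move=> u0; rewrite /airyL mulrA -expRD opprD addNKr.
apply: cvgM; last by apply: edge_int_cvg => //; exact: idx_cvg.
by apply: (cvg_continuous (@continuous_expR R)); apply: cvgN; exact: idx_cvg.
Qed.

Let edge_step b a a' n : R -> R :=
  step_fun (d n) n.+1 (fun i => d n * edge_term b a a' n i).

Let edge_step_int b a a' n :
  \int[mu]_(u in Y) edge_step b a a' n u = edge_cov b a a' n.
Proof.
have [_ ->] := step_integral n.+1 (fun i => d n * edge_term b a a' n i) (d0 n).
by rewrite -mulr_sumr mulrA -expr2.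
Qed.

Let edge_step_cvg b a a' u : 0 <= u -> edge_step b a a' n u @[n --> \oo] -->
  expR b * (expR a * expR a') * (u * (airyL (a + u) * airyL (a' + u))).
Proof.
move=> u0.
have c1 : d n * expsq_coef2 b (idx n u) * (edge_weight R n (idx n u) *
    (edge_prof a n (idx n u) * edge_prof a' n (idx n u))) @[n --> \oo] -->
  u * expR b * (1 * (expR a * airyL (a + u) * (expR a' * airyL (a' + u)))).
  apply: cvgM; first exact: coef_cvg.
  by apply: cvgM; [exact: weight_cvg|apply: cvgM; exact: prof_cvg].
rewrite [X in _ --> X](_ : _ = u * expR b *
  (1 * (expR a * airyL (a + u) * (expR a' * airyL (a' + u))))); last by ring.
apply: cvg_trans c1; apply: near_eq_cvg; near=> n.
have cn : (cell n u < n.+1)%N by near: n; exact: cell_lt.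
rewrite /edge_step step_funE// -/(cell n u) cn /edge_term.
by rewrite /idx (minn_idPl cn) !mulrA.
Unshelve. all: by end_near. Qed.

(** As u <= j d, each profile is at most M exp (- u), while d times the coefficient is at most C (u
    + 2). One of the two exponentials absorbs the linear factor, the other is the dominating
    function. *)
Let edge_step_le b a a' : exists C, forall n u, 0 <= u ->
  `|edge_step b a a' n u| <= C * expR (- u).
Proof.
have [C C0 CP] := expsq_coef2_le b; have [M M0 MP] := edge_int_le R.
exists (2 * C * M ^+ 2) => n u u0; rewrite /edge_step step_funE// -/(cell n u).
have p0 : 0 <= 2 * C * M ^+ 2 * expR (- u).
  by rewrite !mulr_ge0 ?expR_ge0 ?sqr_ge0// ltW.
case: ifPn => [cn|_]; last by rewrite normr0.
set j := (cell n u).+1.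
have /truncn_itv/andP[] : 0 <= u / d n by rewrite divr_ge0// ltW.
rewrite -/(cell n u) -/j ler_pdivlMr// ltr_pdivrMr// => h1 /ltW h2.
have dE1 := edge_d_le1 R n.
have h3 : d n * j.+1%:R <= u + 2.
  rewrite /j -2!natr1 !mulrDr mulr1 mulrC; lra.
have [w0 w1 _] := edge_weight_bounds R cn.
have pf c : `|edge_prof c n j| <= M * expR (- u).
  rewrite /edge_prof normrM gtr0_norm ?expR_gt0// mulrC ler_pM ?expR_ge0//.
    by rewrite MP ?leq_subr.
  by rewrite ler_expR lerN2.
rewrite /edge_term -/j (mulrA (d n)) normrM.
have q1 : `|d n * expsq_coef2 b j| <= C * (u + 2).
  rewrite normrM (gtr0_norm (d0 n)) (@le_trans _ _ (d n * (C * j.+1%:R)))//.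
    by rewrite ler_pM2l.
  by rewrite mulrCA ler_pM2l.
have q2 : `|edge_weight R n j * (edge_prof a n j * edge_prof a' n j)| <=
    1 * (M * expR (- u) * (M * expR (- u))).
  rewrite normrM (ger0_norm w0) ler_pM// normrM ler_pM//.
have q3 : (u + 2) * expR (- u) <= 2.
  rewrite expRN ler_pdivrMr ?expR_gt0//.
  by have := expR_ge1Dx u; lra.
apply: (le_trans (ler_pM (normr_ge0 _) (normr_ge0 _) q1 q2)).
rewrite [leLHS](_ : _ = C * M ^+ 2 * ((u + 2) * expR (- u)) * expR (- u)); last by ring.
rewrite ler_pM2r ?expR_gt0// [leRHS](_ : _ = C * M ^+ 2 * 2); last by ring.
by rewrite ler_pM2l// mulr_gt0 ?exprn_gt0.
Qed.

Lemma edge_cov_cvg (b a a' : R) : edge_cov b a a' n @[n --> \oo] -->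
  expR b * (expR a * expR a') * airy_kernel a a'.
Proof.
have [C CP] := edge_step_le b a a'.
have [|||||_ h] := @Rdominated_cvg R Y (edge_step b a a')
  (fun u => expR b * (expR a * expR a') * (u * (airyL (a + u) * airyL (a' + u))))
  (fun u => C * expR (- u)).
- by [].
- by move=> n; exact: measurable_step.
- by move=> u; rewrite /= in_itv/= andbT => u0; exact: edge_step_cvg.
- exact: integrable_cexpRN.
- by move=> n u; rewrite /= in_itv/= andbT; exact: CP.
rewrite /airy_kernel -RintegralZl//; last exact: integrable_kernel_fun.
by under eq_fun do rewrite -edge_step_int.
Qed.

End edge_cov_limit.

Lemma cosine_rescale (R : rcfType) (k e e' s s1 s2 : R) : 0 < k -> 0 < e -> 0 < e' ->
  k * (e * e') * s / (Num.sqrt (k * (e * e) * s1) * Num.sqrt (k * (e' * e') * s2)) =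
  s / (Num.sqrt s1 * Num.sqrt s2).
Proof.
move=> k0 e0 e'0.
have sE c x : 0 < c -> Num.sqrt (k * (c * c) * x) = Num.sqrt k * c * Num.sqrt x.
  move=> c0; rewrite sqrtrM; last by rewrite !mulr_ge0// ltW.
  by rewrite sqrtrM ?(ltW k0)// -expr2 sqrtr_sqr gtr0_norm.
rewrite !sE// mulrACA (mulrACA (Num.sqrt k)) -(expr2 (Num.sqrt k)) sqr_sqrtr ?(ltW k0)//.
by rewrite -mulf_div divff ?mul1r// !mulf_neq0// gt_eqF.
Qed.

Theorem corollary1p4 (R : realType) (Q : probability (measurableTypeR R) R)
    (Q_mean : (\int[Q]_x (x : R)%:E = 0)%E)
    (Q_var : (\int[Q]_x ((x : R) ^+ 2)%:E = 1)%E)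
    (Q_moment4 : (\int[Q]_x ((x : R) ^+ 4)%:E < +oo)%E)
    (d : nat -> measure_display) (T : forall N, measurableType (d N))
    (P : forall N, probability (T N) R)
    (X : forall N, 'I_N * 'I_N -> {RV (P N) >-> measurableTypeR R})
    (X_iid : forall N, (0 < N)%N -> iid_RVs (upper_triangle N) (@X N) Q) :
  let D N (lambda : R) (w : T N) : R :=
    char_det (wigner_mx (fun p => X N p w)) lambda in
  let sigma N (mu nu : R) : R := correlation (P N) (D N mu) (D N nu) in
  forall mu nu : R,
    sigma N (2 * Num.sqrt N%:R + mu / N%:R `^ (1 / 6))
            (2 * Num.sqrt N%:R + nu / N%:R `^ (1 / 6)) @[N --> \oo]
    --> airyB mu nu / (Num.sqrt (airyB mu mu) * Num.sqrt (airyB nu nu)).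
Proof.
move=> D sigma a a'.
pose b := half_excess Q; pose S := edge_cov b.
have sigmaE n :
    sigma n.+1 (2 * Num.sqrt n.+1%:R + a / n.+1%:R `^ (1 / 6))
               (2 * Num.sqrt n.+1%:R + a' / n.+1%:R `^ (1 / 6)) =
    S a a' n / (Num.sqrt (S a a n) * Num.sqrt (S a' a' n)).
  rewrite edge_sqrt -!/(edge_s R n) -!/(edge_x _ n) /sigma /D.
  rewrite (correlation_char_det Q_mean Q_var Q_moment4 (X_iid n.+1 isT)).
  have [K [E [K0 E0 covE]]] := hermite_cov_edge b n.
  by rewrite !covE cosine_rescale.
(* The target is rewritten with the prefactors that the limits of [edge_cov] carry, which the
   quotient does not see, so that numerator and denominator converge separately. *)
have limE : airyB a a' / (Num.sqrt (airyB a a) * Num.sqrt (airyB a' a')) =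
    expR b * (expR a * expR a') * airy_kernel a a' /
    (Num.sqrt (expR b * (expR a * expR a) * airy_kernel a a) *
     Num.sqrt (expR b * (expR a' * expR a') * airy_kernel a' a')).
  rewrite cosine_rescale ?expR_gt0// !airyBE.
  have c0 : 0 < airy_const R ^+ 2 by rewrite exprn_gt0// airy_const_gt0.
  have := @cosine_rescale R _ 1 1 (airy_kernel a a') (airy_kernel a a)
    (airy_kernel a' a') c0 ltr01 ltr01.
  by rewrite !mulr1.
rewrite limE.
have h : S a a' n / (Num.sqrt (S a a n) * Num.sqrt (S a' a' n)) @[n --> \oo] -->
    expR b * (expR a * expR a') * airy_kernel a a' /
    (Num.sqrt (expR b * (expR a * expR a) * airy_kernel a a) *
     Num.sqrt (expR b * (expR a' * expR a') * airy_kernel a' a')).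
  apply: cvgM; first exact: edge_cov_cvg.
  apply: cvgV; last first.
    by apply: cvgM; apply: (cvg_continuous (@sqrt_continuous R)); exact: edge_cov_cvg.
  rewrite mulf_neq0// gt_eqF// sqrtr_gt0 mulr_gt0 ?airy_kernel_diag_gt0//.
    by rewrite !mulr_gt0 ?expR_gt0.
  by rewrite !mulr_gt0 ?expR_gt0.
(* The shift restricts to positive sizes, where the entries are i.i.d. and [sigmaE] applies. *)
rewrite -(cvg_shiftS (fun N => sigma N (2 * Num.sqrt N%:R + a / N%:R `^ (1 / 6))
  (2 * Num.sqrt N%:R + a' / N%:R `^ (1 / 6)))).
by under eq_fun do rewrite sigmaE.
Qed.
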